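(* Let $S$ be the metric graph of a finite connected simple graph with edge lengths, of total length $\zeta$, let $M\ge1$ and let $f\in\mathcal F^M_*$. Then the following hold. (i) The function $k\mapsto m_k$ is non-decreasing. (ii) $f$ has no dormant arms. (iii) For all $t<\zeta$, $f(t)$ does not contain any vertex of degree $1$. (iv) For all $t<\zeta$, $f(t)$ has exactly $M$ disjoint connected components. (v) For all $t<\zeta$, $f(t)$ contains no loops. (vi) For all $t<\zeta$, the points of $f(0)$ are the centroids of the tree metric graphs comprising $f(t)$, i.e., of the connected components of $f(t)$. (vii) Suppose that $y\in f(0)$, $t\in(t_{k-1},t_k)$ for some $1\le k\le\mathbf k(f)$, $v,w\in\partial f(t)\cap S_y$, $v=x^k_i(t)$, $w=x^k_j(t)$. Let $S_{yv}$ be the connected component of $S_y\setminus\{v\}$ which does not contain $y$, and $S_{yw}$ the connected component of $S_y\setminus\{w\}$ which does not contain $y$. Let $\zeta_v$ and $\zeta_w$ be the total lengths of edges in $S_{yv}$ and $S_{yw}$, respectively. Then $$\frac{z^k_j}{z^k_i}=\frac{\dot x^k_j(t)}{\dot x^k_i(t)}=\frac{\zeta_w}{\zeta_v}.$$ (viii) Suppose that $y_1,y_2\in f(0)$, $t\in(t_{k-1},t_k)$ for some $1\le k\le\mathbf k(f)$, $v\in\partial f(t)\cap S_{y_1}$, $v=x^k_i(t)$, $w\in\partial f(t)\cap S_{y_2}$, $w=x^k_j(t)$. Let $S_{y_1v}$ be the connected component of $S_{y_1}\setminus\{v\}$ which does not contain $y_1$ and $S_{y_2w}$ the connected component of $S_{y_2}\setminus\{w\}$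 which does not contain $y_2$. Let $\zeta_v$ and $\zeta_w$ be the total lengths of edges in $S_{y_1v}$ and $S_{y_2w}$, respectively. Then $$\frac{z^k_j}{z^k_i}=\frac{\dot x^k_j(t)}{\dot x^k_i(t)}=\frac{\zeta_w}{\zeta_v}.$$
   Context: **Metric graphs.** $\mathcal G=(\mathcal V,\mathcal E)$ is a finite connected simple graph with a length function $\ell:\mathcal E\to(0,\infty)$. Each edge is given an arbitrary orientation. $S$ is the quotient of $\bigcup_{e\in\mathcal E}\{e\}\times[0,\ell(e)]$ obtained by identifying points representing the same vertex ($(e,0)$ is the initial vertex of $e$, $(e,\ell(e))$ the terminal one); points are written $(e,x)$. $S$ carries the shortest-path metric and its topology; $\zeta=\sum_e\ell(e)$. **Normal vectors.** For each edge $e$ there are two symbols $e^+,e^-$ with $\mathrm{sign}(e^{\pm})=\pm1$, and $(e,s)+t\mathbf w=(e,s+\mathrm{sign}(\mathbf w)t)$ for $\mathbf w\in\{e^+,e^-\}$ whenever $0\le s+\mathrm{sign}(\mathbf w)t\le \ell(e)$. $e^+$ is anchored at a point $p$ if $p=(e,s)$ with $0\le s<\ell(e)$; $e^-$ is anchored at $p$ if $p=(e,s)$ with $0<s\le\ell(e)$. For a closed set $A\subset S$ with finitely many components and $p\in\partial A$, $\mathbf w$ is an outward normal vector to $A$ at $p$ if $\mathbf w$ is anchored at $p$ and for some $t_1>0$, $p+t\mathbf w\notin A$ for all $t\in(0,t_1)$. **Floodings.** A flooding is a family $(f(t),t\ge0)$ of increasing closed subsets of $S$, each with finitely many components, for which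 there are times $0=t_0<t_1<\dots<t_{\mathbf k(f)}<\infty$ such that $f(t)=S$ for $t\ge t_{\mathbf k(f)}$, and for $k=1,\dots,\mathbf k(f)$: $f(t_{k-1})\ne S$; $\mathbf w^k_1,\dots,\mathbf w^k_{m_k}$ are all outward normal vectors at all points of $\partial f(t_{k-1})$ (so $m_k$ is their total number), with $\mathbf w^k_j\in\{(e^k_j)^+,(e^k_j)^-\}$ anchored at the boundary point $(e^k_j,r^k_j)$; there are $z^k_j\ge0$ with $\sum_{j=1}^{m_k}z^k_j=1$; $t_k$ is the infimum of $t>t_{k-1}$ such that for some $j$, $r^k_j+\mathrm{sign}(\mathbf w^k_j)z^k_j(t-t_{k-1})\notin[0,\ell(e^k_j)]$, or for some $j_1\neq j_2$ with $e^k_{j_1}=e^k_{j_2}$, $r^k_{j_1}+\mathrm{sign}(\mathbf w^k_{j_1})z^k_{j_1}(t-t_{k-1})=r^k_{j_2}+\mathrm{sign}(\mathbf w^k_{j_2})z^k_{j_2}(t-t_{k-1})$; and, with $x^k_j(t)=(e^k_j,r^k_j)+(t-t_{k-1})z^k_j\mathbf w^k_j$, for $t\in[t_{k-1},t_k]$ one has $f(t)=f(t_{k-1})\cup\{x^k_j(s):1\le j\le m_k,\ t_{k-1}\le s\le t\}$. One writes $\dot x^k_j(t)=z^k_j$ for $t\in(t_{k-1},t_k)$ (speed of the $j$-th arm). $\mathcal F^M$ is the set of floodings such that $f(0)$ consists of $M$ distinct points ($M$ sources); then $t_{\mathbf k(f)}=\zeta$. $\mathcal F^{\le M}=\bigcup_{1\le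 K\le M}\mathcal F^K$. **Entropy.** With $0\log0=0$, $\beta(f)=-\sum_{k=1}^{\mathbf k(f)}(t_k-t_{k-1})\sum_{j=1}^{m_k}z^k_j\log z^k_j$; $\beta^*(S,M)=\sup\{\beta(f):f\in\mathcal F^{\le M}\}$ and $\mathcal F^M_*=\{f\in\mathcal F^{\le M}:\beta(f)=\beta^*(S,M)\}$. **Further definitions.** $f$ has a dormant arm if for some $i,j,k$ one has $x^k_j(t_{k-1})=x^{k-1}_i(t_{k-2})$ and $x^k_j(t_{k-1})\neq x^k_j(t_k)$. For $y\in f(0)$ and $t\in[0,\zeta)$, $S_y(t)$ is the connected component of $f(t)$ containing $y$, and $S_y$ is the closure of $\bigcup_{0\le t<\zeta}S_y(t)$. A point $v$ of a tree metric graph $T$ of total length $\zeta_T$ is the centroid of $T$ if every connected subset of $T\setminus\{v\}$ has total length at most $\zeta_T/2$. *)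

(* Defs.v *)
From HB Require Import structures.
From mathcomp Require Import all_boot all_order all_algebra.
From mathcomp Require Import all_classical all_reals all_analysis.

Set Implicit Arguments.
Unset Strict Implicit.
Unset Printing Implicit Defensive.

Import Order.TTheory GRing.Theory Num.Theory.
Import numFieldTopology.Exports numFieldNormedType.Exports.

Local Open Scope classical_set_scope.
Local Open Scope ring_scope.

(* A finite connected simple graph with edge lengths; the arbitrary orientation
   of the edges is the choice of [src] and [tgt]. *)
Record metricGraph (R : realType) := MetricGraph {
  vertex : finType;
  edge : finType;
  src : edge -> vertex;
  tgt : edge -> vertex;
  len : edge -> R;
  len_gt0 : forall e, 0 < len e;
  src_neq_tgt : forall e, src e != tgt e;
  edge_simple : forall e1 e2,
    [set src e1; tgt e1]%SET = [set src e2; tgt e2]%SET -> e1 = e2;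
  graph_connected : forall u v,
    connect (fun a b => [exists e,
      ([set src e; tgt e]%SET == [set a; b]%SET)]) u v
}.

Section Space.
Context {R : realType} (G : metricGraph R).

Definition vdegree (v : vertex G) : nat :=
  #|[set e : edge G | (src e == v) || (tgt e == v)]%SET|.

Definition graph_length : R := \sum_(e : edge G) len e.

Definition prepoint := {p : edge G * R | 0 <= p.2 <= len p.1}.

Definition vertex_at (p : prepoint) : option (vertex G) :=
  let: (e, x) := val p in
  if x == 0 then Some (src e) else if x == len e then Some (tgt e) else None.

Definition same_point (p q : prepoint) : bool :=
  (p == q) || (isSome (vertex_at p) && (vertex_at p == vertex_at q)).

Lemma same_point_refl : reflexive same_point.
Proof. by move=> p; rewrite /same_point eqxx. Qed.

Lemma same_point_sym : symmetric same_point.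
Proof.
move=> p q; rewrite /same_point (eq_sym p) (eq_sym (vertex_at p)).
by case: (vertex_at q =P vertex_at p) => [->//|_]; rewrite !andbF.
Qed.

Lemma same_point_trans : transitive same_point.
Proof.
move=> q p r /orP[/eqP->//|/andP[vp /eqP pq]] /orP[/eqP<-|/andP[_ /eqP qr]].
  by rewrite /same_point vp pq eqxx orbT.
by rewrite /same_point vp pq qr eqxx orbT.
Qed.

Canonical same_point_equiv :=
  EquivRel same_point same_point_refl same_point_sym same_point_trans.

Definition gspace := {eq_quot same_point}%qT.

HB.instance Definition _ := Choice.on gspace.

Lemma prepoint0_subproof (e : edge G) : 0 <= (e, 0 : R).2 <= len (e, 0 : R).1.
Proof. by rewrite /= lexx ltW ?len_gt0. Qed.

(* The point (e, x) of the metric graph; junk, namely (e, 0), unless 0 <= x <= len e. *)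
Definition pt (e : edge G) (x : R) : gspace :=
  (\pi_gspace (insubd (exist _ (e, 0) (prepoint0_subproof e) : prepoint) (e, x)))%qT.

Definition in_edge (e : edge G) (x : R) : Prop := 0 <= x <= len e.

Definition is_vertex_point (v : vertex G) (p : gspace) : Prop :=
  exists e, (src e = v /\ p = pt e 0) \/ (tgt e = v /\ p = pt e (len e)).

(* [path_length p q L]: some path from p to q, made of finitely many segments
   each contained in one edge, has length L. *)
Inductive path_length : gspace -> gspace -> R -> Prop :=
| path_length_nil p : path_length p p 0
| path_length_cons e x y q L : in_edge e x -> in_edge e y ->
    path_length (pt e y) q L -> path_length (pt e x) q (`|x - y| + L).

(* The open ball of the shortest-path metric: the infimum of the lengths of the
   paths from p to q is less than r. *)
Definition path_ball (p : gspace) (r : R) : set gspace :=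
  [set q | exists2 L, path_length p q L & L < r].

Lemma path_length_cat p q s L1 L2 :
  path_length p q L1 -> path_length q s L2 -> path_length p s (L1 + L2).
Proof.
elim=> [?|e x y ? L ex ey _ IH qs]; first by rewrite add0r.
by rewrite -addrA; apply: path_length_cons => //; exact: IH.
Qed.

Lemma path_length_sym p q L : path_length p q L -> path_length q p L.
Proof.
elim=> [?|e x y s L' ex ey _ IH]; first exact: path_length_nil.
rewrite addrC; apply: (path_length_cat IH); rewrite distrC -[X in path_length _ _ X]addr0.
by apply: path_length_cons => //; exact: path_length_nil.
Qed.

Lemma path_ball_center p (r : R) : 0 < r -> path_ball p r p.
Proof. by move=> r0; exists 0 => //; exact: path_length_nil. Qed.

Lemma path_ball_sym p q (r : R) : path_ball p r q -> path_ball q r p.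
Proof. by move=> [L /path_length_sym pq Lr]; exists L. Qed.

Lemma path_ball_triangle p q s (r1 r2 : R) :
  path_ball p r1 q -> path_ball q r2 s -> path_ball p (r1 + r2) s.
Proof.
move=> [L1 pq L1r] [L2 qs L2r]; exists (L1 + L2); last exact: ltrD.
exact: path_length_cat pq qs.
Qed.

HB.instance Definition _ := hasNbhs.Build gspace (nbhs_ (entourage_ path_ball)).

HB.instance Definition _ := @Nbhs_isPseudoMetric.Build R gspace
  (entourage_ path_ball) erefl path_ball
  path_ball_center path_ball_sym path_ball_triangle erefl.

Definition boundary (A : set gspace) : set gspace := closure A `\` A°.

Definition is_component (A C : set gspace) : Prop :=
  exists2 p, A p & C = connected_component A p.

Definition total_length (A : set gspace) : R :=
  \sum_(e : edge G) fine (lebesgue_measure [set x | in_edge e x /\ A (pt e x)]).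

Definition has_loop (A : set gspace) : Prop :=
  exists g : R -> gspace,
    [/\ {within `[0, 1], continuous g},
        (forall s t, 0 <= s < 1 -> 0 <= t < 1 -> g s = g t -> s = t),
        g 0 = g 1
      & forall s, 0 <= s <= 1 -> A (g s)].

Definition is_centroid (T : set gspace) (v : gspace) : Prop :=
  T v /\ forall C, C `<=` T `\ v -> connected C ->
    total_length C <= total_length T / 2.

(* An arm is a symbol e^+ ([forward] = true) or e^- together with the
   coordinate [acoord] on e of the point where it is anchored. *)
Record arm := Arm { aedge : edge G; forward : bool; acoord : R }.

Definition asign (a : arm) : R := if forward a then 1 else -1.

Definition anchor (a : arm) : gspace := pt (aedge a) (acoord a).

Definition anchored (a : arm) : Prop :=
  if forward a then 0 <= acoord a < len (aedge a)
  else 0 < acoord a <= len (aedge a).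

Definition outward_normal (A : set gspace) (a : arm) : Prop :=
  [/\ anchored a, boundary A (anchor a)
    & exists2 t1, 0 < t1 & forall t, 0 < t < t1 ->
        in_edge (aedge a) (acoord a + asign a * t) /\
        ~ A (pt (aedge a) (acoord a + asign a * t))].

(* [fam] is the family (f(t)), meaningful for t >= 0; the stages are indexed by
   1 <= k <= nstages, stage k being the time interval [time k.-1, time k]. *)
Record flooding_data := FloodingData {
  fam :> R -> set gspace;
  nstages : nat;
  time : nat -> R;
  narms : nat -> nat;
  farm : forall k, 'I_(narms k) -> arm;
  speed : forall k, 'I_(narms k) -> R
}.

Section FloodingOps.
Variable f : flooding_data.

(* The coordinate, on the edge of the j-th arm of stage k, of its tip x^k_j(t). *)
Definition tip_coord k (j : 'I_(narms f k)) (t : R) : R :=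
  acoord (farm j) + asign (farm j) * speed j * (t - time f k.-1).

Definition tip k (j : 'I_(narms f k)) (t : R) : gspace :=
  pt (aedge (farm j)) (tip_coord j t).

Definition stage_end_event k (t : R) : Prop :=
  (exists j : 'I_(narms f k), ~ in_edge (aedge (farm j)) (tip_coord j t)) \/
  (exists j1 j2 : 'I_(narms f k), [/\ j1 <> j2,
     aedge (farm j1) = aedge (farm j2) & tip_coord j1 t = tip_coord j2 t]).

Definition is_stage k : Prop :=
  [/\ f (time f k.-1) <> setT,
      injective (@farm f k)
        /\ (forall a, outward_normal (f (time f k.-1)) a <->
                      exists j : 'I_(narms f k), farm j = a),
      (forall j : 'I_(narms f k), 0 <= speed j)
        /\ \sum_(j < narms f k) speed j = 1,
      time f k = inf [set t | time f k.-1 < t /\ stage_end_event k t]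
    & forall t, time f k.-1 <= t <= time f k ->
        f t = f (time f k.-1) `|`
          [set p | exists j s, time f k.-1 <= s <= t /\ p = @tip k j s]].

Definition is_flooding : Prop :=
  [/\ (forall s t, 0 <= s <= t -> f s `<=` f t),
      (forall t, 0 <= t -> closed (f t) /\ finite_set [set C | is_component (f t) C]),
      time f 0 = 0 /\
        (forall k, (1 <= k <= nstages f)%N -> time f k.-1 < time f k),
      (forall t, time f (nstages f) <= t -> f t = setT)
    & forall k, (1 <= k <= nstages f)%N -> is_stage k].

Definition flooding_from (K : nat) : Prop := is_flooding /\ (f 0 #= `I_K)%card.

Definition flooding_from_le (M : nat) : Prop :=
  exists2 K, (1 <= K <= M)%N & flooding_from K.

(* [ln 0 = 0] in the library, so that the convention 0 log 0 = 0 holds. *)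
Definition entropy : R :=
  - \sum_(1 <= k < (nstages f).+1)
      (time f k - time f k.-1) * \sum_(j < narms f k) speed j * ln (speed j).

Definition has_dormant_arm : Prop :=
  exists k (i : 'I_(narms f k.-1)) (j : 'I_(narms f k)),
    [/\ (2 <= k <= nstages f)%N,
        tip j (time f k.-1) = tip i (time f k.-2)
      & tip j (time f k.-1) <> tip j (time f k)].

Definition basin_at (y : gspace) (t : R) : set gspace :=
  connected_component (f t) y.

Definition basin_union (y : gspace) : set gspace :=
  \bigcup_(t in [set t | 0 <= t < graph_length]) basin_at y t.

Definition basin (y : gspace) : set gspace := closure (basin_union y).

(* With S_y = basin y, C is S_{yv}: the connected component of S_y minus v which
   does not contain y.  If arms started from y meet each other at the final
   time, the closure S_y contains a loop and S_y minus v may be connected, so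
   that S_{yv} only makes sense in the tree [basin_union y] of the points reached
   before that time; hence the second alternative.  The two can only differ by
   finitely many points, which do not change the total length. *)
Definition branch (y v : gspace) (C : set gspace) : Prop :=
  ~ C y /\ (is_component (basin y `\ v) C \/
            is_component (basin_union y `\ v) C).

End FloodingOps.

Definition max_entropy (M : nat) : \bar R :=
  ereal_sup [set (entropy f)%:E | f in [set f | flooding_from_le f M]].

Definition optimal_flooding (M : nat) (f : flooding_data) : Prop :=
  flooding_from_le f M /\ (entropy f)%:E = max_entropy M.

End Space.

(* Main.v *)
Require Import Defs.
From HB Require Import structures.
From mathcomp Require Import all_boot all_order all_algebra.
From mathcomp Require Import all_classical all_reals all_analysis.
From mathcomp Require Import ring lra.
Import Order.TTheory GRing.Theory Num.Theory.
Import numFieldTopology.Exports numFieldNormedType.Exports.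
Local Open Scope classical_set_scope.
Local Open Scope ring_scope.

(** The theorem follows from an exact upper bound for the entropy, a continuous
    analogue of the hook length formula, and from the study of equality in it.

    Let [f] be a flooding that starts from [M] sources.  The sources cut the
    edges into regions, and each region is run through from its two ends, along
    two half-edges.  Let [L h] be the length finally covered along the half-edge
    [h].  Every vertex is first reached along some half-edge [par v], and making
    it the parent of the half-edges that start at [v] turns the half-edges into a
    forest rooted at the sources.  Write [a h] for the total of [L] over [h]
    and its descendants, the hook of [h], and [b h = a h - L h].  Over each stage
    the relative entropy inequality, used for each moving half-edge with two
    outcomes, points covered in this stage and points left for later, compares
    the speed of an arm with the share of the unflooded length that lies ahead of
    it.  The sum telescopes to
      [entropy f <= xln zeta - \sum_h (xln (a h) - xln (b h))]
    ([progression_entropyE], [entropy_le]).  In case of equality each moving arm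
    has a speed equal to the share of the unflooded length lying ahead of it
    ([moving_speed], [hs_speed_at]), and everything unflooded lies ahead of some
    moving arm ([remaining_covered]).

    Conversely, let positive lengths be given on the half-edges of the same
    forest, with the right total on each edge.  Letting every arm run at the speed
    just described defines a flooding with as many sources which attains the
    bound ([filling_is_flooding], [filling_entropy]).  So if [f] is optimal, its
    lengths [L] minimise the hook cost among all nonnegative lengths on its
    forest, by continuity, and equality holds for [f] itself
    ([reading_minimal]).

    A minimum satisfies first-order conditions.  A half-edge of length zero with
    nothing beyond it could be lengthened with a gain of order [e * ln (1 / e)]
    ([minimiser_no_idle]).  Therefore every arm moves as soon as it exists, and
    sources that coincide are impossible, so that exactly [M] of them are used.
    Moving a source along its edge transfers length between its two arms, so that
    their hooks agree, unless the source sits at a vertex ([minimiser_balance]).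

    Now everything can be read off.  Two arms never meet and no arm comes to the
    end of a dead end before the final time, as the speed of an arm with nothing
    beyond its half-edge dies out in proportion to the remaining time
    ([leaf_unfinished]); so arms stop only at vertices where others take over.
    Hence the number of arms does not decrease, leaves are not flooded early, and
    each flooded point other than a source has a unique address, a half-edge and a
    position on it.  Cutting at an address separates the flooded set: it contains
    no loop, and its components are trees, one for each source.  Subtrees that
    start at a source grow at constant rates ([branch_progress]), so the balance
    of hooks at time 0 makes the sources centroids at all times; the remaining
    choice, of an edge on which a source at a vertex is placed, is used to get the
    balance for every arm at this vertex ([root_arm_balance]).  Finally the part
    flooded through an arm after time [t] has length equal to the speed of the arm
    times the remaining time ([branch_length]), which gives the ratios of
    speeds. *)

Set Implicit Arguments.
Unset Strict Implicit.
Unset Printing Implicit Defensive.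

(** * The function x ln x *)

Section XlnX.
Context {R : realType}.
Implicit Types x y p q : R.

Definition xln x : R := x * ln x.

Lemma xln0 : xln 0 = 0. Proof. by rewrite /xln mul0r. Qed.

Lemma ln_le_sub1 x : 0 < x -> ln x <= x - 1.
Proof.
move=> x0; have := @le_ln1Dx R (x - 1).
by rewrite addrCA subrr addr0 => -> //; rewrite ltrBrDl subrr.
Qed.

(** Convexity, in the form used throughout; the point [y] may be the boundary
    point 0, the point of tangency [x] may not. *)
Lemma xln_tangent x y : 0 < x -> 0 <= y ->
  xln x + (ln x + 1) * (y - x) <= xln y.
Proof.
move=> x0; rewrite le_eqVlt => /orP[/eqP<-|y0].
  rewrite xln0 /xln; nra.
have := @ln_le_sub1 (x / y) (divr_gt0 x0 y0).
rewrite ln_div ?posrE// => H.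
have : y * (ln x - ln y) <= y * (x / y - 1) by rewrite ler_wpM2l// ltW.
rewrite mulrBr mulrBr mulr1 mulrCA divff ?gt_eqF// mulr1 /xln; nra.
Qed.

Lemma xln_convex (e x y : R) : 0 <= e <= 1 -> 0 <= x -> 0 <= y ->
  xln ((1 - e) * x + e * y) <= (1 - e) * xln x + e * xln y.
Proof.
move=> /andP[e0 e1] x0 y0; set z := (1 - e) * x + e * y.
have z0 : 0 <= z by rewrite addr_ge0// mulr_ge0// subr_ge0.
have := z0; rewrite le_eqVlt => /orP[/eqP zE|zp].
  have /eqP := esym zE; rewrite paddr_eq0 ?mulr_ge0 ?subr_ge0// => /andP[].
  rewrite !mulf_eq0 -zE xln0.
  by move=> /orP[]/eqP -> /orP[]/eqP ->; rewrite ?xln0 ?mul0r ?mulr0 ?add0r.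
have Hx := xln_tangent zp x0.
have Hy := xln_tangent zp y0.
have Ex : (1 - e) * (xln z + (ln z + 1) * (x - z)) <= (1 - e) * xln x.
  by rewrite ler_wpM2l ?subr_ge0.
have Ey : e * (xln z + (ln z + 1) * (y - z)) <= e * xln y by rewrite ler_wpM2l.
have Ez : z = (1 - e) * x + e * y by [].
have : (1 - e) * (xln z + (ln z + 1) * (x - z)) + e * (xln z + (ln z + 1) * (y - z))
   = xln z + (ln z + 1) * ((1 - e) * x + e * y - z) by ring.
by rewrite -Ez subrr mulr0 addr0 => <-; exact: lerD.
Qed.

Lemma xlnM x y : 0 <= x -> 0 <= y -> xln (x * y) = y * xln x + x * xln y.
Proof.
move=> x0 y0; have [->|xn] := eqVneq x 0; first by rewrite !(mul0r, xln0, mulr0, addr0).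
have [->|yn] := eqVneq y 0; first by rewrite !(mul0r, xln0, mulr0, addr0).
rewrite /xln lnM ?posrE ?lt0r ?xn ?yn//; ring.
Qed.

(** The relative entropy of two probabilities on two points is nonnegative;
    here the first one is (l / (l + b), b / (l + b)). *)
Lemma xln_gibbs2 (l b p q : R) : 0 <= l -> 0 <= b -> 0 < p -> 0 <= q -> p + q = 1 ->
  (q = 0 -> b = 0) ->
  l * ln p + b * ln q <= xln l + xln b - xln (l + b).
Proof.
move=> l0 b0 p0 q0 pq qb.
have [/eqP|lb0] := eqVneq (l + b) 0.
  rewrite paddr_eq0// => /andP[/eqP-> /eqP->].
  by rewrite addr0 xln0 !mul0r !addr0 subr0.
have lbp : 0 < l + b by rewrite lt0r lb0 addr_ge0.
have H1 : xln ((l + b) * p) + (ln ((l + b) * p) + 1) * (l - (l + b) * p) <= xln l.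
  by rewrite xln_tangent// mulr_gt0.
have [q00|qn] := eqVneq q 0.
  have {}qb := qb q00; have p1 : p = 1 by rewrite -pq q00 addr0.
  by rewrite qb p1 ln1 mulr0 mul0r !addr0 xln0 addr0 subrr.
have qp : 0 < q by rewrite lt0r qn.
have H2 : xln ((l + b) * q) + (ln ((l + b) * q) + 1) * (b - (l + b) * q) <= xln b.
  by rewrite xln_tangent// mulr_gt0.
move: H1 H2; rewrite /xln !lnM ?posrE// => H1 H2.
have E : p = 1 - q by rewrite -pq addrK.
have -> : l * ln p + b * ln q = ((l + b) * p * (ln (l + b) + ln p) + (ln (l + b) + ln p + 1) * (l - (l + b) * p))
  + ((l + b) * q * (ln (l + b) + ln q) + (ln (l + b) + ln q + 1) * (b - (l + b) * q)) - (l + b) * ln (l + b).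
  move: (ln p) (ln q) (ln (l + b)) => P Q S; rewrite E; ring.
by rewrite lerD2r lerD.
Qed.

Lemma xln_tangent_eq x y : 0 < x -> 0 <= y ->
  xln x + (ln x + 1) * (y - x) = xln y -> x = y.
Proof.
move=> x0 y0 E; apply/eqP; apply: contraT => xy.
pose z := (x + y) / 2.
have z0 : 0 < z by rewrite /z divr_gt0// ltr_wpDr.
have H1 := xln_tangent z0 y0.
have H2 := xln_tangent x0 (ltW z0).
have H3 := xln_tangent z0 (ltW x0).
have zE : z = (x + y) / 2 by [].
have yE : y = 2 * z - x by rewrite zE; field.
have E1 : ln z = ln x.
  have E2 : (ln z - ln x) * (y - x) <= 0.
    have : (ln z - ln x) * (y - z) <= 0.
      move: H1 H2 E; move: (xln x) (xln y) (xln z) (ln x) (ln z) => a b c d e H1 H2 E.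
      by rewrite -subr_ge0 -[_ - _]subr0; lra.
    have -> : y - z = (y - x) / 2 by rewrite zE; field.
    by rewrite mulrA pmulr_lle0.
  have := xy; rewrite neq_lt => /orP[xy'|xy'].
    have xz : x < z by rewrite zE; lra.
    have : ln x < ln z by rewrite ltr_ln// posrE.
    nra.
  have xz : z < x by rewrite zE; lra.
  have : ln z < ln x by rewrite ltr_ln// posrE.
  nra.
have /eqP := ln_inj z0 x0 E1.
have -> : (z == x) = (y == x).
  by apply/eqP/eqP => h; [rewrite yE h; ring|rewrite zE h; field].
by rewrite eq_sym (negbTE xy).
Qed.

Lemma xln_gibbs2_eq (l b p q : R) : 0 <= l -> 0 <= b -> 0 < p -> 0 <= q -> p + q = 1 ->
  (q = 0 -> b = 0) ->
  l * ln p + b * ln q = xln l + xln b - xln (l + b) -> l = (l + b) * p.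
Proof.
move=> l0 b0 p0 q0 pq qb.
have [/eqP|lb0] := eqVneq (l + b) 0.
  by rewrite paddr_eq0// => /andP[/eqP l00 /eqP b00]; move=> _; rewrite l00 b00 addr0 mul0r.
have lbp : 0 < l + b by rewrite lt0r lb0 addr_ge0.
have lpp : 0 < (l + b) * p by rewrite mulr_gt0.
have H1 := @xln_tangent_eq _ _ lpp l0.
have H1' := @xln_tangent _ _ lpp l0.
have [q00|qn] := eqVneq q 0.
  have {}qb := qb q00; have p1 : p = 1 by rewrite -pq q00 addr0.
  by move=> _; rewrite qb p1 !(mulr1, addr0).
have qp : 0 < q by rewrite lt0r qn.
have H2 : xln ((l + b) * q) + (ln ((l + b) * q) + 1) * (b - (l + b) * q) <= xln b.
  by rewrite xln_tangent// mulr_gt0.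
have E : p = 1 - q by rewrite -pq addrK.
have EE : l * ln p + b * ln q = ((l + b) * p * (ln (l + b) + ln p) + (ln (l + b) + ln p + 1) * (l - (l + b) * p))
  + ((l + b) * q * (ln (l + b) + ln q) + (ln (l + b) + ln q + 1) * (b - (l + b) * q)) - (l + b) * ln (l + b).
  move: (ln p) (ln q) (ln (l + b)) => P Q S; rewrite E; ring.
move=> Eq; apply/esym/H1/eqP; rewrite eq_le H1' /=.
move: EE; rewrite Eq -!lnM ?posrE// -/(xln _) -/(xln ((l + b) * q)) -/(xln (l + b)).
move=> EE; rewrite -subr_ge0.
have aux (T1 T2 S : R) : xln l + xln b - S = T1 + T2 - S -> T1 - xln l = xln b - T2 by move=> *; lra.
rewrite (aux _ _ _ EE) subr_ge0; exact: H2.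
Qed.

(** Read at [x = d ^+ 2], this bounds [xln x] by a multiple of the square
    root of [x], enough for error terms in [xln e] to vanish with [e]. *)
Lemma sqrt_xln (d : R) : 0 < d -> d < 1 -> - (2 * d) <= xln (d ^+ 2) <= 0.
Proof.
move=> d0 d1; rewrite /xln lnXn//; apply/andP; split; last first.
  rewrite mulr_ge0_le0 ?exprn_ge0 ?(ltW d0)// mulrn_wle0//.
  by rewrite ln_le0// ltW.
have := @ln_le_sub1 d^-1; rewrite invr_gt0 lnV ?posrE// => /(_ d0) H.
have : d * - ln d <= d * (d^-1 - 1) by rewrite ler_wpM2l// ltW.
rewrite mulrBr divff ?gt_eqF// mulr1 => H2.
have -> : d ^+ 2 * (ln d *+ 2) = - (d * (d * - ln d) * 2) by ring.
rewrite lerN2.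
have H3 : d * (d * - ln d) <= d by rewrite -[leRHS]mulr1 ler_wpM2l ?ltW//; lra.
lra.
Qed.

End XlnX.

(** * Rooted forests and hooks *)

Section Forest.
Context {R : realType} {H : finType}.
Variables (up : H -> option H) (rk : H -> nat).
Hypothesis rk_up : forall x y, up x = Some y -> (rk y < rk x)%N.

Definition desc : rel H := connect (fun a b => up a == Some b).
Definition pdesc x y := desc x y && (x != y).

Lemma desc_refl x : desc x x. Proof. exact: connect0. Qed.

Lemma desc_trans x y z : desc x y -> desc y z -> desc x z.
Proof. exact: connect_trans. Qed.

Lemma desc_up x y : up x = Some y -> desc x y.
Proof. by move=> xy; apply: connect1; rewrite xy. Qed.

Lemma descP x y : desc x y -> x = y \/ exists2 z, up x = Some z & desc z y.
Proof.
move=> /connectP[[|z s] /=]; first by left.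
move=> /andP[/eqP xz zs] yl; right; exists z => //.
by apply/connectP; exists s.
Qed.

Lemma desc_rk x y : desc x y -> x = y \/ (rk y < rk x)%N.
Proof.
move: {2}(rk x) (leqnn (rk x)) => m; elim: m x => [|m IH] x xm /descP[->|[z xz zy]];
  [by left| | by left | ]; right; have zx := rk_up xz.
  by move: (leq_trans zx xm).
have [zE|zl] := IH z (leq_trans zx xm) zy; first by rewrite -zE.
exact: ltn_trans zl zx.
Qed.

Lemma desc_anti x y : desc x y -> desc y x -> x = y.
Proof.
by move=> /desc_rk[//|xy] /desc_rk[//|yx]; have := ltn_trans xy yx; rewrite ltnn.
Qed.

Lemma desc_comp x a b : desc x a -> desc x b -> desc a b \/ desc b a.
Proof.
move: {2}(rk x) (leqnn (rk x)) => m; elim: m x => [|m IH] x xm xa xb.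
  have [<-|[z xz _]] := descP xa; first by left.
  by have := leq_trans (rk_up xz) xm.
have [<-|[z xz za]] := descP xa; first by left.
have [<-|[w xw wb]] := descP xb; first by right.
have zx := rk_up xz; move: xw; rewrite xz => -[?]; subst w.
exact: IH (leq_trans zx xm) za wb.
Qed.

Lemma pdesc_up x y : pdesc x y -> exists2 z, up x = Some z & desc z y.
Proof. by move=> /andP[/descP[->|//]]; rewrite eqxx. Qed.

Lemma up_pdesc x y z : up x = Some y -> desc y z -> pdesc x z.
Proof.
move=> xy yz; rewrite /pdesc (desc_trans (desc_up xy) yz) /=.
apply/eqP => xz; subst z; have := rk_up xy.
by have [->|] := desc_rk yz; rewrite ?ltnn// => h1 h2; have := ltn_trans h1 h2; rewrite ltnn.
Qed.

Definition hook (L : H -> R) x := \sum_(y | desc y x) L y.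
Definition subhook (L : H -> R) x := \sum_(y | pdesc y x) L y.

Lemma hookE L x : hook L x = L x + subhook L x.
Proof. by rewrite /hook (bigD1 x) ?desc_refl. Qed.

(** Subtrees hanging from pairwise incomparable nodes are disjoint. *)
Lemma sum_unique_anc (P : pred H) (F : H -> R) :
  (forall y x x', P x -> P x' -> desc y x -> desc y x' -> x = x') ->
  \sum_(x | P x) \sum_(y | desc y x) F y
    = \sum_(y | [exists x, P x && desc y x]) F y.
Proof.
move=> uni; rewrite (exchange_big_dep predT)//= [RHS]big_mkcond; apply: eq_bigr => y _.
case: ifPn => [/existsP[x /andP[Px yx]]|/existsPn nex]; last first.
  by rewrite big1// => x xy; have := nex x; rewrite xy.
rewrite (big_pred1 x)// => z /=; apply/idP/eqP => [/andP[Pz yz]|->]; last by rewrite Px.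
exact: uni yz yx.
Qed.

Lemma subhook_children L x : subhook L x = \sum_(c | up c == Some x) hook L c.
Proof.
rewrite /hook sum_unique_anc; last first.
  move=> y c c' /eqP cx /eqP c'x yc yc'.
  have [/descP[//|[z]]|/descP[//|[z]]] := desc_comp yc yc'.
    rewrite cx => -[<-] xc'; have := up_pdesc c'x (desc_refl x).
    by rewrite /pdesc => /andP[/desc_anti/(_ xc')->]; rewrite eqxx.
  rewrite c'x => -[<-] xc; have := up_pdesc cx (desc_refl x).
  by rewrite /pdesc => /andP[/desc_anti/(_ xc)->]; rewrite eqxx.
apply: eq_bigl => y; apply/idP/existsP => [|[c /andP[/eqP cx yc]]].
  move=> /andP[]; move: {2}(rk y) (leqnn (rk y)) => m; elim: m y => [|m IH] y ym.
    by move=> /descP[->|[z /rk_up yz]]; [rewrite eqxx|have := leq_trans yz ym].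
  move=> /descP[->|[z yz zx]]; first by rewrite eqxx.
  move=> _; have [zx'|zx'] := eqVneq z x; first by exists y; rewrite desc_refl yz zx' eqxx.
  have [c /andP[cx zc]] := IH z (leq_trans (rk_up yz) ym) zx zx'.
  by exists c; rewrite cx (desc_trans (desc_up yz) zc).
have := up_pdesc cx (desc_refl x) => /andP[cdx cnx].
rewrite /pdesc (desc_trans yc cdx); apply/eqP => yx; subst y.
by rewrite (desc_anti cdx yc) eqxx in cnx.
Qed.

Lemma sum_root_hooks L : \sum_(r | up r == None) hook L r = \sum_x L x.
Proof.
rewrite /hook sum_unique_anc; last first.
  by move=> y r r' /eqP rN /eqP r'N yr yr';
    have [/descP[//|[z]]|/descP[//|[z]]] := desc_comp yr yr'; rewrite ?rN ?r'N.
apply: eq_bigl => y; apply/existsP.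
move: {2}(rk y) (leqnn (rk y)) => m; elim: m y => [|m IH] y ym;
  case yE: (up y) => [z|]; last by exists y; rewrite desc_refl yE.
- by have := leq_trans (rk_up yE) ym.
- by exists y; rewrite desc_refl yE.
have [c /andP[cx zc]] := IH z (leq_trans (rk_up yE) ym).
by exists c; rewrite cx (desc_trans (desc_up yE) zc).
Qed.

Lemma hook_linear (e : R) L D x : hook (fun y => L y + e * D y) x = hook L x + e * hook D x.
Proof. by rewrite /hook big_split /= mulr_sumr. Qed.

Lemma subhook_linear (e : R) L D x :
  subhook (fun y => L y + e * D y) x = subhook L x + e * subhook D x.
Proof. by rewrite /subhook big_split /= mulr_sumr. Qed.

Lemma subhook_ge0 L x : (forall y, 0 <= L y) -> 0 <= subhook L x.
Proof. by move=> L0; exact: sumr_ge0. Qed.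

Lemma hook_ge0 L x : (forall y, 0 <= L y) -> 0 <= hook L x.
Proof. by move=> L0; exact: sumr_ge0. Qed.

Lemma le_hook_pdesc L x y : (forall y, 0 <= L y) -> pdesc x y -> hook L x <= subhook L y.
Proof.
move=> L0 xy; rewrite /hook /subhook [leRHS]big_mkcond [leLHS]big_mkcond; apply: ler_sum => z _.
case: ifP => [zx|_]; last by case: ifP.
have /andP[xy1 xy2] := xy; rewrite /pdesc (desc_trans zx xy1); case: eqP => //= zy.
by subst z; rewrite (desc_anti xy1 zx) eqxx in xy2.
Qed.

(** Up to the term [xln] of the total, minus the leading term of the
    logarithm of the number of linear extensions of a forest whose nodes are
    long chains of lengths [L], by the hook length formula. *)
Definition hook_cost (L : H -> R) : R := \sum_x (xln (hook L x) - xln (subhook L x)).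

(** * The entropy of a progression is bounded by the hook cost *)

Section Progression.
Variables (n : nat) (tm : nat -> R) (phi : nat -> H -> R).
Hypotheses (tm0 : tm 0 = 0) (tmS : forall k, (k < n)%N -> tm k < tm k.+1).
Hypothesis phi0 : forall x, phi 0 x = 0.
Hypothesis phiS : forall k x, (k < n)%N -> phi k x <= phi k.+1 x.
Hypothesis phi_sum : forall k, (k <= n)%N -> \sum_x phi k x = tm k.
Hypothesis phi_order : forall k x y, (k < n)%N -> phi k x < phi k.+1 x ->
  pdesc y x -> phi k.+1 y = 0.

Let L := phi n.
Let A k := tm n - tm k.
Let dt k := tm k.+1 - tm k.
Let dphi k x := phi k.+1 x - phi k x.
Definition remaining k x := phi n x - phi k x.
Local Notation rem := remaining.
Let B k x := rem k x + subhook L x.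
Definition moving k x := phi k x < phi k.+1 x.

Lemma phi_mono k l x : (k <= l <= n)%N -> phi k x <= phi l x.
Proof.
move=> /andP[]; elim: l => [|l IH]; first by rewrite leqn0 => /eqP->.
rewrite leq_eqVlt => /orP[/eqP->//|kl ln]; apply: le_trans (phiS x ln).
by apply: IH => //; exact: ltnW.
Qed.

Lemma tm_mono k l : (k < l <= n)%N -> tm k < tm l.
Proof.
move=> /andP[]; elim: l => // l IH.
rewrite ltnS leq_eqVlt => /orP[/eqP->//|kl ln]; first exact: tmS.
by apply: lt_trans (tmS ln); apply: IH => //; exact: ltnW.
Qed.

Lemma phi_ge0 k x : (k <= n)%N -> 0 <= phi k x.
Proof. by move=> kn; rewrite -(phi0 x) phi_mono. Qed.

Lemma remaining_ge0 k x : (k <= n)%N -> 0 <= rem k x.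
Proof. by move=> kn; rewrite subr_ge0 phi_mono// kn leqnn. Qed.

Let L_ge0 x : 0 <= L x. Proof. exact: phi_ge0. Qed.

Lemma remaining_sum k : (k <= n)%N -> \sum_x rem k x = tm n - tm k.
Proof. by move=> kn; rewrite sumrB !phi_sum. Qed.

Let A_gt0 k : (k < n)%N -> 0 < A k.
Proof. by move=> kn; rewrite subr_gt0 tm_mono// kn leqnn. Qed.

Let A_ge0 k : (k <= n)%N -> 0 <= A k.
Proof. by rewrite leq_eqVlt => /orP[/eqP->|/A_gt0/ltW//]; rewrite /A subrr. Qed.

Let dt_gt0 k : (k < n)%N -> 0 < dt k.
Proof. by move=> kn; rewrite subr_gt0 tmS. Qed.

Let dphi_ge0 k x : (k < n)%N -> 0 <= dphi k x.
Proof. by move=> kn; rewrite subr_ge0 phiS. Qed.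

Lemma moving_anc_uniq k y x x' : (k < n)%N -> moving k x -> moving k x' ->
  desc y x -> desc y x' -> x = x'.
Proof.
move=> kn; wlog xx' : x x' / desc x x'.
  move=> W mx mx' yx yx'; have [h|h] := desc_comp yx yx'; first exact: (W x x').
  by apply/esym/(W x' x).
move=> mx mx' yx yx'; apply/eqP; apply: contraT => nx.
have /(phi_order kn mx') E : pdesc x x' by rewrite /pdesc xx' nx.
by move: mx; rewrite /moving E ltNge phi_ge0// ltnW.
Qed.

(** The arms that move during a stage own disjoint subtrees, whose points are
    all still to be reached. *)
Lemma moving_remaining k (x : H) : (k < n)%N -> moving k x ->
  rem k x + subhook L x = \sum_(y | desc y x) rem k y.
Proof.
move=> kn mx; rewrite [RHS](bigD1 x) ?desc_refl//=; congr (_ + _).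
apply: eq_bigr => y yx; rewrite /remaining.
suff -> : phi k y = 0 by rewrite subr0.
have := phi_order kn mx yx => E; apply/eqP; rewrite eq_le phi_ge0 ?(ltnW kn)// andbT.
by rewrite -E phiS.
Qed.

Let covered k y := [exists x, moving k x && desc y x].

Let sum_moving k : (k < n)%N -> \sum_(x | moving k x) B k x = \sum_(y | covered k y) rem k y.
Proof.
move=> kn; rewrite -sum_unique_anc; last by move=> y x x'; exact: moving_anc_uniq.
by apply: eq_bigr => x mx; rewrite /B moving_remaining.
Qed.

Let sum_moving_le k : (k < n)%N -> \sum_(x | moving k x) B k x <= A k.
Proof.
move=> kn; rewrite sum_moving// /A -remaining_sum ?(ltnW kn)//.
rewrite big_mkcond; apply: ler_sum => y _; case: ifP => // _.
by rewrite remaining_ge0 ?(ltnW kn).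
Qed.

Let sum_dphi k : (k < n)%N -> \sum_(x | moving k x) dphi k x = dt k.
Proof.
move=> kn; rewrite /dt -!phi_sum ?(ltnW kn)// -sumrB big_mkcond; apply: eq_bigr => x _.
rewrite /moving; case: ltP => // h; have := dphi_ge0 x kn; rewrite /dphi => h'.
by apply/eqP; rewrite eq_le h' /= subr_le0.
Qed.

Let BS k x : B k x = dphi k x + B k.+1 x.
Proof. rewrite /B /remaining /dphi; ring. Qed.

Let B_ge0 k x : (k <= n)%N -> 0 <= B k x.
Proof. by move=> kn; rewrite addr_ge0 ?remaining_ge0 ?subhook_ge0. Qed.

Let sum_movingS k : (k < n)%N -> \sum_(x | moving k x) B k.+1 x <= A k.+1.
Proof.
move=> kn; have := sum_moving_le kn.
under eq_bigr do rewrite BS; rewrite big_split /= sum_dphi// /A /dt; lra.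
Qed.

Let AS k : A k = dt k + A k.+1.
Proof. rewrite /A /dt; ring. Qed.

Let prat k := dt k / A k.
Let qrat k := A k.+1 / A k.

Let pq k : (k < n)%N -> prat k + qrat k = 1.
Proof. by move=> kn; rewrite -mulrDl -AS divff// gt_eqF// A_gt0. Qed.

Let B_last k x : (k < n)%N -> moving k x -> qrat k = 0 -> B k.+1 x = 0.
Proof.
move=> kn mx /eqP; rewrite mulf_eq0 invr_eq0 (gt_eqF (A_gt0 kn)) orbF => /eqP AE.
apply/eqP; rewrite eq_le B_ge0// andbT -AE; apply: le_trans (sum_movingS kn).
rewrite (bigD1 x)//= lerDl sumr_ge0// => y _; exact: B_ge0.
Qed.

Let lnq_le0 k : (k < n)%N -> ln (qrat k) <= 0.
Proof.
move=> kn; apply: ln_le0; rewrite -(pq kn) lerDr divr_ge0 ?ltW ?dt_gt0 ?A_gt0//.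
Qed.

Let stage_gap k x : R := if moving k x then
  xln (dphi k x) + xln (B k.+1 x) - xln (B k x)
    - (dphi k x * ln (prat k) + B k.+1 x * ln (qrat k)) else 0.

Let stage_gap_ge0 k x : (k < n)%N -> 0 <= stage_gap k x.
Proof.
move=> kn; rewrite /stage_gap; case: ifPn => // mx; rewrite subr_ge0 (BS k x).
apply: xln_gibbs2; rewrite ?dphi_ge0 ?B_ge0 ?divr_gt0 ?dt_gt0 ?A_gt0 ?divr_ge0 ?A_ge0 ?pq ?(ltnW kn)//.
exact: B_last.
Qed.

Let idle_gap k : R := (\sum_(x | moving k x) B k.+1 x - A k.+1) * ln (qrat k).

Let idle_gap_ge0 k : (k < n)%N -> 0 <= idle_gap k.
Proof. by move=> kn; rewrite mulr_le0// ?lnq_le0// subr_le0 sum_movingS. Qed.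

Definition progression_entropy : R := - \sum_(k < n) dt k *
  \sum_x (dphi k x / dt k) * ln (dphi k x / dt k).

Let stage_entropy k : (k < n)%N -> dt k * (\sum_x (dphi k x / dt k) * ln (dphi k x / dt k))
  = \sum_(x | moving k x) xln (dphi k x) - xln (dt k).
Proof.
move=> kn; have d0 := dt_gt0 kn.
have -> : xln (dt k) = \sum_(x | moving k x) dphi k x * ln (dt k) by rewrite -mulr_suml sum_dphi.
rewrite -sumrB mulr_sumr [RHS]big_mkcond /=.
apply: eq_bigr => x _; rewrite /moving; case: ifPn => mx.
  have p0 : 0 < dphi k x by rewrite subr_gt0.
  rewrite ln_div// /xln; move: (dphi k x) (dt k) d0 => a d d0.
  by rewrite mulrA mulrCA divff ?gt_eqF// mulr1 mulrBr.
have -> : dphi k x = 0; last by rewrite !mul0r mulr0.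
by apply/eqP; rewrite eq_le dphi_ge0// andbT subr_le0 leNgt.
Qed.

Let stage_identity k : (k < n)%N ->
  \sum_(x | moving k x) xln (dphi k x) - xln (dt k)
   = \sum_x (xln (B k x) - xln (B k.+1 x)) - (xln (A k) - xln (A k.+1))
     + (\sum_x stage_gap k x + idle_gap k).
Proof.
move=> kn.
have E1 : \sum_x (xln (B k x) - xln (B k.+1 x))
        = \sum_(x | moving k x) (xln (B k x) - xln (B k.+1 x)).
  rewrite [RHS]big_mkcond; apply: eq_bigr => x _; case: ifPn => // mx.
  have -> : B k x = B k.+1 x; last by rewrite subrr.
  rewrite BS; have -> : dphi k x = 0; last by rewrite add0r.
  by apply/eqP; rewrite eq_le dphi_ge0// andbT subr_le0 leNgt.
rewrite E1 /stage_gap -big_mkcond /= !sumrB !big_split /= -!mulr_suml sum_dphi// /idle_gap.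
have : dt k * ln (prat k) + A k.+1 * ln (qrat k) = xln (dt k) + xln (A k.+1) - xln (A k).
  rewrite /prat /qrat ln_div ?posrE ?dt_gt0 ?A_gt0//.
  have := A_ge0 kn; rewrite le_eqVlt => /orP[/eqP AE|Ap].
    by rewrite -AE mul0r xln0 !addr0 (AS k) -AE addr0 subrr mulr0 subrr.
  rewrite ln_div ?posrE ?Ap ?A_gt0// /xln.
  have -> : A k * ln (A k) = (dt k + A k.+1) * ln (A k) by rewrite -AS.
  by move: (dt k) (A k) (A k.+1) => a b c; ring.
by lra.
Qed.

Let total_gap : R := \sum_(k < n) (\sum_x stage_gap k x + idle_gap k).

(** Both logarithmic sums telescope over the stages; what is left is a sum of
    relative entropies and of terms due to parts that no moving arm covers,
    all nonnegative. *)
Lemma progression_entropyE : progression_entropy = xln (tm n) - hook_cost L - total_gap.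
Proof.
rewrite /progression_entropy.
under eq_bigr do rewrite stage_entropy// stage_identity//.
rewrite big_split sumrB /= -/total_gap exchange_big /=.
have -> : \sum_(k < n) (xln (A k) - xln (A k.+1)) = xln (tm n).
  rewrite -(big_mkord predT (fun k => xln (A k) - xln (A k.+1))).
  under eq_bigr do rewrite -opprB.
  rewrite sumrN telescope_sumr// opprB /A subrr xln0 subr0 tm0 subr0//.
have -> : \sum_x \sum_(k < n) (xln (B k x) - xln (B k.+1 x)) = hook_cost L.
  apply: eq_bigr => x _.
  rewrite -(big_mkord predT (fun k => xln (B k x) - xln (B k.+1 x))).
  under eq_bigr do rewrite -opprB.
  rewrite sumrN telescope_sumr// opprB hookE /B /remaining subrr add0r phi0 subr0//.
lra.
Qed.

Lemma total_gap_ge0 : 0 <= total_gap.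
Proof.
by apply: sumr_ge0 => k _; rewrite addr_ge0 ?idle_gap_ge0// sumr_ge0// => x _; exact: stage_gap_ge0.
Qed.

Lemma progression_entropy_le : progression_entropy <= xln (tm n) - hook_cost L.
Proof. by rewrite progression_entropyE gerBl total_gap_ge0. Qed.

Section Equality.
Hypothesis entropy_max : xln (tm n) - hook_cost L <= progression_entropy.

Let gap0 k : (k < n)%N -> (forall x, stage_gap k x = 0) /\ idle_gap k = 0.
Proof.
move=> kn; have tg : total_gap = 0.
  apply/eqP; rewrite eq_le total_gap_ge0 andbT.
  by move: entropy_max; rewrite progression_entropyE; lra.
have G0 (l : 'I_n) : true -> 0 <= \sum_x stage_gap l x + idle_gap l.
  by move=> _; rewrite addr_ge0 ?idle_gap_ge0// sumr_ge0// => x _; exact: stage_gap_ge0.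
have /eqP : \sum_x stage_gap k x + idle_gap k = 0.
  by have G1 (l : 'I_n) : \sum_x stage_gap l x + idle_gap l = 0
    by [apply: (psumr_eq0P G0 tg)]; exact: (G1 (Ordinal kn)).
rewrite paddr_eq0 ?idle_gap_ge0//=; last by rewrite sumr_ge0// => x _; exact: stage_gap_ge0.
move=> /andP[/eqP s0 /eqP->]; split=> // x.
by apply: (psumr_eq0P _ s0) => // y _; exact: stage_gap_ge0.
Qed.

(** Equality in the relative entropy inequality forces the two distributions
    to agree. *)
Lemma moving_speed k x : (k < n)%N -> moving k x ->
  dphi k x * (tm n - tm k) = (rem k x + subhook L x) * dt k.
Proof.
move=> kn mx; have [/(_ x) + _] := gap0 kn.
rewrite /stage_gap mx => /eqP; rewrite subr_eq0 => /eqP /esym.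
rewrite (BS k x) => /xln_gibbs2_eq E.
have {}E : dphi k x = (dphi k x + B k.+1 x) * prat k.
  apply: E; rewrite ?dphi_ge0 ?B_ge0 ?divr_gt0 ?dt_gt0 ?A_gt0 ?divr_ge0 ?A_ge0 ?pq ?(ltnW kn)//.
  exact: B_last.
by rewrite {1}E -BS /prat -/(A k) -mulrA divfK// gt_eqF// A_gt0.
Qed.

(** If something remained outside the subtrees of the moving arms, what
    remains inside would fall short of what remains of the whole, and
    [idle_gap] would be positive. *)
Lemma remaining_covered k y : (k < n)%N -> 0 < rem k y ->
  exists2 x, moving k x & desc y x.
Proof.
move=> kn ry; have [_ /eqP] := gap0 kn.
have E : \sum_(x | moving k x) B k.+1 x = A k.+1 -> covered k y.
  move=> E; have : \sum_(x | moving k x) B k x = A k.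
    by under eq_bigr do rewrite BS; rewrite big_split /= sum_dphi// E -AS.
  rewrite sum_moving// /A -remaining_sum ?(ltnW kn)// big_mkcond /= => /eqP.
  rewrite -subr_eq0 -sumrB => /eqP S0; apply: contraT => ncov.
  have : \sum_x ((if covered k x then rem k x else 0) - rem k x) < 0.
    rewrite (bigD1 y)//= (negbTE ncov) sub0r.
    suff : \sum_(x | x != y) ((if covered k x then rem k x else 0) - rem k x) <= 0.
      by move: ry; move: (\sum_(x | _) _) (rem k y) => a b; lra.
    apply: sumr_le0 => x _; case: ifP; rewrite ?subrr// sub0r oppr_le0.
    by rewrite remaining_ge0// ltnW.
  by rewrite S0 ltxx.
have fin : covered k y -> exists2 x, moving k x & desc y x.
  by move=> /existsP[x /andP[? ?]]; exists x.
rewrite mulf_eq0 subr_eq0 => /orP[/eqP/E/fin//|/eqP lnq].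
apply/fin/E.
have := A_ge0 kn; rewrite le_eqVlt => /orP[/eqP AE|Ap].
  have := sum_movingS kn; rewrite -AE => S; apply/eqP; rewrite eq_le S/=.
  by apply: sumr_ge0 => x _; exact: B_ge0.
have : ln (qrat k) < 0.
  apply: ln_lt0; apply/andP; split; first by apply: divr_gt0 => //; exact: A_gt0.
  by rewrite -(pq kn) ltrDr divr_gt0 ?dt_gt0 ?A_gt0.
by rewrite lnq ltxx.
Qed.

(** By [moving_speed] what remains of such an arm shrinks, while it moves, in
    proportion to what remains of the whole. *)
Lemma remaining_gt0 k x : (k < n)%N -> 0 < L x -> subhook L x = 0 -> 0 < rem k x.
Proof.
move=> + Lx Sx; elim: k => [n0|k IH kn]; first by rewrite /remaining phi0 subr0.
have {IH} := IH (ltnW kn) => rk0; have [mx|nmx] := boolP (moving k x); last first.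
  by apply: lt_le_trans rk0 _; rewrite /remaining lerB// leNgt.
have := moving_speed (ltnW kn) mx; rewrite Sx addr0 => E.
have : rem k.+1 x * A k = rem k x * A k.+1.
  have -> : rem k.+1 x = rem k x - dphi k x by rewrite /remaining /dphi; ring.
  by rewrite mulrBl E (AS k); ring.
move=> E2; rewrite -(pmulr_lgt0 _ (A_gt0 (ltnW kn))) E2.
by rewrite mulr_gt0// A_gt0.
Qed.

(** The moving nodes below [x] share out all that remains below [x], each at
    the rate given by [moving_speed]. *)
Lemma remaining_scale k x : (k < n)%N -> (forall y, pdesc x y -> rem k y = 0) ->
  (\sum_(y | desc y x) dphi k y) * (tm n - tm k) = (\sum_(y | desc y x) rem k y) * dt k.
Proof.
move=> kn anc0.
have mov_le y z : desc y x -> desc y z -> moving k z -> desc z x.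
  move=> yx yz mz; have [//|xz] := desc_comp yz yx.
  have [->|nzx] := eqVneq z x; first exact: desc_refl.
  have := anc0 z; rewrite /pdesc xz eq_sym nzx => /(_ isT) rz.
  have := mz; rewrite /moving ltNge => /negP[].
  by move/eqP: rz; rewrite subr_eq0 => /eqP <-; rewrite phi_mono// kn leqnn.
have -> : \sum_(y | desc y x) dphi k y = \sum_(z | moving k z && desc z x) dphi k z.
  rewrite (bigID (moving k)) /= [X in _ + X]big1 ?addr0; last first.
    move=> y /andP[_ ny]; apply/eqP; rewrite eq_le dphi_ge0// andbT subr_le0 leNgt//.
  by apply: eq_bigl => z; rewrite andbC.
have -> : \sum_(y | desc y x) rem k y = \sum_(z | moving k z && desc z x) \sum_(y | desc y z) rem k y.
  rewrite sum_unique_anc; last first.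
    by move=> y z z' /andP[mz _] /andP[mz' _]; exact: (moving_anc_uniq kn).
  rewrite big_mkcond [RHS]big_mkcond /=; apply: eq_bigr => y _.
  case: ifPn => [yx|nyx].
    case: ifPn => // ne; apply/eqP; rewrite eq_le remaining_ge0 ?(ltnW kn)// andbT leNgt.
    apply: contra ne => /(remaining_covered kn)[z mz yz].
    by apply/existsP; exists z; rewrite mz (mov_le _ _ yx yz mz).
  case: ifPn => // /existsP[z /andP[/andP[_ zx] yz]].
  by rewrite (desc_trans yz zx) in nyx.
rewrite !mulr_suml; apply: eq_bigr => z /andP[mz _].
by rewrite moving_speed// moving_remaining.
Qed.

End Equality.
End Progression.
End Forest.

(** * Minimisers of the hook cost *)

Section Expansion.
Context {R : realType}.
Implicit Types (a b v w : R).

(** The entropy term [xln e] only appears when [a] is 0; otherwise [xln]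
    varies linearly, by convexity. *)
Lemma xln_expand_le a (al : R) : 0 <= a -> 0 <= a + al ->
  exists c, forall e : R, 0 < e < 1 ->
    xln (a + e * al) <= xln a + e * c + (if a == 0 then al else 0) * xln e.
Proof.
move=> a0 aal; case: eqVneq => [->|an] in a0 aal *.
  exists (xln al) => e /andP[e0 e1]; rewrite add0r in aal.
  by rewrite xln0 !add0r mulrC xlnM ?(ltW e0)// addrC.
exists (xln (a + al) - xln a) => e /andP[e0 e1].
have := @xln_convex _ e a (a + al); rewrite (ltW e0) (ltW e1) => /(_ isT a0 aal).
have -> : (1 - e) * a + e * (a + al) = a + e * al by ring.
by rewrite mul0r addr0; lra.
Qed.

Lemma xln_expand_ge b (be : R) : 0 <= b -> 0 <= b + be ->
  exists c, forall e : R, 0 < e < 1 ->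
    - xln (b + e * be) <= - xln b + e * c - (if b == 0 then be else 0) * xln e.
Proof.
move=> b0 bbe; case: eqVneq => [->|bn] in b0 bbe *.
  exists (- xln be) => e /andP[e0 e1]; rewrite add0r in bbe.
  by rewrite xln0 !add0r mulrC xlnM ?(ltW e0)//; lra.
exists (- ((ln b + 1) * be)) => e /andP[e0 e1].
have b1 : 0 <= b + e * be.
  have -> : b + e * be = (1 - e) * b + e * (b + be) by ring.
  by rewrite addr_ge0// mulr_ge0// ?subr_ge0 ltW.
have := xln_tangent (_ : 0 < b) b1; rewrite lt0r bn b0 => /(_ isT).
rewrite (addrC b) addrK mul0r subr0; lra.
Qed.

(** Both [e] and [xln e] tend to 0 with [e]. *)
Lemma ge_of_xln_error v w (C S : R) :
  (forall e : R, 0 < e < 1 -> v <= w + e * C + S * xln e) -> v <= w.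
Proof.
move=> h; apply/ler_addgt0Pr => d d0.
(* For [e = x ^+ 2] the error is at most [x * K]. *)
pose K := `|C| + 2 * `|S| + 1.
have K0 : 0 < K by rewrite ltr_wpDl// addr_ge0// mulr_ge0.
pose x := Num.min (1 / 2) (d / K).
have x0 : 0 < x by rewrite lt_min divr_gt0//= divr_gt0.
have x1 : x < 1 by rewrite gt_min; apply/orP; left; lra.
have xd : x * K <= d by rewrite -ler_pdivlMr// ge_min lexx orbT.
have H : v <= w + x ^+ 2 * C + S * xln (x ^+ 2).
  by apply: h; rewrite exprn_gt0//= exprn_ilt1// ltW.
apply: le_trans H _; rewrite -addrA lerD2l; apply: le_trans xd.
have /andP[g1 g2] := sqrt_xln x0 x1.
have H1 : x ^+ 2 * C <= x * `|C|.
  rewrite expr2 -mulrA ler_wpM2l ?(ltW x0)//.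
  apply: le_trans (ler_norm _) _; rewrite normrM gtr0_norm//.
  by rewrite ler_piMl ?(ltW x1).
have H2 : S * xln (x ^+ 2) <= `|S| * (2 * x).
  apply: le_trans (ler_norm _) _; rewrite normrM ler_wpM2l//.
  by rewrite ler0_norm// lerNl.
rewrite /K; nra.
Qed.

(** Near 0, [xln e] dominates every multiple of [e]. *)
Lemma le0_of_xln_error (C S : R) :
  (forall e : R, 0 < e < 1 -> 0 <= e * C + S * xln e) -> S <= 0.
Proof.
move=> h; rewrite leNgt; apply/negP => S0.
pose t := (`|C| + 1) / S.
have t0 : 0 < t by rewrite divr_gt0// ltr_wpDl.
have := h (expR (- t)); rewrite expR_gt0 expR_lt1 oppr_lt0 => /(_ t0).
rewrite /xln expRK mulrCA -mulrDr pmulr_rge0 ?expR_gt0//.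
rewrite /t mulrN mulrCA divff ?gt_eqF// mulr1.
have := ler_norm C; lra.
Qed.

End Expansion.

Section Variation.
Context {R : realType} {H E : finType}.
Variable up : H -> option H.
Variables (ed : H -> E) (len : E -> R) (opp : pred H).
Hypothesis len_gt0 : forall e, 0 < len e.
Hypothesis edge_nonopp : forall e, exists x, ed x = e /\ ~~ opp x.
Implicit Types L D : H -> R.
Local Notation hook := (hook up).
Local Notation subhook := (subhook up).
Local Notation cost := (hook_cost up).

Definition feasible L := [/\ forall x, 0 <= L x,
  forall e, \sum_(x | ed x == e) L x = len e & forall x, opp x -> L x = 0].

(** The extents that an actual flooding of the forest can realise with all
    arms moving; [feasible] is the closure of this set. *)
Definition generic L := feasible L /\ forall x, ~~ opp x -> 0 < L x.

Lemma hook_cost_expand L D : (forall x, 0 <= L x) -> (forall x, 0 <= L x + D x) ->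
  exists C, forall e : R, 0 < e < 1 ->
    cost (fun x => L x + e * D x) <= cost L + e * C
      + (\sum_(x | hook L x == 0) hook D x - \sum_(x | subhook L x == 0) subhook D x) * xln e.
Proof.
move=> L0 LD0.
have h1 x : 0 <= hook L x + hook D x by rewrite /hook -big_split; apply: sumr_ge0 => y _; exact: LD0.
have h2 x : 0 <= subhook L x + subhook D x by rewrite /subhook -big_split; apply: sumr_ge0 => y _; exact: LD0.
have [c1 c1P] := choice (fun x => xln_expand_le (hook_ge0 up x L0) (h1 x)).
have [c2 c2P] := choice (fun x => xln_expand_ge (subhook_ge0 up x L0) (h2 x)).
exists (\sum_x (c1 x + c2 x)) => e e01.
rewrite mulrBl !mulr_suml [X in _ + (X - _)]big_mkcond [X in _ + (_ - X)]big_mkcond /=.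
rewrite mulr_sumr /hook_cost -sumrB -!big_split /=; apply: ler_sum => x _.
rewrite hook_linear subhook_linear.
have := c1P x e e01; have := c2P x e e01.
case: eqP => _; case: eqP => _; rewrite ?mul0r; lra.
Qed.

Lemma feasible_mix L L' (e : R) : feasible L -> feasible L' -> 0 < e < 1 ->
  feasible (fun x => L x + e * (L' x - L x)).
Proof.
move=> [L0 Ls Lo] [L'0 L's L'o] /andP[e0 e1]; split=> [x|d|x ox].
- have -> : L x + e * (L' x - L x) = (1 - e) * L x + e * L' x by ring.
  by rewrite addr_ge0// mulr_ge0// ?subr_ge0 ltW.
- by rewrite big_split -mulr_sumr sumrB /= Ls L's subrr mulr0 addr0.
- by rewrite Lo// L'o// subrr mulr0 addr0.
Qed.

Lemma generic_mix L L' (e : R) : feasible L -> generic L' -> 0 < e < 1 ->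
  generic (fun x => L x + e * (L' x - L x)).
Proof.
move=> fL [fL' gL'] e01; split; first exact: feasible_mix.
move=> x nx; have [L0 _ _] := fL; have /andP[e0 e1] := e01.
have -> : L x + e * (L' x - L x) = (1 - e) * L x + e * L' x by ring.
by rewrite ltr_wpDl ?mulr_gt0 ?gL'// mulr_ge0// subr_ge0 ltW.
Qed.

Lemma generic_exists : exists L, generic L.
Proof.
pose c e := \sum_(x | (ed x == e) && ~~ opp x) (1 : R).
have c0 e : 0 < c e.
  have [x [xe ox]] := edge_nonopp e.
  rewrite /c (bigD1 x)/=; last by rewrite xe eqxx.
  by rewrite ltr_pwDl// sumr_ge0.
pose L x := if opp x then 0 else len (ed x) / c (ed x).
exists L; split; first split=> [x|e|x]; rewrite /L.
- by case: ifP => // _; rewrite divr_ge0// ltW.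
- transitivity (\sum_(x | (ed x == e) && ~~ opp x) (len e / c e) * 1).
    rewrite big_mkcondr; apply: eq_bigr => x /eqP ->.
    by case: ifP; rewrite ?mulr1.
  by rewrite -mulr_sumr -/(c e) divfK// gt_eqF.
- by move=> ->.
- by move=> x /negbTE->; rewrite divr_gt0.
Qed.

(** Mixing in a positive configuration with weight [e] changes the cost by at
    most multiples of [e] and of [xln e]. *)
Lemma generic_bound v L : (forall L', generic L' -> v <= cost L') ->
  feasible L -> v <= cost L.
Proof.
move=> gv fL; have [L' gL'] := generic_exists.
have [L0 _ _] := fL; have [[L'0 _ _] _] := gL'.
have LD0 x : 0 <= L x + (L' x - L x) by rewrite addrC subrK.
have [C CP] := hook_cost_expand L0 LD0.
apply: (ge_of_xln_error (C := C)) => e e01.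
by apply: le_trans (CP e e01); apply: gv; exact: generic_mix.
Qed.

Section Minimiser.
Variable L : H -> R.
Hypotheses (fL : feasible L) (minL : forall L', feasible L' -> cost L <= cost L').

(** Moving a piece of length [e] from elsewhere on the edge to [x] would
    change the cost by a positive multiple of [xln e], which is negative and
    beats every linear term. *)
Lemma minimiser_no_idle x : ~~ opp x -> hook L x = 0 ->
  (forall y, pdesc up x y -> subhook L y = 0 -> hook L y = 0) -> False.
Proof.
move=> nx hx anc; have [L0 Ls Lo] := fL.
have [z [ze Lz]] : exists z, ed z = ed x /\ 0 < L z.
  apply: contrapT => nz; have := len_gt0 (ed x); rewrite -Ls big1 ?ltxx// => z /eqP ze.
  by apply/eqP; rewrite eq_le L0 andbT leNgt; apply/negP => Lz; apply: nz; exists z.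
have hz : 0 < hook L z by rewrite hookE ltr_pwDl ?subhook_ge0.
have zx : z != x by apply: contraTneq hz => ->; rewrite hx ltxx.
(* The whole length of [z] goes to [x]; small fractions of this move are used. *)
pose D y : R := L z * ((y == x)%:R - (y == z)%:R).
have fD : feasible (fun y => L y + D y).
  split=> [y|e|y oy]; rewrite /D.
  - case: eqVneq => [->|yx]; first by rewrite (eq_sym x) (negbTE zx) subr0 mulr1 addr_ge0.
    case: eqVneq => [->|yz]; first by rewrite sub0r mulrN1 subrr.
    by rewrite subrr mulr0 addr0.
  - rewrite big_split /= Ls -mulr_sumr sumrB.
    suff -> : \sum_(y | ed y == e) ((y == x)%:R : R) = \sum_(y | ed y == e) ((y == z)%:R : R).
      by rewrite subrr mulr0 addr0.
    rewrite [LHS]big_mkcond [RHS]big_mkcond [LHS](bigD1 x)// [RHS](bigD1 z)//= !eqxx ze.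
    by rewrite !big1// => y /negbTE ->; case: ifP.
  - have yx : y != x by apply: contraTneq oy => ->.
    have yz : y != z by apply: contraTneq Lz => <-; rewrite Lo// ltxx.
    by rewrite (negbTE yx) (negbTE yz) subrr mulr0 addr0 Lo.
have LD0 y : 0 <= L y + D y by case: fD.
have [C CP] := hook_cost_expand L0 LD0.
set S := (\sum_(y | hook L y == 0) hook D y - _) in CP.
have S0 : S <= 0.
  apply: (le0_of_xln_error (C := C)) => e e01.
  rewrite -(lerD2l (cost L)) addr0 addrA; apply: le_trans (CP e e01).
  apply: minL; have -> : (fun y => L y + e * D y) = (fun y => L y + e * ((L y + D y) - L y)).
    by apply/funext => y; rewrite addrC (addrC (L y) (D y)) addrK addrC.
  exact: feasible_mix.
suff SE : S = L z by move: S0; rewrite SE leNgt Lz.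
rewrite /S big_mkcond [X in _ - X]big_mkcond -sumrB /= (bigD1 x)//= hx eqxx.
have sx : subhook L x = 0.
  by apply/eqP; rewrite eq_le subhook_ge0// andbT -hx hookE lerDr.
have Dx : D x = L z by rewrite /D eqxx eq_sym (negbTE zx) subr0 mulr1.
rewrite sx eqxx hookE addrK Dx big1 ?addr0//.
move=> y yx; have Dy : hook L y = 0 -> D y = 0.
  move=> hy; rewrite /D (negbTE yx); case: eqVneq => [yz|_]; last by rewrite subrr mulr0.
  by move: hz; rewrite -yz hy ltxx.
case: eqVneq => [hy|hy].
  have -> : subhook L y = 0.
    by apply/eqP; rewrite eq_le subhook_ge0// andbT -hy hookE lerDr.
  by rewrite eqxx hookE Dy// add0r subrr.
case: eqVneq => [sy|_]; last by rewrite subrr.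
rewrite sub0r /subhook big1 ?oppr0// => w wy.
rewrite /D; case: eqVneq => [wx|_].
  by move: hy; rewrite anc ?eqxx// -wx.
case: eqVneq => [wz|_]; last by rewrite subrr mulr0.
move: sy; rewrite /subhook (bigD1 w)//= => /eqP.
by rewrite wz paddr_eq0 ?sumr_ge0// (gt_eqF Lz).
Qed.

(** Moving a source along its edge transfers length from [r] to [r'], and the
    derivative of the cost is the difference of the logarithms of the two
    hooks. *)
Lemma minimiser_balance r r' : up r = None -> up r' = None -> r != r' ->
  ed r = ed r' -> ~~ opp r' -> 0 < L r -> hook L r <= hook L r'.
Proof.
move=> uN u'N rr' ee nr' Lr; have [L0 Ls Lo] := fL; rewrite leNgt; apply/negP => hh.
have [e [e0 eL eh]] : exists e : R, [/\ 0 < e, e <= L r & hook L r' + e < hook L r - e].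
  (* A shift short enough to keep the hook of [r] the larger one. *)
  exists (Num.min (L r) ((hook L r - hook L r') / 3)); split.
  - by rewrite lt_min Lr divr_gt0 ?subr_gt0.
  - by rewrite ge_min lexx.
  - have : Num.min (L r) ((hook L r - hook L r') / 3) <= (hook L r - hook L r') / 3.
      by rewrite ge_min lexx orbT.
    move: (Num.min _ _) => m; lra.
pose D y : R := (y == r')%:R - (y == r)%:R.
pose L' y := L y + e * D y.
have dr y s : up s = None -> desc up s y -> s = y.
  by move=> sN /descP[//|[w]]; rewrite sN.
have fL' : feasible L'.
  split=> [y|d|y oy]; rewrite /L' /D.
  - case: (eqVneq y r') => [->|_].
      by rewrite eq_sym (negbTE rr') subr0 mulr1 addr_ge0// ltW.
    by case: eqVneq => [->|_]; rewrite ?subrr ?mulr0 ?addr0// sub0r mulrN1 subr_ge0.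
  - rewrite big_split /= Ls -mulr_sumr sumrB.
    suff -> : \sum_(y | ed y == d) ((y == r')%:R : R) = \sum_(y | ed y == d) ((y == r)%:R : R).
      by rewrite subrr mulr0 addr0.
    rewrite [LHS]big_mkcond [RHS]big_mkcond [LHS](bigD1 r')// [RHS](bigD1 r)//= !eqxx ee.
    by rewrite !big1// => y /negbTE ->; case: ifP.
  - have yr' : y != r' by apply: contraTneq oy => ->.
    have yr : y != r by apply: contraTneq Lr => <-; rewrite Lo// ltxx.
    by rewrite (negbTE yr) (negbTE yr') subrr mulr0 addr0 Lo.
have := minL fL'; apply/negP; rewrite -ltNge.
have hD y : hook D y = (y == r')%:R - (y == r)%:R.
  rewrite /hook sumrB; congr (_ - _).
    have [->|yr'] := eqVneq y r'.
      rewrite (bigD1 r') ?desc_refl//= eqxx big1 ?addr0// => w /andP[_ /negbTE->//].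
    rewrite big1// => w wy; case: eqVneq => // wr'.
    by move: yr'; rewrite wr' in wy; rewrite (dr _ _ u'N wy) eqxx.
  have [->|yr] := eqVneq y r.
    rewrite (bigD1 r) ?desc_refl//= eqxx big1 ?addr0// => w /andP[_ /negbTE->//].
  rewrite big1// => w wy; case: eqVneq => // wr.
  by move: yr; rewrite wr in wy; rewrite (dr _ _ uN wy) eqxx.
have sD y : subhook D y = 0.
  have : D y = D y + subhook D y by rewrite -hookE hD.
  by move: (subhook D y) => s; lra.
rewrite /L' /hook_cost (bigD1 r)//= [ltRHS](bigD1 r)//= (bigD1 r')/=; last by rewrite eq_sym.
rewrite [X in _ < _ + X](bigD1 r')/=; last by rewrite eq_sym.
rewrite !hook_linear !subhook_linear !sD !hD !eqxx (negbTE rr') eq_sym (negbTE rr').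
rewrite [X in _ + (_ + X) < _](eq_bigr (fun y => xln (hook L y) - xln (subhook L y))); last first.
  move=> y /andP[/negbTE yr /negbTE yr'].
  by rewrite hook_linear subhook_linear sD hD yr yr' subrr mulr0 !addr0.
rewrite mulr0 !addr0 subr0 sub0r mulr1 mulrN1 !addrA ltrD2r.
have h'0 : 0 <= hook L r' by exact: hook_ge0.
have hr0 : 0 < hook L r by apply: le_lt_trans hh.
have p1 : 0 < hook L r - e by apply: lt_trans eh; rewrite ltr_wpDl.
have p2 : 0 < hook L r' + e by rewrite ltr_wpDl.
have T1 := xln_tangent p1 (ltW hr0).
have T2 := xln_tangent p2 h'0.
have lnlt : ln (hook L r' + e) < ln (hook L r - e) by rewrite ltr_ln// posrE.
rewrite opprB addrCA subrr addr0 in T1.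
rewrite opprD addrA subrr sub0r in T2.
have : e * ln (hook L r' + e) < e * ln (hook L r - e) by rewrite ltr_pM2l.
lra.
Qed.

End Minimiser.
End Variation.

(** * Points and topology of a metric graph *)

Section Points.
Context {R : realType} {G : metricGraph R}.
Implicit Types (e : edge G) (x y : R) (p q : gspace G) (A : set (gspace G)).

Definition end_vertex e x : option (vertex G) :=
  if x == 0 then Some (src e) else if x == len e then Some (tgt e) else None.

Lemma len_neq0 e : (len e == 0) = false. Proof. by rewrite gt_eqF ?len_gt0. Qed.

Lemma end_vertex0 e : end_vertex e 0 = Some (src e). Proof. by rewrite /end_vertex eqxx. Qed.
Lemma end_vertex_len e : end_vertex e (len e) = Some (tgt e).
Proof. by rewrite /end_vertex len_neq0 eqxx. Qed.

Lemma pt_eqP e x e' x' : in_edge e x -> in_edge e' x' ->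
  (pt e x = pt e' x' <->
   (e = e' /\ x = x') \/ exists v, end_vertex e x = Some v /\ end_vertex e' x' = Some v).
Proof.
move=> ex ex'; rewrite /pt.
have -> : insubd (exist _ (e, 0) (prepoint0_subproof e) : prepoint G) (e, x)
    = exist _ (e, x) ex :> prepoint G.
  by apply: val_inj; rewrite val_insubd /= ifT.
have -> : insubd (exist _ (e', 0) (prepoint0_subproof e') : prepoint G) (e', x')
    = exist _ (e', x') ex' :> prepoint G.
  by apply: val_inj; rewrite val_insubd /= ifT.
split.
  move/eqquotP => /= /orP[/eqP[-> ->]|/andP[/= + /eqP]]; first by left.
  rewrite /vertex_at /= -/(end_vertex e x) -/(end_vertex e' x').
  by case: end_vertex => // v _ <-; right; exists v.
move=> h; apply/eqquotP => /=; rewrite /same_point.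
case: h => [[? ?]|[v [h1 h2]]]; first by subst; apply/orP; left; apply/eqP; exact: val_inj.
apply/orP; right; rewrite /vertex_at /= -/(end_vertex e x) -/(end_vertex e' x').
by rewrite h1 h2 /=.
Qed.

Lemma gspace_ptP p : exists e x, in_edge e x /\ p = pt e x.
Proof.
elim/quotW: p => -[[e x] ex]; exists e, x; split=> //.
rewrite /pt; congr (\pi_(gspace G) _)%qT; apply: val_inj.
by rewrite val_insubd /= ifT.
Qed.

Lemma end_vertexP e x v : end_vertex e x = Some v ->
  (x = 0 /\ src e = v) \/ (x = len e /\ tgt e = v).
Proof.
rewrite /end_vertex; case: eqP => [-> [->]|_]; first by left.
by case: eqP => // -> [->]; right.
Qed.

Lemma end_vertex_mid e x : 0 < x < len e -> end_vertex e x = None.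
Proof. by move=> /andP[x0 x1]; rewrite /end_vertex gt_eqF// lt_eqF. Qed.

Lemma pt_inj e x y : in_edge e x -> in_edge e y -> pt e x = pt e y -> x = y.
Proof.
move=> ex ey /(pt_eqP ex ey)[[]//|[v [/end_vertexP hx /end_vertexP hy]]].
have st := src_neq_tgt e.
case: hx hy => -[-> xv] [] [-> yv] //; by rewrite xv yv eqxx in st.
Qed.

Lemma pt_mid_inj e x e' y : in_edge e x -> 0 < y < len e' -> pt e x = pt e' y ->
  e = e' /\ x = y.
Proof.
move=> ex y01 h; have ey : in_edge e' y by move/andP: y01 => [? ?]; rewrite /in_edge !ltW.
by move/(pt_eqP ex ey): h => [//|[v [_]]]; rewrite end_vertex_mid.
Qed.

Lemma fin_min (I : finType) (P : I -> R -> Prop) :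
  (forall i d d', d' <= d -> P i d -> P i d') ->
  (forall i, exists2 d, 0 < d & P i d) -> exists2 d, 0 < d & forall i, P i d.
Proof.
move=> anti ex; have [d dP] := choice (fun i => let: ex_intro2 d h1 h2 := ex i in
  ex_intro (fun d => 0 < d /\ P i d) d (conj h1 h2)).
exists (\big[Num.min/1]_i d i).
  by apply: lt_bigmin => // i _; have [] := dP i.
by move=> i; have [_] := dP i; apply: anti; exact: bigmin_le_cond.
Qed.

(** To leave the star of edges at [p], a path must run along the whole
    remainder of an edge. *)
Lemma path_star p : exists2 d, 0 < d & forall q l, path_length p q l -> l < d ->
  exists e x y, [/\ in_edge e x, in_edge e y, p = pt e x, q = pt e y & `|x - y| <= l].
Proof.
pose good d := forall e x, in_edge e x -> p = pt e x ->
  [/\ d <= len e, (x != 0 -> d <= x) & (x != len e -> d <= len e - x)].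
have [d d0 dP] : exists2 d, 0 < d & good d.
  have [||d d0 dP] := @fin_min (edge G) (fun e d => forall x, in_edge e x -> p = pt e x ->
     [/\ d <= len e, (x != 0 -> d <= x) & (x != len e -> d <= len e - x)]) .
  - move=> e d d' dd' h x ex px; have [h1 h2 h3] := h x ex px.
    by split; [exact: le_trans h1|move=> /h2; exact: le_trans|move=> /h3; exact: le_trans].
  - move=> e; have [[x [ex px]]|nx] := pselect (exists x, in_edge e x /\ p = pt e x); last first.
      by exists 1 => // x ex px; case: nx; exists x.
    exists (Num.min (len e) (Num.min (if x == 0 then 1 else x) (if x == len e then 1 else len e - x))).
      rewrite !lt_min len_gt0 /=; move/andP: ex => [x0 x1].
      case: eqVneq => [_|xn0]; case: eqVneq => [_|xn1]; rewrite ?ltr01 //= ?subr_gt0.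
      + by rewrite lt_neqAle xn1.
      + by rewrite lt0r xn0 x0.
      + by rewrite lt0r xn0 x0 lt_neqAle xn1.
    move=> y ey py; have <- : x = y by apply: (pt_inj ex ey); rewrite -px.
    split; first by rewrite ge_min lexx.
      by move=> /negbTE ->; rewrite !ge_min lexx /= orbT.
    by move=> /negbTE ->; rewrite !ge_min lexx /= !orbT.
  - by exists d => // e x; exact: dP.
exists d => // q l pq ld.
suff H p' q' l' : path_length p' q' l' -> forall r, 0 <= r -> r + l' < d ->
    (exists e x y, [/\ in_edge e x, in_edge e y, p = pt e x, p' = pt e y & `|x - y| <= r]) ->
    exists e x y, [/\ in_edge e x, in_edge e y, p = pt e x, q' = pt e y & `|x - y| <= r + l'].
  have [e [x [ex px]]] := gspace_ptP p.
  have := H _ _ _ pq 0 (lexx _); rewrite add0r => /(_ ld); apply.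
  by exists e, x, x; split; rewrite ?subrr ?normr0.
have plen p1 q1 l1 : path_length p1 q1 l1 -> 0 <= l1.
  by elim=> // *; rewrite addr_ge0.
elim=> {p' q' l'} [p' r r0 _ h|e1 x1 y1 q' l' ex1 ey1 pl IH r r0 rl].
  by rewrite addr0.
move=> [e [x [y [ex ey px pe pr]]]].
rewrite addrA; apply: IH; [by rewrite addr_ge0| by rewrite -addrA|].
have rd : r < d.
  by apply: le_lt_trans rl; rewrite lerDl addr_ge0//; exact: plen pl.
have [[ee xy]|[v [hv1 hv]]] := (pt_eqP ex1 ey).1 pe.
  subst e1 x1; exists e, x, y1; split=> //.
  have := ler_distD y x y1; move=> h; apply: le_trans h _; exact: lerD.
have [g1 g2 g3] := dP e x ex px.
have xy : x = y.
  apply/eqP; apply: contraT => xy; move/andP: ex => [x0 xl].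
  have [[y0 _]|[yl _]] := end_vertexP hv.
    have xn : x != 0 by rewrite -y0.
    have := lt_le_trans rd (g2 xn); rewrite y0 subr0 ger0_norm// in pr.
    by rewrite ltNge pr.
  have xn : x != len e by rewrite -yl.
  have := lt_le_trans rd (g3 xn); rewrite yl distrC ger0_norm ?subr_ge0// in pr.
  by rewrite ltNge pr.
exists e1, x1, y1; split=> //; first by rewrite px xy -pe.
by rewrite lerDr.
Qed.

Lemma nbhs_ptP p (U : set (gspace G)) : nbhs p U <->
  (forall e x, in_edge e x -> p = pt e x ->
     exists2 d, 0 < d & forall y, in_edge e y -> `|x - y| < d -> U (pt e y)).
Proof.
split.
  move=> /nbhs_ballP[d /= d0 dU] e x ex px; exists d => // y ey xyd; apply: dU.
  exists `|x - y| => //; rewrite px -[X in path_length _ _ X]addr0.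
  by apply: path_length_cons => //; exact: path_length_nil.
move=> h.
have [||d1 d10 d1P] := @fin_min (edge G) (fun e d => forall x y, in_edge e x -> p = pt e x ->
    in_edge e y -> `|x - y| < d -> U (pt e y)) .
- by move=> e d d' dd' hd x y ex px ey xy; apply: (hd x) => //; exact: lt_le_trans xy dd'.
- move=> e; have [[x [ex px]]|nx] := pselect (exists x, in_edge e x /\ p = pt e x); last first.
    by exists 1 => // x y ex px; case: nx; exists x.
  have [d d0 dU] := h e x ex px; exists d => // x' y ex' px' ey.
  by have -> : x' = x; [apply: (pt_inj ex' ex); rewrite -px|exact: dU].
have [d2 d20 d2P] := path_star p.
apply/nbhs_ballP; exists (Num.min d1 d2) => /=; first by rewrite lt_min d10.
move=> q [l pl]; rewrite lt_min => /andP[l1 l2].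
have [e [x [y [ex ey px -> xy]]]] := d2P q l pl l2.
by apply: (d1P e x y) => //; exact: le_lt_trans l1.
Qed.

Lemma closed_ptP A : closed A <->
  (forall e x, in_edge e x -> ~ A (pt e x) ->
     exists2 d, 0 < d & forall y, in_edge e y -> `|x - y| < d -> ~ A (pt e y)).
Proof.
split.
  move=> /closed_openC; rewrite openE => oA e x ex nA.
  exact: ((nbhs_ptP _ _).1 (oA (pt e x) nA)).
move=> h; rewrite -openC openE => p nA; apply/nbhs_ptP => e x ex px.
by apply: h => //; rewrite -px.
Qed.

Lemma pt_continuous e (a b : R) : 0 <= a -> b <= len e ->
  {within `[a, b], continuous (pt e)}.
Proof.
move=> a0 bl; apply/subspace_continuousP => x; rewrite /= in_itv /= => /andP[ax xb].
have ex : in_edge e x by rewrite /in_edge (le_trans a0 ax) (le_trans xb bl).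
move=> U /= /nbhs_ptP/(_ e x ex erefl)[d d0 dU].
apply/nbhs_ballP; exists d => //= y xy; rewrite in_itv /= => /andP[ay yb].
apply: dU => //; by rewrite /in_edge (le_trans a0 ay) (le_trans yb bl).
Qed.

Definition segment e (a b : R) : set (gspace G) := pt e @` `[a, b].

Lemma segment_connected_set e a b : 0 <= a -> b <= len e -> connected (segment e a b).
Proof.
move=> a0 bl; apply: connected_continuous_connected; first exact: segment_connected.
exact: pt_continuous.
Qed.

Lemma segment_closed e a b : 0 <= a -> b <= len e -> closed (segment e a b).
Proof.
move=> a0 bl; apply/closed_ptP => e' x ex nA.
have sub y : y \in `[a, b] -> in_edge e y.
  by rewrite in_itv /= => /andP[ay yb]; rewrite /in_edge (le_trans a0 ay) (le_trans yb bl).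
have [d1 d10 d1P] : exists2 d, 0 < d & forall y, in_edge e' y -> `|x - y| < d -> y != x -> 0 < y < len e'.
  move/andP: ex => [x0]; rewrite le_eqVlt => /orP[/eqP xl|xl].
    exists (len e'); first exact: len_gt0.
    move=> y /andP[y0 yl]; rewrite xl ger0_norm ?subr_ge0// => h yx.
    have yl' : y < len e' by rewrite lt_neqAle yl yx.
    by rewrite yl' andbT; lra.
  move: x0; rewrite le_eqVlt => /orP[/eqP <-|x0].
    exists (len e'); first exact: len_gt0.
    by move=> y /andP[y0 yl]; rewrite sub0r normrN ger0_norm// lt0r y0 => -> ->.
  exists (Num.min x (len e' - x)); first by rewrite lt_min x0 subr_gt0.
  by move=> y /andP[y0 yl]; rewrite lt_min !ltr_norml => /andP[/andP[h1 h2] /andP[h3 h4]] _; lra.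
have [ee|ne] := pselect (e = e'); last first.
  exists d1 => // y ey xy; have [-> //|yx] := eqVneq y x.
  move=> [z /= zab zy]; apply: ne.
  by have [] := pt_mid_inj (sub z zab) (d1P _ ey xy yx) zy.
subst e'; have nx : ~ (`[a, b]%classic x) by move=> h; apply: nA; exists x.
have [d2 d20 d2P] : exists2 d2, 0 < d2 & forall y, `|x - y| < d2 -> ~ `[a, b]%classic y.
  move: nx; rewrite /= in_itv /= => /negP; rewrite negb_and -!ltNge => /orP[xa|xb].
    exists (a - x); first by rewrite subr_gt0.
    by move=> y; rewrite ltr_norml in_itv /= => /andP[h1 h2] /andP[h3 _]; lra.
  exists (x - b); first by rewrite subr_gt0.
  by move=> y; rewrite ltr_norml in_itv /= => /andP[h1 h2] /andP[_ h3]; lra.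
exists (Num.min d1 d2); first by rewrite lt_min d10.
move=> y ey; rewrite lt_min => /andP[xy1 xy2]; have [-> //|yx] := eqVneq y x.
move=> [z /= zab zy].
have [_ zE] := pt_mid_inj (sub z zab) (d1P _ ey xy1 yx) zy.
by apply: (d2P y) => //; rewrite /= -zE.
Qed.

Lemma boundaryP A p : closed A -> boundary A p <-> A p /\ ~ A° p.
Proof. by move=> cA; rewrite /boundary -(closure_id A).1. Qed.

Lemma outward_normalP A a : closed A -> outward_normal A a <->
  [/\ anchored a, A (anchor a) & exists2 t1, 0 < t1 & forall t, 0 < t < t1 ->
     ~ A (pt (aedge a) (acoord a + asign a * t))].
Proof.
move=> cA; split=> [[h1 /(boundaryP _ cA)[h2 _] [t1 t10 h]]|[h1 h2 [t1 t10 h]]].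
  by split=> //; exists t1 => // t /h[].
have ea : in_edge (aedge a) (acoord a).
  by move: h1; rewrite /anchored /in_edge; case: ifP => _ /andP[g1 g2];
    apply/andP; split=> //; exact: ltW.
have [t2 t20 ht2] : exists2 t2, 0 < t2 & forall t, 0 < t < t2 -> in_edge (aedge a) (acoord a + asign a * t).
  move: h1 ea; rewrite /anchored /in_edge /asign; case: ifP => _ /andP[g1 g2] _.
    exists (len (aedge a) - acoord a); first by rewrite subr_gt0.
    by move=> t /andP[t0 tl]; lra.
  by exists (acoord a) => // t /andP[t0 tl]; lra.
have mp : 0 < Num.min t1 t2 by rewrite lt_min t10.
split=> //; last first.
  exists (Num.min t1 t2) => // t /andP[t0]; rewrite lt_min => /andP[l1 l2].
  by split; [apply: ht2|apply: h]; rewrite t0/=.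
apply/boundaryP => //; split=> // /nbhs_ptP/(_ _ _ ea erefl)[d d0 dA].
pose t := Num.min (Num.min t1 t2) d / 2.
have md : 0 < Num.min (Num.min t1 t2) d by rewrite lt_min mp.
have t0 : 0 < t by rewrite divr_gt0.
have tm : t < Num.min (Num.min t1 t2) d by rewrite /t ltr_pdivrMr// ltr_pMr// ltr1n.
move: tm; rewrite !lt_min => /andP[/andP[l1 l2] l3].
apply: (h t); first by rewrite t0.
apply: dA; first by apply: ht2; rewrite t0.
rewrite opprD addrA subrr sub0r normrN normrM (gtr0_norm t0).
by rewrite /asign; case: ifP; rewrite ?normrN normr1 mul1r.
Qed.

(** The two parts of [C] are closed in it and disjoint. *)
Lemma connected_closed_split (T : topologicalType) (C D E : set T) : connected C ->
  closed D -> closed E -> C `<=` D `|` E -> C `&` D `&` E = set0 ->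
  C `<=` D \/ C `<=` E.
Proof.
move=> cC cD cE CDE C0.
have sep : separated (C `&` D) (C `&` E).
  split; apply/seteqP; split=> // x [].
    move=> /closureI[_]; rewrite -(closure_id D).1// => Dx [Cx Ex].
    by rewrite -C0; split.
  move=> [Cx Dx] /closureI[_]; rewrite -(closure_id E).1// => Ex.
  by rewrite -C0; split.
have CU : C `<=` (C `&` D) `|` (C `&` E).
  by move=> x Cx; have [] := CDE _ Cx; [left|right].
by have [h|h] := connected_subset sep CU cC; [left=> x /h[]|right=> x /h[]].
Qed.

End Points.

(** * Edges cut into half-edges *)

Section Grid.
Context {R : realType} {G : metricGraph R}.
Variables (n : edge G -> nat) (c : edge G -> nat -> R).

Definition region := {e : edge G & 'I_(n e).+1}.
Definition half : Type := (region * bool)%type.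
HB.instance Definition _ := Finite.on half.

Implicit Types (r : region) (h : half) (d x t : R) (e : edge G) (A : set (gspace G)).

Definition redge r : edge G := tag r.
Definition ridx r : nat := tagged r.
Definition rlo r := c (redge r) (ridx r).
Definition rhi r := c (redge r) (ridx r).+1.
Definition width r := rhi r - rlo r.

Definition hedge h := redge h.1.
Definition flip h : half := (h.1, ~~ h.2).
Definition hwidth h := width h.1.

Definition coord h d := if h.2 then rlo h.1 + d else rhi h.1 - d.
Definition hpt h d : gspace G := pt (hedge h) (coord h d).
Definition start h : option (vertex G) :=
  if h.2 then (if ridx h.1 == 0 then Some (src (hedge h)) else None)
  else (if ridx h.1 == n (hedge h) then Some (tgt (hedge h)) else None).
Definition arm_of h d : arm G := Arm (hedge h) h.2 (coord h d).

Lemma flipK : involutive flip. Proof. by move=> [r b]; rewrite /flip negbK. Qed.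
Lemma flip_neq h : flip h != h.
Proof. by case: h => r []; rewrite /flip /=; apply/eqP => -[]. Qed.
Lemma hwidth_flip h : hwidth (flip h) = hwidth h. Proof. by []. Qed.

Lemma same_region h h' : h.1 = h'.1 -> h' = h \/ h' = flip h.
Proof. by case: h h' => [r []] [r' []] /= ->; [left|right|right|left]. Qed.

Lemma region_ext r r' : redge r = redge r' -> ridx r = ridx r' -> r = r'.
Proof.
case: r r' => [e i] [e' i']; rewrite /redge /ridx /= => ee; subst e' => ii.
by congr existT; exact: val_inj.
Qed.

Lemma region_at e i : (i <= n e)%N -> exists r, redge r = e /\ ridx r = i.
Proof. by move=> ie; exists (Tagged (fun e => 'I_(n e).+1) (Ordinal (ie : i < (n e).+1)%N)). Qed.

Lemma ridx_le r : (ridx r <= n (redge r))%N.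
Proof. by case: r => e i; rewrite /ridx /redge /= -ltnS. Qed.

Lemma coord_flip h d : coord (flip h) d = coord h (hwidth h - d).
Proof. by case: h => r []; rewrite /coord /hwidth /width /=; ring. Qed.

Lemma hpt_flip h d : hpt (flip h) d = hpt h (hwidth h - d).
Proof. by rewrite /hpt coord_flip. Qed.

Lemma coordD h d t : coord h (d + t) = coord h d + asign (arm_of h d) * t.
Proof. by case: h => r []; rewrite /coord /asign /=; ring. Qed.

Hypotheses (c0 : forall e, c e 0 = 0) (c_last : forall e, c e (n e).+1 = len e).
Hypothesis c_step : forall e i, (i <= n e)%N -> c e i <= c e i.+1.

Lemma c_mono e i j : (i <= j <= (n e).+1)%N -> c e i <= c e j.
Proof.
move=> /andP[]; elim: j => [|j IH]; first by rewrite leqn0 => /eqP->.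
rewrite leq_eqVlt => /orP[/eqP->//|ij jn]; apply: le_trans (c_step jn).
by apply: IH => //; exact: ltnW.
Qed.

Lemma rlo_ge0 r : 0 <= rlo r.
Proof. by rewrite -(c0 (redge r)); apply: c_mono; rewrite leq0n/= leqW// ridx_le. Qed.

Lemma rhi_le r : rhi r <= len (redge r).
Proof. by rewrite -c_last; apply: c_mono; rewrite leqnn andbT ltnS ridx_le. Qed.

Lemma width_ge0 r : 0 <= width r.
Proof. by rewrite subr_ge0 c_step// ridx_le. Qed.
Hint Resolve width_ge0 : core.

Lemma hwidth_ge0 h : 0 <= hwidth h. Proof. exact: width_ge0. Qed.
Hint Resolve hwidth_ge0 : core.

Lemma coord_bounds h d : 0 <= d <= hwidth h -> rlo h.1 <= coord h d <= rhi h.1.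
Proof. by case: h => r []; rewrite /coord /hwidth /width /= => /andP[? ?]; lra. Qed.

Lemma coord_in h d : 0 <= d <= hwidth h -> in_edge (hedge h) (coord h d).
Proof.
move=> /coord_bounds/andP[d0 d1]; rewrite /in_edge.
by rewrite (le_trans (rlo_ge0 _) d0) (le_trans d1 (rhi_le _)).
Qed.

Lemma coord_inj h d d' : coord h d = coord h d' -> d = d'.
Proof. by case: h => r []; rewrite /coord /= => E; lra. Qed.

Lemma hpt_inj h d d' : 0 <= d <= hwidth h -> 0 <= d' <= hwidth h ->
  hpt h d = hpt h d' -> d = d'.
Proof. by move=> hd hd' /(pt_inj (coord_in hd) (coord_in hd'))/coord_inj. Qed.

Lemma regions_disjoint r r' : redge r = redge r' -> r <> r' ->
  rhi r <= rlo r' \/ rhi r' <= rlo r.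
Proof.
move=> ee rr; have : ridx r != ridx r' by apply/eqP => ii; exact/rr/region_ext.
rewrite neq_ltn /rhi /rlo ee => /orP[ii|ii]; [left|right]; apply: c_mono.
  by rewrite ii/= leqW// ridx_le.
by rewrite ii/= leqW// -ee ridx_le.
Qed.

Lemma cover_right e x : 0 <= x < len e -> exists r, redge r = e /\ rlo r <= x < rhi r.
Proof.
move=> /andP[x0 xl]; have ex : exists i, x < c e i.+1 by exists (n e); rewrite c_last.
case: (ex_minnP ex) => i xi mini.
have ine : (i <= n e)%N by apply: mini; rewrite c_last.
have [r [re ri]] := region_at ine; exists r; split=> //.
rewrite /rlo /rhi re ri xi andbT; case: i {ri ine} xi mini => [|i] xi mini; first by rewrite c0.
by rewrite leNgt; apply/negP => /mini; rewrite ltnn.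
Qed.

Lemma cover_left e x : 0 < x <= len e -> exists r, redge r = e /\ rlo r < x <= rhi r.
Proof.
move=> /andP[x0 xl]; have ex : exists i, x <= c e i.+1 by exists (n e); rewrite c_last.
case: (ex_minnP ex) => i xi mini.
have ine : (i <= n e)%N by apply: mini; rewrite c_last.
have [r [re ri]] := region_at ine; exists r; split=> //.
rewrite /rlo /rhi re ri xi andbT; case: i {ri ine} xi mini => [|i] xi mini; first by rewrite c0.
by rewrite ltNge; apply/negP => /mini; rewrite ltnn.
Qed.

Lemma cover e x : in_edge e x -> exists h d, [/\ hedge h = e, 0 <= d <= hwidth h & coord h d = x].
Proof.
move=> /andP[x0]; rewrite le_eqVlt => /orP[/eqP xl|xl].
  have [r [re /andP[h1 h2]]] := @cover_left e (len e) (introT andP (conj (len_gt0 e) (lexx _))).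
  exists (r, false), (rhi r - x); rewrite /hedge /hwidth /width /coord /= xl; split=> //; lra.
have [r [re /andP[h1 h2]]] := @cover_right e x (introT andP (conj x0 xl)).
by exists (r, true), (x - rlo r); rewrite /hedge /hwidth /width /coord /=; split=> //; lra.
Qed.

(** Half-edges overlap only in their end points, except for the two that run
    through the same region. *)
Lemma coord_mid_inj h d h' d' : hedge h = hedge h' -> coord h d = coord h' d' ->
  0 < d < hwidth h -> 0 <= d' <= hwidth h' ->
  (h' = h /\ d' = d) \/ (h' = flip h /\ d' = hwidth h - d).
Proof.
move=> ee xx d01 d'01.
have rr : h.1 = h'.1.
  apply: contrapT => rr; have := regions_disjoint ee rr.
  have /andP[g1 g2] := coord_bounds d'01; rewrite -xx in g1 g2.
  move: d01 g1 g2; case: (h) => r []; rewrite /coord /hwidth /width /= => /andP[? ?] ? ? []; lra.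
have [hh|hh] := same_region rr; subst h'; [left|right]; split=> //.
  by apply: (@coord_inj h).
rewrite coord_flip in xx; have := coord_inj xx; lra.
Qed.

Lemma hpt_mid_inj h d h' d' : hpt h' d' = hpt h d ->
  0 < d < hwidth h -> 0 <= d' <= hwidth h' ->
  (h' = h /\ d' = d) \/ (h' = flip h /\ d' = hwidth h - d).
Proof.
move=> E d01 d'01.
have mid : 0 < coord h d < len (hedge h).
  have := rlo_ge0 h.1; have := rhi_le h.1.
  by move: d01; rewrite /hedge /coord /hwidth /width; case: (h) => r [] /= /andP[? ?] ? ?; lra.
have [ee xx] := pt_mid_inj (coord_in d'01) mid E.
exact: coord_mid_inj.
Qed.

Lemma coord_half_inj h d h' d' : hedge h = hedge h' -> h.2 = h'.2 -> coord h d = coord h' d' ->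
  0 <= d < hwidth h -> 0 <= d' < hwidth h' -> h = h'.
Proof.
move=> ee bb xx d01 d'01.
have rr : h.1 = h'.1.
  apply: contrapT => rr; have := regions_disjoint ee rr.
  case: h h' ee bb xx d01 d'01 rr => r [] [r' []] //=; rewrite /coord /hwidth /width /=;
   move=> _ _ ? /andP[? ?] /andP[? ?] _ []; lra.
by case: h h' rr bb {ee xx d01 d'01} => r b [r' b'] /= -> ->.
Qed.

Lemma start_vertex h v : start h = Some v -> end_vertex (hedge h) (coord h 0) = Some v.
Proof.
rewrite /start /coord /hedge /rlo /rhi; case: h => r [] /=.
  by case: eqP => // -> [<-]; rewrite c0 addr0 end_vertex0.
by case: eqP => // -> [<-]; rewrite c_last subr0 end_vertex_len.
Qed.

(** This is how a stage comes to its end when an arm reaches a vertex. *)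
Lemma coord_exit h v d : start (flip h) = Some v -> hwidth h < d ->
  ~ in_edge (hedge h) (coord h d).
Proof.
rewrite /in_edge /start /coord /hwidth /width /hedge /rlo /rhi; case: h => r [] /=.
  case: eqP => // E _; rewrite E c_last => gt; apply/negP; rewrite negb_and -!ltNge.
  by apply/orP; right; lra.
case: eqP => // E _; rewrite E c0 => gt; apply/negP; rewrite negb_and -!ltNge.
by apply/orP; left; lra.
Qed.

(** No source lies on such an edge. *)
Lemma full_edge_width h v w : start h = Some v -> start (flip h) = Some w ->
  hwidth h = len (hedge h).
Proof.
rewrite /start /hwidth /width /hedge /rlo /rhi; case: h => r [] /=.
  by case: eqP => // E0 _; case: eqP => // E1 _; rewrite -{1}c_last -E1 E0 c0 subr0.
by case: eqP => // E0 _; case: eqP => // E1 _; rewrite -{1}c_last -E0 E1 c0 subr0.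
Qed.

Lemma end_vertex_half h d v : 0 <= d <= hwidth h -> end_vertex (hedge h) (coord h d) = Some v ->
  d = 0 \/ d = hwidth h.
Proof.
move=> /andP[d0 dw] E; apply: contrapT => /not_orP[/eqP dn /eqP dnw].
have d1 : 0 < d by rewrite lt0r dn.
have d2 : d < hwidth h by rewrite lt_neqAle dnw.
have : end_vertex (hedge h) (coord h d) = None; last by rewrite E.
apply: end_vertex_mid; have := rlo_ge0 h.1; have := rhi_le h.1.
move: d1 d2; rewrite /hedge /coord /hwidth /width.
by case: (h) => r [] /= ? ? ? ?; lra.
Qed.

Lemma start_None h : start h = None -> exists e i, [/\ (1 <= i <= n e)%N, hedge h = e & coord h 0 = c e i].
Proof.
rewrite /start /coord /hedge /rlo /rhi; case: h => r [] /=; have ri := ridx_le r.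
  case: eqP => // i0 _; exists (redge r), (ridx r); rewrite addr0; split=> //.
  by rewrite ri andbT lt0n; apply/eqP.
case: eqP => // i0 _; exists (redge r), (ridx r).+1; rewrite subr0; split=> //=.
by rewrite ltn_neqAle ri andbT; apply/eqP.
Qed.

(** A set that has advanced by [phi h] into every half-edge [h] whose start it
    contains. *)
Definition shape A (phi : half -> R) : Prop :=
  [/\ forall h, 0 <= phi h, forall h, phi h + phi (flip h) <= hwidth h,
      forall h, ~ A (hpt h 0) -> phi h = 0
    & forall h d, 0 <= d <= hwidth h -> A (hpt h d) <->
       (A (hpt h 0) /\ d <= phi h) \/ (A (hpt (flip h) 0) /\ hwidth h - d <= phi (flip h))].

Definition active A (phi : half -> R) h : Prop := A (hpt h 0) /\ phi h + phi (flip h) < hwidth h.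

Lemma shape_le_width A phi h : shape A phi -> 0 <= phi h <= hwidth h.
Proof.
by case=> s1 s2 _ _; rewrite s1/= (le_trans _ (s2 h))// lerDl.
Qed.

Lemma active_lt A phi h : shape A phi -> active A phi h -> 0 <= phi h < hwidth h.
Proof. by case=> s1 s2 _ _ [_ l]; rewrite s1/= (le_lt_trans _ l)// lerDl. Qed.

Lemma anchored_half (a : arm G) : anchored a ->
  exists h d, 0 <= d < hwidth h /\ a = arm_of h d.
Proof.
case: a => e b x; rewrite /anchored /=; case: b => hx.
  have [r [re /andP[h1 h2]]] := cover_right hx.
  exists (r, true), (x - rlo r); rewrite /arm_of /hedge /hwidth /width /coord /= re.
  by split; [lra|congr Arm; ring].
have [r [re /andP[h1 h2]]] := cover_left hx.
exists (r, false), (rhi r - x); rewrite /arm_of /hedge /hwidth /width /coord /= re.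
by split; [lra|congr Arm; ring].
Qed.

Lemma arm_of_anchored h d : 0 <= d < hwidth h -> anchored (arm_of h d).
Proof.
have := rlo_ge0 h.1; have := rhi_le h.1.
rewrite /anchored /arm_of /coord /hedge /hwidth /width; case: h => r [] /= ? ? /andP[? ?]; lra.
Qed.

(** This identifies the arms of a stage with the half-edges whose regions are
    not yet filled. *)
Lemma shape_normals A phi a : closed A -> shape A phi ->
  outward_normal A a <-> exists h, active A phi h /\ a = arm_of h (phi h).
Proof.
move=> cA sA; have [s1 s2 s3 s4] := sA; split.
  move=> /(outward_normalP _ cA)[/anchored_half[h [d [/andP[d0 dw] ->]]]].
  rewrite /anchor /= -/(hpt h d) => Ad [t1 t10 out].
  have outh t : 0 < t < t1 -> ~ A (hpt h (d + t)).
    by move=> /out; rewrite /hpt coordD.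
  have [|[A0 dphi]|[A0 dphi]] := (s4 h d _).1 Ad; first by rewrite d0 ltW.
    move: dphi; rewrite le_eqVlt => /orP[/eqP dE|dlt]; last first.
      pose t := Num.min t1 (phi h - d) / 2.
      have mp : 0 < Num.min t1 (phi h - d) by rewrite lt_min t10 subr_gt0.
      have tm : t < Num.min t1 (phi h - d) by rewrite /t ltr_pdivrMr// ltr_pMr// ltr1n.
      have t0 : 0 < t by rewrite divr_gt0.
      move: tm; rewrite lt_min => /andP[tt1 tphi].
      have := outh t; rewrite t0 => /(_ tt1) []; apply/s4.
        have /andP[_ pw] := shape_le_width h sA; apply/andP; split; lra.
      by left; split=> //; lra.
    exists h; split; last by rewrite -dE.
    split=> //; rewrite lt_neqAle s2 andbT; apply/eqP => E.
    have A1 : A (hpt (flip h) 0).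
      apply: contrapT => /s3 f0; move: dw; rewrite dE -E f0; lra.
    pose t := Num.min t1 (hwidth h - d) / 2.
    have mp : 0 < Num.min t1 (hwidth h - d) by rewrite lt_min t10 subr_gt0.
    have tm : t < Num.min t1 (hwidth h - d) by rewrite /t ltr_pdivrMr// ltr_pMr// ltr1n.
    have t0 : 0 < t by rewrite divr_gt0.
    move: tm; rewrite lt_min => /andP[tt1 tphi].
    have := outh t; rewrite t0 => /(_ tt1) []; apply/s4; first by apply/andP; split; lra.
    by right; split=> //; lra.
  pose t := Num.min t1 (hwidth h - d) / 2.
  have mp : 0 < Num.min t1 (hwidth h - d) by rewrite lt_min t10 subr_gt0.
  have tm : t < Num.min t1 (hwidth h - d) by rewrite /t ltr_pdivrMr// ltr_pMr// ltr1n.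
  have t0 : 0 < t by rewrite divr_gt0.
  move: tm; rewrite lt_min => /andP[tt1 tphi].
  have := outh t; rewrite t0 => /(_ tt1) []; apply/s4; first by apply/andP; split; lra.
  by right; split=> //; lra.
move=> [h [ah ->]]; have pw := active_lt sA ah; have [A0 lt] := ah.
apply/outward_normalP => //; split; first exact: arm_of_anchored.
  rewrite /anchor -/(hpt h (phi h)); apply/s4; last by left.
  by move/andP: pw => [-> /ltW].
exists (hwidth h - (phi h + phi (flip h))); first by rewrite subr_gt0.
move=> t /andP[t0 tl]; rewrite /= -/(arm_of h (phi h)) -coordD -/(hpt h (phi h + t)).
move=> /s4[|[_ ?]|[_ ?]]; [|lra|lra].
have := s1 h; have := s1 (flip h) => ? ?; apply/andP; split; lra.
Qed.

Lemma sum_half_edge (F : half -> R) e :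
  \sum_(h | hedge h == e) F h = \sum_(r | redge r == e) (F (r, true) + F (r, false)).
Proof.
rewrite [LHS](eq_bigl (fun h : half => (redge h.1 == e) && true)); last by move=> h; rewrite andbT.
rewrite [LHS](eq_bigr (fun h : half => F (h.1, h.2))); last by case.
rewrite -(pair_big (fun r : region => redge r == e) predT (fun r b => F (r, b))) /=.
by apply: eq_bigr => r _; rewrite big_bool.
Qed.

Lemma sum_width e : \sum_(r | redge r == e) width r = len e.
Proof.
rewrite (reindex_onto (fun i : 'I_(n e).+1 => Tagged (fun e => 'I_(n e).+1) i) (fun r => inord (ridx r)));
  last first.
  move=> r /eqP re; apply: region_ext; rewrite /redge /ridx //= inordK// ltnS.
  by rewrite -re ridx_le.
rewrite (eq_bigl predT); last first.
  by move=> i; rewrite /redge /ridx /= eqxx; apply/eqP/val_inj; rewrite /= inordK.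
rewrite -(big_mkord predT (fun i => c e i.+1 - c e i)) telescope_sumr//.
by rewrite c_last c0 subr0.
Qed.

Lemma arm_of_active_inj A phi h h' : shape A phi -> active A phi h -> active A phi h' ->
  arm_of h (phi h) = arm_of h' (phi h') -> h = h'.
Proof.
move=> sA ah ah' [ee bb xx].
exact: (coord_half_inj ee bb xx (active_lt sA ah) (active_lt sA ah')).
Qed.

End Grid.

(** * Finite unions of arcs *)

Section FiniteUnions.
Context {R : realType} {G : metricGraph R}.

Lemma closed_finU (T : topologicalType) (I : finType) (P : I -> Prop) (F : I -> set T) :
  (forall i, P i -> closed (F i)) -> closed [set p | exists2 i, P i & F i p].
Proof.
move=> cF; have -> : [set p | exists2 i, P i & F i p] = \bigcup_(i in [set i | P i]) F i by [].
by apply: closed_bigcup => //; exact: finite_finset.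
Qed.

Lemma finite_components_finU (I : finType) (P : I -> Prop) (F : I -> set (gspace G)) :
  (forall i, P i -> connected (F i)) ->
  finite_set [set C | is_component [set p | exists2 i, P i & F i p] C].
Proof.
move=> cF; pose A := [set p | exists2 i, P i & F i p]; rewrite -/A.
have [g gP] : exists g : I -> set (gspace G), forall i p, P i -> F i p -> connected_component A p = g i.
  have : forall i, exists C, forall p, P i -> F i p -> connected_component A p = C.
    move=> i; have [[p [Pi Fp]]|no] := pselect (exists p, P i /\ F i p); last first.
      by exists set0 => p Pi Fp; case: no; exists p.
    exists (connected_component A p) => q _ Fq; apply: same_connected_component.
    by exists (F i) => //; split=> //; [move=> x Fx; exists i|exact: cF].
  by move=> /choice[g gP]; exists g.
apply: (@sub_finite_set _ _ (g @` setT)); last by apply: finite_image; exact: finite_finset.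
by move=> C [p [i Pi Fp] ->]; exists i => //; rewrite (gP i p).
Qed.

Lemma card_eq_fin (T : finType) : ([set: T] #= `I_#|T|)%card.
Proof.
have -> : `I_#|T| = (fun x : T => nat_of_ord (enum_rank x)) @` setT.
  apply/seteqP; split=> [i /= iT|_ [x _ <-]]; last exact: ltn_ord.
  by exists (enum_val (Ordinal iT)) => //; rewrite enum_valK.
rewrite card_eq_sym; apply: inj_card_eq => x y _ _ /ord_inj; exact: enum_rank_inj.
Qed.

End FiniteUnions.

Section HalfSegments.
Context {R : realType} {G : metricGraph R}.
Variables (n : edge G -> nat) (c : edge G -> nat -> R).
Hypotheses (c0 : forall e, c e 0 = 0) (c_last : forall e, c e (n e).+1 = len e).
Hypothesis c_step : forall e i, (i <= n e)%N -> c e i <= c e i.+1.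
Local Notation half := (half n).
Local Notation hpt := (hpt c).
Local Notation hwidth := (hwidth c).
Implicit Types (h : half) (a b d : R).

Definition hseg h a b : set (gspace G) := [set p | exists2 d, a <= d <= b & p = hpt h d].

Lemma hsegE h a b : exists x y, hseg h a b = segment (hedge h) x y /\
  (0 <= a -> b <= hwidth h -> 0 <= x /\ y <= len (hedge h)).
Proof.
have l0 := rlo_ge0 c0 c_step h.1; have l1 := rhi_le c_last c_step h.1.
case: h l0 l1 => r [] /= l0 l1.
  exists (rlo c r + a), (rlo c r + b); split.
    apply/seteqP; split=> [p [d d01 ->]|p [x + <-]].
      by exists (rlo c r + d) => //=; rewrite in_itv /= !lerD2l.
    rewrite /= in_itv /= => x01; exists (x - rlo c r); first by lra.
    by rewrite /hpt /coord /= addrC subrK.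
  by rewrite /hwidth /width /hedge /= in l0 l1 *; lra.
exists (rhi c r - b), (rhi c r - a); split.
  apply/seteqP; split=> [p [d d01 ->]|p [x + <-]].
    by exists (rhi c r - d) => //=; rewrite in_itv /= !lerD2l !lerN2 andbC.
  rewrite /= in_itv /= => x01; exists (rhi c r - x); first by lra.
  by rewrite /hpt /coord /= opprB addrC subrK.
by rewrite /hwidth /width /hedge /= in l0 l1 *; lra.
Qed.

Lemma hseg_closed h a b : 0 <= a -> b <= hwidth h -> closed (hseg h a b).
Proof.
move=> a0 bw; have [x [y [-> H]]] := hsegE h a b.
by have [? ?] := H a0 bw; exact: segment_closed.
Qed.

Lemma hseg_connected h a b : 0 <= a -> b <= hwidth h -> connected (hseg h a b).
Proof.
move=> a0 bw; have [x [y [-> H]]] := hsegE h a b.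
by have [? ?] := H a0 bw; exact: segment_connected_set.
Qed.

End HalfSegments.

(** * Spanning forests of half-edges *)

Section Scheme.
Context {R : realType} {G : metricGraph R}.
Variables (n : edge G -> nat) (par : vertex G -> half n) (rank : vertex G -> nat).
Hypothesis par_end : forall v, start (flip (par v)) = Some v.
Hypothesis rank_par : forall v w, start (par v) = Some w -> (rank w < rank v)%N.
Local Notation half := (half n).
Implicit Types (h x y : half) (v w : vertex G).

Definition up h : option half := omap par (start h).
Definition half_rank h : nat := if start h is Some v then (rank v).+1 else 0.
(** A half-edge that could only be entered backwards from the vertex at which
    the other half of its region arrives. *)
Definition opp h : bool := if start h is Some v then par v == flip h else false.

Lemma half_rank_up x y : up x = Some y -> (half_rank y < half_rank x)%N.
Proof.
rewrite /up /half_rank; case: (start x) => //= v [<-].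
by case E: (start (par v)) => [w|]//; rewrite ltnS; exact: rank_par.
Qed.

Lemma upP x y : up x = Some y <-> exists2 v, start x = Some v & par v = y.
Proof.
rewrite /up; split=> [|[v -> <-//]].
by case: (start x) => //= v [<-]; exists v.
Qed.

Lemma oppP h : opp h <-> exists2 v, start h = Some v & par v = flip h.
Proof.
rewrite /opp; split=> [|[v -> ->]]; last exact: eqxx.
by case: (start h) => // v /eqP; exists v.
Qed.

Lemma root_up h : start h = None -> up h = None.
Proof. by rewrite /up => ->. Qed.

Lemma root_nopp h : start h = None -> ~~ opp h.
Proof. by rewrite /opp => ->. Qed.

Lemma opp_flip_par v : opp (flip (par v)).
Proof. by apply/oppP; exists v; rewrite ?par_end// flipK. Qed.

Lemma opp_flipP h : opp (flip h) <-> exists v, par v = h.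
Proof.
split=> [/oppP[v _]|[v <-]]; last exact: opp_flip_par.
by rewrite flipK => <-; exists v.
Qed.

Lemma par_nopp v : ~~ opp (par v).
Proof.
apply/negP => /oppP[w sw pw].
have := rank_par sw.
have : start (par w) = Some v by rewrite pw par_end.
by move=> /rank_par h1 h2; have := ltn_trans h1 h2; rewrite ltnn.
Qed.

Lemma opp_no_child h x : opp h -> up x <> Some h.
Proof. by move=> oh /upP[v _ ph]; move: oh; rewrite -ph (negbTE (par_nopp v)). Qed.

Lemma edge_nonopp_half e : exists h, hedge h = e /\ ~~ opp h.
Proof.
have [r [re _]] := @region_at R G n e 0 isT.
have [op|nop] := boolP (opp (r, true)); last by exists (r, true).
exists (r, false); split=> //; apply/negP.
have -> : (r, false) = flip (r, true) by [].
by move=> /opp_flipP[v pv]; move: op; rewrite -pv (negbTE (par_nopp v)).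
Qed.

Lemma subhook_leaf (L : half -> R) h : (forall v, par v <> h) -> subhook up L h = 0.
Proof.
move=> nh; rewrite (subhook_children half_rank_up) big1// => x /eqP/upP[v _ pv].
by case: (nh v).
Qed.

Lemma subhook_opp (L : half -> R) h : opp h -> subhook up L h = 0.
Proof. by move=> oh; apply: subhook_leaf => v pv; move: oh; rewrite -pv (negbTE (par_nopp v)). Qed.

End Scheme.

(** * The flooding that fills a forest of half-edges optimally *)

Section Filling.
Context {R : realType} {G : metricGraph R}.
Variables (n : edge G -> nat) (par : vertex G -> half n) (rank : vertex G -> nat).
Hypothesis par_end : forall v, start (flip (par v)) = Some v.
Hypothesis rank_par : forall v w, start (par v) = Some w -> (rank w < rank v)%N.
Variable L : half n -> R.
Hypothesis gL : generic (hedge (n:=n)) (@len R G) (opp par) L.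
Local Notation half := (half n).
Implicit Types (h x y : half) (v w : vertex G) (t s d : R) (k : nat).
Local Notation up := (up par).
Local Notation opp := (opp par).
Let hrk := half_rank_up rank_par.
Local Notation pdesc := (pdesc up).
Local Notation desc := (desc up).

Let L_ge0 h : 0 <= L h. Proof. by have [[]] := gL. Qed.
Let L_opp h : opp h -> L h = 0. Proof. by have [[_ _ +] _] := gL; apply. Qed.
Let L_gt0 h : ~~ opp h -> 0 < L h. Proof. by have [_] := gL; apply. Qed.
Hint Resolve L_ge0 : core.

(** ** The grid given by the lengths *)

Definition filling_grid (e : edge G) (i : nat) : R :=
  \sum_(r : region n | (redge r == e) && (ridx r < i)%N) (L (r, true) + L (r, false)).
Local Notation c := filling_grid.
Local Notation coord := (coord c).
Local Notation hpt := (hpt c).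
Local Notation hwidth := (hwidth c).

Lemma filling_grid0 e : c e 0 = 0.
Proof. by rewrite /c big1// => r /andP[]. Qed.

Lemma filling_grid_last e : c e (n e).+1 = len e.
Proof.
have [[_ <- _] _] := gL; rewrite sum_half_edge /c; apply: eq_bigl => r.
by case: eqP => //= <-; rewrite ltnS ridx_le.
Qed.

Lemma filling_width r : width c r = L (r, true) + L (r, false).
Proof.
rewrite /width /rhi /rlo /c [X in X - _](bigD1 r)/=; last by rewrite eqxx ltnSn.
rewrite (eq_bigl (fun r' => (redge r' == redge r) && (ridx r' < ridx r)%N)) ?addrK// => r'.
rewrite ltnS leq_eqVlt; case: eqVneq => //= ee; case: eqVneq => /= [ii|ii].
  by rewrite (region_ext ee ii) eqxx ltnn.
by rewrite andbC; case: eqVneq => //= rr; rewrite rr eqxx in ii.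
Qed.

Lemma filling_hwidth h : hwidth h = L h + L (flip h).
Proof. by case: h => r []; rewrite /hwidth filling_width//= addrC. Qed.

Lemma filling_step e i : (i <= n e)%N -> c e i < c e i.+1.
Proof.
move=> ie; have [r [<- <-]] := region_at ie.
rewrite -subr_gt0 -[ltRHS]/(width c r) filling_width.
have [op|nop] := boolP (opp (r, true)); last by rewrite ltr_pwDl// L_gt0.
rewrite ltr_wpDl// L_gt0//; apply/negP.
have -> : (r, false) = flip (r, true) by [].
by move=> /(opp_flipP par_end)[v pv]; move: op; rewrite -pv (negbTE (par_nopp par_end rank_par v)).
Qed.

Let c0 := filling_grid0.
Let cl := filling_grid_last.
Let cs e i (ie : (i <= n e)%N) : c e i <= c e i.+1 := ltW (filling_step ie).
Hint Resolve c0 cl cs : core.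

Let w_ge0 h : 0 <= hwidth h. Proof. exact: hwidth_ge0. Qed.

Lemma grid_interior e i : (1 <= i <= n e)%N -> 0 < c e i < len e.
Proof.
move=> /andP[i1 ie]; apply/andP; split.
  rewrite -(c0 e); apply: (@lt_le_trans _ _ (c e 1)); first exact: filling_step.
  by apply: (c_mono cs); rewrite i1 leqW.
rewrite -(cl e); apply: (@le_lt_trans _ _ (c e (n e))); last exact: filling_step.
by apply: (c_mono cs); rewrite ie leqnSn.
Qed.

Lemma start_of_vertex h v : end_vertex (hedge h) (coord h 0) = Some v -> start h = Some v.
Proof.
case E: (start h) => [w|]; first by rewrite (start_vertex c0 cl E).
have [e [i [ie -> ->]]] := start_None c E.
by rewrite end_vertex_mid// grid_interior.
Qed.

(** ** Times and speeds *)

Local Notation a := (hook up L).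
Local Notation b := (subhook up L).
Definition total : R := \sum_h L h.
Local Notation zeta := total.

(** The proportion of the total that is unflooded when [h] is entered. What
    lies ahead of a moving arm stays in proportion to what remains of the
    whole, and running along [x] reduces it from [a x] to [b x]. *)
Definition unfilled h : R := \prod_(x | pdesc h x) (b x / a x).
Local Notation U := unfilled.
Definition tstart h : R := zeta * (1 - U h).
Definition tend h : R := zeta * (1 - U h * (b h / a h)).
(** Ahead of the arm lies [a h] when the remainder of the whole is [zeta *
    unfilled h]; the quotient of the two does not change while the arm moves. *)
Definition hspeed h : R := a h / (zeta * U h).
Definition progress t h : R := Num.min (L h) (hspeed h * Num.max 0 (t - tstart h)).
Local Notation phi := progress.

Lemma totalE : zeta = graph_length G.
Proof.
rewrite /total /graph_length (partition_big (hedge (n:=n)) predT)//=.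
by apply: eq_bigr => e _; have [[_ <- _] _] := gL.
Qed.

Let a_ge0 h : 0 <= a h. Proof. exact: hook_ge0. Qed.
Let b_ge0 h : 0 <= b h. Proof. exact: subhook_ge0. Qed.
Hint Resolve a_ge0 b_ge0 : core.

Lemma hook_gt0 h : ~~ opp h -> 0 < a h.
Proof. by move=> nh; rewrite hookE ltr_pwDl// L_gt0. Qed.

Lemma hook_opp h : opp h -> a h = 0.
Proof. by move=> oh; rewrite hookE L_opp// (subhook_opp par_end rank_par)// addr0. Qed.

Lemma pdesc_nopp h x : pdesc h x -> ~~ opp x.
Proof.
move=> /andP[+ hx]; move: {2}(half_rank rank h) (leqnn (half_rank rank h)) => m.
elim: m h hx => [|m IH] h hx hm hd; have [E|[y hy yx]] := descP hd;
  try (by rewrite E eqxx in hx).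
  by have := leq_trans (hrk hy) hm.
have [yx'|yx'] := eqVneq y x; last by apply: (IH y) => //; exact: leq_trans (hrk hy) hm.
apply/negP => ox; apply: (opp_no_child par_end rank_par ox (x := h)).
by rewrite hy yx'.
Qed.

Lemma hook_ratio_le1 x : 0 <= b x / a x <= 1.
Proof.
have := a_ge0 x; rewrite le_eqVlt => /orP[/eqP <-|ax].
  by rewrite invr0 mulr0 lexx ler01.
by rewrite divr_ge0//= ler_pdivrMr// mul1r hookE lerDr.
Qed.

Lemma unfilled_bounds h : 0 <= U h <= 1.
Proof.
rewrite /U; apply: (big_ind (fun z => 0 <= z <= 1)); rewrite ?ler01 ?lexx//.
  by move=> p q /andP[p0 p1] /andP[q0 q1]; rewrite mulr_ge0//= mulr_ile1.
by move=> x _; exact: hook_ratio_le1.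
Qed.

Lemma unfilled_gt0 h : ~~ opp h -> 0 < U h.
Proof.
move=> nh; apply: prodr_gt0 => x hx; have nx := pdesc_nopp hx.
rewrite divr_gt0 ?hook_gt0//; apply: lt_le_trans (hook_gt0 nh) _.
exact: (le_hook_pdesc hrk).
Qed.

Lemma pdesc_up_desc x y h : up h = Some x -> pdesc h y = desc x y.
Proof.
move=> hx; apply/idP/idP => [/pdesc_up[z]|xy]; first by rewrite hx => -[<-].
exact: (up_pdesc hrk hx).
Qed.

Lemma unfilled_up h x : up h = Some x -> U h = U x * (b x / a x).
Proof.
move=> hx; rewrite /U (eq_bigl (desc x)); last by move=> y; exact: pdesc_up_desc.
by rewrite (bigD1 x) ?desc_refl//= mulrC; congr (_ * _); apply: eq_bigl => y; congr (_ && ~~ _); exact: eq_sym.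
Qed.

Lemma unfilled_root h : up h = None -> U h = 1.
Proof. by move=> hN; rewrite /U big1// => x /pdesc_up[z]; rewrite hN. Qed.

Lemma tstart_up h x : up h = Some x -> tstart h = tend x.
Proof. by move=> hx; rewrite /tstart /tend (unfilled_up hx). Qed.

Lemma tstart_root h : up h = None -> tstart h = 0.
Proof. by move=> hN; rewrite /tstart unfilled_root// subrr mulr0. Qed.

Lemma total_ge0 : 0 <= zeta. Proof. exact: sumr_ge0. Qed.

Lemma tstart_ge0 h : 0 <= tstart h.
Proof. by have /andP[_ ?] := unfilled_bounds h; rewrite mulr_ge0 ?total_ge0// subr_ge0. Qed.

Lemma tend_le h : tend h <= zeta.
Proof.
rewrite /tend -[leRHS]mulr1 ler_wpM2l ?total_ge0// gerBl.
by have /andP[? _] := unfilled_bounds h; have /andP[? _] := hook_ratio_le1 h; exact: mulr_ge0.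
Qed.

Lemma tstart_le_tend h : tstart h <= tend h.
Proof.
rewrite ler_wpM2l ?total_ge0// lerB//.
have /andP[? _] := unfilled_bounds h; have /andP[_ ?] := hook_ratio_le1 h.
by rewrite ler_piMr.
Qed.

Section Positive.
Hypothesis zeta_gt0 : 0 < zeta.

Lemma hspeed_gt0 h : ~~ opp h -> 0 < hspeed h.
Proof. by move=> nh; rewrite divr_gt0 ?hook_gt0// mulr_gt0 ?unfilled_gt0. Qed.

Lemma hspeed_opp h : opp h -> hspeed h = 0.
Proof. by move=> oh; rewrite /hspeed hook_opp// mul0r. Qed.

Lemma hspeed_ge0 h : 0 <= hspeed h.
Proof.
by have [oh|nh] := boolP (opp h); [rewrite hspeed_opp|exact/ltW/hspeed_gt0].
Qed.

Lemma hspeed_duration h : ~~ opp h -> hspeed h * (tend h - tstart h) = L h.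
Proof.
move=> nh; have U0 := unfilled_gt0 nh; have a0 := hook_gt0 nh.
have -> : tend h - tstart h = zeta * U h * ((a h - b h) / a h).
  by rewrite /tend /tstart mulrBl divff ?gt_eqF//; ring.
rewrite /hspeed hookE addrK -hookE.
by field; rewrite !gt_eqF.
Qed.

Lemma tstart_lt_tend h : ~~ opp h -> tstart h < tend h.
Proof.
by move=> nh; have := L_gt0 nh; rewrite -hspeed_duration// pmulr_rgt0 ?hspeed_gt0// subr_gt0.
Qed.

Lemma progress_ge0 t h : 0 <= phi t h.
Proof. by rewrite le_min L_ge0 mulr_ge0 ?hspeed_ge0// le_max lexx. Qed.

Lemma progress_le t h : phi t h <= L h. Proof. by rewrite ge_min lexx. Qed.

Lemma progress_opp t h : opp h -> phi t h = 0.
Proof. by move=> oh; apply/eqP; rewrite eq_le progress_ge0 andbT -(L_opp oh) progress_le. Qed.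

Lemma progress_before t h : t <= tstart h -> phi t h = 0.
Proof.
by move=> th; rewrite /phi max_l ?subr_le0// mulr0 min_r.
Qed.

Lemma progress_during t h : tstart h <= t <= tend h -> phi t h = hspeed h * (t - tstart h).
Proof.
move=> /andP[t0 t1]; have [oh|nh] := boolP (opp h); first by rewrite progress_opp// hspeed_opp// mul0r.
rewrite /phi max_r ?subr_ge0// min_r// -hspeed_duration//.
by rewrite ler_wpM2l ?hspeed_ge0// lerD2r.
Qed.

Lemma progress_after t h : tend h <= t -> phi t h = L h.
Proof.
move=> t1; have [oh|nh] := boolP (opp h); first by rewrite progress_opp// L_opp.
rewrite /phi min_l// -[leLHS]hspeed_duration// ler_wpM2l ?hspeed_ge0//.
by rewrite le_max lerD2r t1 orbT.
Qed.

Lemma progress_mono t s h : t <= s -> phi t h <= phi s h.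
Proof.
move=> ts; rewrite /phi le_min ge_min lexx/= ge_min; apply/orP; right.
rewrite ler_wpM2l ?hspeed_ge0// ge_max le_max lexx/= le_max.
by apply/orP; right; rewrite lerD2r.
Qed.

Lemma progress_lt t h : ~~ opp h -> t < tend h -> phi t h < L h.
Proof.
move=> nh th; have [ts|ts] := leP t (tstart h); first by rewrite progress_before// L_gt0.
rewrite progress_during ?(ltW ts) ?(ltW th)// -[ltRHS]hspeed_duration//.
by rewrite ltr_pM2l ?hspeed_gt0// ltrD2r.
Qed.

Lemma progress_gt0 t h : 0 < phi t h -> tstart h < t.
Proof. by rewrite ltNge => /negP p; rewrite ltNge; apply/negP => /progress_before p0; rewrite p0 lexx in p. Qed.

Lemma tend_leaf h : (forall v, par v <> h) -> tend h = zeta.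
Proof.
by move=> nh; rewrite /tend (subhook_leaf rank_par)// mul0r mulr0 subr0 mulr1.
Qed.

(** ** The flooded sets *)

Definition filling t : set (gspace G) :=
  [set p | exists2 h, tstart h <= t & hseg c h 0 (phi t h) p].
Local Notation F := filling.

Let phi_width t h : phi t h <= hwidth h.
Proof. by rewrite filling_hwidth (le_trans (progress_le t h))// lerDl. Qed.

Lemma filling_node t h : tstart h <= t -> F t (hpt h 0).
Proof. by move=> th; exists h => //; exists 0 => //; rewrite lexx progress_ge0. Qed.

Lemma node_filling t h : t < zeta -> F t (hpt h 0) -> tstart h <= t.
Proof.
move=> tz [y ty [d /andP[d0 dphi] E]].
have dw := le_trans dphi (phi_width t y).
case S: (start h) => [v|]; last first.
  by rewrite tstart_root ?(le_trans (tstart_ge0 y))// /up S.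
have hv : end_vertex (hedge y) (coord y d) = Some v.
  have hin : in_edge (hedge h) (coord h 0) by apply: (coord_in c0 cl cs); rewrite lexx w_ge0.
  have yin : in_edge (hedge y) (coord y d) by apply: (coord_in c0 cl cs); rewrite d0.
  have [[ee <-]|[w [hw yw]]] := (pt_eqP hin yin).1 E.
    by rewrite -ee; exact: start_vertex.
  by rewrite yw -hw; exact: start_vertex.
have hmid : ~ (0 < d < hwidth y).
  move=> dm; have : end_vertex (hedge y) (coord y d) = None; last by rewrite hv.
  apply: end_vertex_mid; have := rlo_ge0 c0 cs y.1; have := rhi_le cl cs y.1.
  move: dm; rewrite /hedge /coord /hwidth /width.
  by case: (y) => r [] /= /andP[? ?] ? ?; lra.
have [d00|dn] := eqVneq d 0.
  rewrite d00 in hv; have := start_of_vertex hv => yS.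
  have eu : up h = up y by rewrite /up S yS.
  have hup : up h = Some (par v) by rewrite /up S.
  by rewrite (tstart_up hup) -(tstart_up (h := y)) -?eu.
have dE : d = hwidth y.
  apply/eqP; rewrite eq_le dw leNgt; apply/negP => dlt; apply: hmid.
  by rewrite lt0r dn d0.
have Lf : opp (flip y).
  apply: contraT => /L_gt0 Lf; move: dphi; rewrite dE filling_hwidth.
  have := progress_le t y; lra.
have [v' pv'] := (opp_flipP par_end y).1 Lf.
have sf : start (flip y) = Some v.
  by apply: start_of_vertex; rewrite coord_flip subr0 -dE.
have vv : v' = v by move: sf; rewrite -pv' par_end => -[].
have hup : up h = Some y by rewrite /up S -vv /= pv'.
rewrite (tstart_up hup) leNgt; apply/negP => tlt.
have ny : ~~ opp y by rewrite -pv' (par_nopp par_end rank_par).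
have := progress_lt ny tlt; move: dphi; rewrite dE filling_hwidth => h1 h2.
by have := L_ge0 (flip y); lra.
Qed.

Lemma filling_closed t : closed (F t).
Proof. by apply: closed_finU => h _; apply: hseg_closed. Qed.

Lemma filling_components t : finite_set [set C | is_component (F t) C].
Proof. by apply: finite_components_finU => h _; apply: hseg_connected. Qed.

Lemma filling_mono t s : t <= s -> F t `<=` F s.
Proof.
move=> ts p [h ht [d /andP[d0 dp] ->]]; exists h; first exact: le_trans ts.
by exists d => //; rewrite d0 (le_trans dp)// progress_mono.
Qed.

Lemma filling_point t h d : 0 < d <= phi t h -> F t (hpt h d).
Proof.
move=> /andP[d0 dp]; exists h; first by apply/ltW/progress_gt0/(lt_le_trans d0).
by exists d => //; rewrite ltW.
Qed.

Lemma filling_shape t : shape c (F t) (phi t).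
Proof.
split.
- by move=> h; exact: progress_ge0.
- by move=> h; rewrite filling_hwidth lerD// progress_le.
- move=> h nF; apply/eqP; rewrite eq_le progress_ge0 andbT leNgt; apply/negP.
  by move=> /progress_gt0 /ltW /filling_node.
move=> h d /andP[d0 dw]; split; last first.
  move=> [[F0 dp]|[F0 dp]].
    move: d0; rewrite le_eqVlt => /orP[/eqP <-//|d0]; apply: filling_point.
    by rewrite d0.
  move: dw; rewrite le_eqVlt => /orP[/eqP ->|dw].
    by move: F0; rewrite hpt_flip subr0.
  have := @filling_point t (flip h) (hwidth h - d).
  by rewrite subr_gt0 dw dp hpt_flip subKr => /(_ isT).
have [->|dn] := eqVneq d 0; first by move=> F0; left; split=> //; exact: progress_ge0.
have [->|dnw] := eqVneq d (hwidth h).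
  move=> F0; right; rewrite subrr progress_ge0; split=> //.
  by rewrite hpt_flip subr0.
have dm : 0 < d < hwidth h by rewrite lt0r dn d0 lt_neqAle dnw dw.
move=> [y ty [d' /andP[d'0 d'p] E]].
have yw := le_trans d'p (phi_width t y).
have d'w : 0 <= d' <= hwidth y by rewrite d'0.
have [[yh dd]|[yh dd]] := hpt_mid_inj c0 cl cs (esym E) dm d'w; subst y d'.
  by left; split=> //; exact: filling_node.
by right; split=> //; exact: filling_node.
Qed.

Lemma filling_end : F zeta = setT.
Proof.
apply/seteqP; split=> // p _; have [e [x [ex ->]]] := gspace_ptP p.
have [h [d [<- dw <-]]] := cover c0 cl ex; rewrite -/(hpt h d).
have P y : phi zeta y = L y by rewrite progress_after// tend_le.
have S y : tstart y <= zeta by exact: le_trans (tstart_le_tend y) (tend_le y).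
have [_ _ _ sh] := filling_shape zeta; apply/sh => //.
have [dl|dl] := leP d (L h); [left|right]; split=> //; rewrite ?P//; try exact: filling_node.
by rewrite filling_hwidth lerBlDl lerD2r ltW.
Qed.

(** ** The moving arms *)

Definition act t h := [&& ~~ opp h, tstart h <= t & t < tend h].

Lemma act_active t h : t < zeta -> active c (F t) (phi t) h <-> act t h.
Proof.
move=> tz; split.
  move=> [/(node_filling tz) th lt]; rewrite /act th andTb.
  have nh : ~~ opp h.
    apply/negP => oh; have /oppP[v hv pv] := oh.
    have hup : up h = Some (flip h) by rewrite /up hv /= pv.
    move: lt; rewrite filling_hwidth (progress_opp _ oh) (L_opp oh) progress_after ?ltxx//.
    by rewrite -(tstart_up hup).
  rewrite nh /= ltNge; apply/negP => te; move: lt.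
  rewrite (progress_after te) filling_hwidth ltrD2l.
  have [fop|nf] := boolP (opp (flip h)); first by rewrite progress_opp// L_opp// ltxx.
  rewrite tend_leaf in te; first by move: tz; rewrite ltNge te.
  by move=> v pv; move: nf; rewrite -pv (opp_flip_par par_end).
move=> /and3P[nh th te]; split; first exact: filling_node.
by rewrite filling_hwidth ltr_leD// ?progress_lt// progress_le.
Qed.

(** When an arm ends, the arms of its children take over its speed exactly. *)
Lemma speed_sum t : 0 <= t < zeta -> \sum_(h | act t h) hspeed h = 1.
Proof.
move=> /andP[t0 tz].
have E1 : \sum_(h | tstart h <= t) hspeed h = 1 + \sum_(h | tend h <= t) hspeed h.
  rewrite (bigID (fun h => up h == None))/=; congr (_ + _).
    rewrite (eq_bigl (fun h => up h == None)); last first.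
      by move=> h; case: eqP => [hN|]; rewrite ?andbF// tstart_root// t0.
    rewrite (eq_bigr (fun h => a h / zeta)); last first.
      by move=> h /eqP hN; rewrite /hspeed unfilled_root// mulr1.
    by rewrite -mulr_suml (sum_root_hooks hrk) divff// gt_eqF.
  pose p h := odflt h (up h).
  rewrite (partition_big p (fun x => tend x <= t))/=; last first.
    move=> h /andP[ht]; rewrite /p; case E: (up h) => [x|]// _ /=.
    by rewrite -(tstart_up E).
  apply: eq_bigr => x xt.
  have bx : b x != 0.
    apply: contraTneq xt => bx0; rewrite -ltNge /tend bx0 mul0r mulr0 subr0 mulr1//.
  have ax : a x != 0 by rewrite gt_eqF// hookE ltr_wpDl// lt0r bx b_ge0.
  rewrite (eq_bigl (fun h => up h == Some x)); last first.
    move=> h; rewrite /p; case E: (up h) => [y|]; last by rewrite !andbF.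
    rewrite /= andbT; apply/andP/eqP => [[_ /eqP->]//|[yx]].
    by rewrite -yx eqxx (tstart_up E) yx.
  rewrite (eq_bigr (fun h => a h / (zeta * (U x * (b x / a x))))); last first.
    by move=> h /eqP hx; rewrite /hspeed (unfilled_up hx).
  rewrite -mulr_suml -(subhook_children hrk) /hspeed.
  have [->|Ux] := eqVneq (U x) 0.
    by rewrite mul0r mulr0 invr0 !mulr0.
  by field; rewrite ?bx ?ax ?Ux ?(gt_eqF zeta_gt0).
have E2 : \sum_(h | tstart h <= t) hspeed h
   = \sum_(h | act t h) hspeed h + \sum_(h | tend h <= t) hspeed h.
  rewrite (bigID (fun h => t < tend h))/=; congr (_ + _).
    rewrite [LHS](bigID opp)/= big1 ?add0r.
      by apply: eq_bigl => h; rewrite /act andbC.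
    by move=> h /andP[_ oh]; rewrite hspeed_opp.
  apply: eq_bigl => h; rewrite -leNgt; apply: andb_idl => te.
  exact: le_trans (tstart_le_tend h) te.
by move: E1; rewrite E2; move: (\sum_(h | _) _) (\sum_(h | _) _) => u v; lra.
Qed.

Lemma act_exists t : 0 <= t < zeta -> exists h, act t h.
Proof.
move=> tz; apply: contrapT => no; have := speed_sum tz.
rewrite big1; first by move=> /eqP; rewrite eq_sym oner_eq0.
by move=> h ah; case: no; exists h.
Qed.

(** ** The stages *)

Definition stage_times : seq R := sort <=%R (undup (0 :: zeta :: [seq tstart h | h <- enum {: half}])).
Definition nst : nat := (size stage_times).-1.
Definition ftime k : R := nth zeta stage_times k.

Lemma mem_stage_times t : t \in stage_times <-> [\/ t = 0, t = zeta | exists h, t = tstart h].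
Proof.
rewrite mem_sort mem_undup !inE; split.
  move=> /or3P[/eqP->|/eqP->|/mapP[h _ ->]]; [exact: Or31|exact: Or32|by apply: Or33; exists h].
by case=> [->|->|[h ->]]; rewrite ?eqxx ?orbT//; rewrite map_f ?orbT// mem_enum.
Qed.

Let sorted_times : sorted <%R stage_times.
Proof. by rewrite sort_lt_sorted undup_uniq. Qed.

Let size_times : size stage_times = nst.+1.
Proof.
rewrite /nst prednK// lt0n size_eq0; apply/eqP => E.
by have := (mem_stage_times 0).2 (Or31 _ _ erefl); rewrite E.
Qed.

Lemma ftime_lt i j : (i < j <= nst)%N -> ftime i < ftime j.
Proof.
move=> /andP[ij jn]; apply: (sorted_ltn_nth lt_trans zeta sorted_times) => //;
  rewrite inE size_times ltnS//.
exact: leq_trans (ltnW ij) jn.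
Qed.

Lemma ftime_mem k : (k <= nst)%N -> ftime k \in stage_times.
Proof. by move=> kn; rewrite mem_nth// size_times ltnS. Qed.

Lemma stage_times_bounds t : t \in stage_times -> 0 <= t <= zeta.
Proof.
move=> /mem_stage_times[->|->|[h ->]]; rewrite ?lexx ?total_ge0//.
by rewrite tstart_ge0 (le_trans (tstart_le_tend h))// tend_le.
Qed.

Lemma mem_ftime t : t \in stage_times -> exists2 k, (k <= nst)%N & t = ftime k.
Proof.
move=> tin; exists (index t stage_times); last by rewrite /ftime nth_index.
by rewrite -ltnS -size_times index_mem.
Qed.

Lemma ftime0 : ftime 0 = 0.
Proof.
have [[|k] kn E] := mem_ftime ((mem_stage_times 0).2 (Or31 _ _ erefl)); first by [].
have := @ftime_lt 0 k.+1; rewrite kn -E => /(_ isT).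
by have /andP[+ _] := stage_times_bounds (ftime_mem (leq0n nst)); rewrite leNgt => /negbTE ->.
Qed.

Lemma ftime_nst : ftime nst = zeta.
Proof.
have [k kn E] := mem_ftime ((mem_stage_times zeta).2 (Or32 _ _ erefl)).
move: kn; rewrite leq_eqVlt => /orP[/eqP kE|kn]; first by rewrite E kE.
have := @ftime_lt k nst; rewrite kn leqnn -E => /(_ isT).
by have /andP[_ +] := stage_times_bounds (ftime_mem (leqnn nst)); rewrite leNgt => /negbTE ->.
Qed.

Lemma ftime_gap k t : (k < nst)%N -> t \in stage_times -> t <= ftime k \/ ftime k.+1 <= t.
Proof.
move=> kn /mem_ftime[i inn ->]; have [ik|ki] := leqP i k; [left|right].
  move: ik; rewrite leq_eqVlt => /orP[/eqP->//|ik]; apply/ltW/ftime_lt.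
  by rewrite ik ltnW.
move: ki; rewrite leq_eqVlt => /orP[/eqP->//|ki]; apply/ltW/ftime_lt.
by rewrite ki.
Qed.

Lemma ftimeS k : (k < nst)%N -> ftime k < ftime k.+1.
Proof. by move=> kn; apply: ftime_lt; rewrite ltnSn. Qed.

Lemma ftimeS_gt0 k : (k < nst)%N -> 0 < ftime k.+1.
Proof. by move=> kn; rewrite -ftime0; apply: ftime_lt. Qed.

Lemma tstart_mem h : tstart h \in stage_times.
Proof. by apply/mem_stage_times/Or33; exists h. Qed.

Lemma tend_mem h : ~~ opp h -> tend h \in stage_times.
Proof.
move=> nh; have [[v pv]|nv] := pselect (exists v, par v = h).
  apply/mem_stage_times/Or33; exists (flip h); rewrite -(tstart_up (h := flip h))//.
  by rewrite /up -pv par_end.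
by rewrite tend_leaf; [apply/mem_stage_times/Or32|move=> v pv; apply: nv; exists v].
Qed.

Lemma ftime_bounds k : (k < nst)%N -> 0 <= ftime k < zeta.
Proof.
move=> kn; have /andP[-> _] := stage_times_bounds (ftime_mem (ltnW kn)).
by rewrite -ftime_nst ftime_lt// kn leqnn.
Qed.

Lemma act_stage k h : (k < nst)%N -> act (ftime k) h -> tstart h <= ftime k /\ ftime k.+1 <= tend h.
Proof.
move=> kn /and3P[nh h1 h2]; split=> //.
by have [te|//] := ftime_gap kn (tend_mem nh); move: h2; rewrite ltNge te.
Qed.

Lemma progress_stage k h t : (k < nst)%N -> act (ftime k) h -> ftime k <= t <= ftime k.+1 ->
  phi t h = phi (ftime k) h + hspeed h * (t - ftime k).
Proof.
move=> kn ah /andP[t0 t1]; have [h0 h1] := act_stage kn ah.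
rewrite !progress_during; first by ring.
  by rewrite h0 (le_trans t0)// (le_trans t1).
by rewrite (le_trans h0)// (le_trans t1).
Qed.

Lemma progress_idle k h : (k < nst)%N -> ~~ act (ftime k) h -> phi (ftime k.+1) h = phi (ftime k) h.
Proof.
move=> kn; have [oh|nh] := boolP (opp h); first by rewrite !progress_opp.
rewrite /act nh/= negb_and -ltNge -leNgt => /orP[ts|te].
  have [h1|h1] := ftime_gap kn (tstart_mem h); first by move: ts; rewrite ltNge h1.
  by rewrite !progress_before// ltW.
by rewrite !progress_after// (le_trans te)// ltW// ftimeS.
Qed.

Definition filling_data : flooding_data G :=
  @FloodingData R G filling nst ftime
    (fun k => #|[pred h | act (ftime k.-1) h]|)
    (fun k j => let h := enum_val j in arm_of c h (progress (ftime k.-1) h))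
    (fun k j => hspeed (enum_val j)).

Lemma filling_tip k (j : 'I_(narms filling_data k.+1)) t : (k < nst)%N ->
  ftime k <= t <= ftime k.+1 -> tip j t = hpt (enum_val j) (phi t (enum_val j)).
Proof.
move=> kn t01; have ah : act (ftime k) (enum_val j) by have := enum_valP j; rewrite inE.
by rewrite (progress_stage kn ah t01) /tip /tip_coord /hpt coordD mulrA.
Qed.

Lemma filling_tip_coord k (j : 'I_(narms filling_data k.+1)) t :
  tip_coord j t = coord (enum_val j) (phi (ftime k) (enum_val j) + hspeed (enum_val j) * (t - ftime k)).
Proof. by rewrite coordD /tip_coord mulrA. Qed.

Lemma act_arm k h : act (ftime k) h -> exists j : 'I_(narms filling_data k.+1), enum_val j = h.
Proof.
move=> ah; have hin : h \in [pred h | act (ftime k) h] by rewrite inE.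
by exists (enum_rank_in hin h); rewrite enum_rankK_in.
Qed.

Lemma filling_stage_set k t : (k < nst)%N -> ftime k <= t <= ftime k.+1 ->
  F t = F (ftime k) `|`
    [set p | exists (j : 'I_(narms filling_data k.+1)) s, ftime k <= s <= t /\ p = tip j s].
Proof.
move=> kn /andP[t0 t1]; apply/seteqP; split=> p.
  move=> [h ht [d /andP[d0 dp] ->]].
  have [hs|hs] := ftime_gap kn (tstart_mem h).
    have [dl|dl] := leP d (phi (ftime k) h).
      by left; exists h => //; exists d => //; rewrite d0.
    have ah : act (ftime k) h.
      apply: contraT => nah; have := progress_idle kn nah.
      have := progress_mono h t1; lra.
    have [j jh] := act_arm ah; right; exists j.
    have z0 : 0 < hspeed h by apply: hspeed_gt0; have /and3P[] := ah.
    have [_ te] := act_stage kn ah.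
    have E0 := progress_stage kn ah (introT andP (conj (lexx _) (ltW (ftimeS kn)))).
    have Et := progress_stage kn ah (introT andP (conj t0 t1)).
    exists (ftime k + (d - phi (ftime k) h) / hspeed h).
    have s0 : 0 <= (d - phi (ftime k) h) / hspeed h by rewrite divr_ge0 ?subr_ge0 ?ltW.
    have s1 : (d - phi (ftime k) h) / hspeed h <= t - ftime k.
      by rewrite ler_pdivrMr// lerBlDl (le_trans dp)// Et mulrC.
    split; first by rewrite lerDl s0/= -lerBrDl.
    rewrite filling_tip//; last by rewrite lerDl s0/= (le_trans _ t1)// -lerBrDl.
    rewrite jh (progress_stage kn ah); last by rewrite lerDl s0/= (le_trans _ t1)// -lerBrDl.
    congr hpt; rewrite (addrC (ftime k)) addrK mulrCA divff ?gt_eqF// mulr1; ring.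
  have tE : t = ftime k.+1 by apply/eqP; rewrite eq_le t1 (le_trans hs).
  have hE : tstart h = ftime k.+1 by apply/eqP; rewrite eq_le hs -tE ht.
  have dE : d = 0.
    by apply/eqP; rewrite eq_le d0 andbT (le_trans dp)// progress_before// hE tE.
  case hN : (start h) => [v|]; last first.
    have := ftimeS_gt0 kn; rewrite -hE tstart_root ?ltxx//.
    by rewrite /up hN.
  have hup : up h = Some (par v) by rewrite /up hN.
  set x := par v in hup; have nx : ~~ opp x by exact: (par_nopp par_end rank_par).
  have xe : tend x = ftime k.+1 by rewrite -(tstart_up hup).
  have ax : act (ftime k) x.
    rewrite /act nx xe ftimeS// andbT.
    have [//|xs] := ftime_gap kn (tstart_mem x).
    by have := tstart_lt_tend nx; rewrite xe ltNge xs.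
  have [j jx] := act_arm ax; right; exists j, t; rewrite t0 lexx; split=> //.
  rewrite filling_tip ?t0// jx progress_after ?xe ?tE// dE.
  have -> : L x = hwidth x by rewrite filling_hwidth (L_opp (opp_flip_par par_end v)) addr0.
  have -> : hpt x (hwidth x) = hpt (flip x) 0 by rewrite hpt_flip subr0.
  apply/pt_eqP.
  - by apply: (coord_in c0 cl cs); rewrite lexx w_ge0.
  - by apply: (coord_in c0 cl cs); rewrite lexx w_ge0.
  - by right; exists v; split; apply: start_vertex => //; rewrite par_end.
move=> [Fp|[j [s [/andP[s0 s1] ->]]]]; first exact: filling_mono Fp.
rewrite filling_tip ?s0 ?(le_trans s1)//.
have := enum_valP j; rewrite inE => /act_stage[//|h0 h1].
exists (enum_val j); first by rewrite (le_trans h0)// (le_trans s0).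
by exists (phi s (enum_val j)) => //; rewrite progress_ge0 progress_mono.
Qed.

Lemma filling_no_event k t : (k < nst)%N -> ftime k < t < ftime k.+1 ->
  ~ @stage_end_event R G filling_data k.+1 t.
Proof.
move=> kn /andP[t0 t1].
have t01 : ftime k <= t <= ftime k.+1 by rewrite !ltW.
have tc (j : 'I_(narms filling_data k.+1)) :
    tip_coord j t = coord (enum_val j) (phi t (enum_val j)) /\ 0 < phi t (enum_val j) < L (enum_val j).
  have := enum_valP j; rewrite inE => ah; rewrite filling_tip_coord -(progress_stage kn ah t01).
  have [h0 h1] := act_stage kn ah; have /and3P[nh _ _] := ah; split=> //.
  rewrite progress_lt ?(lt_le_trans t1)// andbT progress_during.
    by rewrite mulr_gt0 ?hspeed_gt0// subr_gt0 (le_lt_trans h0).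
  by rewrite (le_trans h0 (ltW t0)) (le_trans (ltW t1)).
case=> [[j]|[j1 [j2 [nj ej cj]]]].
  have [-> /andP[p0 p1]] := tc j; apply; apply: (coord_in c0 cl cs).
  by rewrite ltW//= phi_width.
have [E1 /andP[p1 q1]] := tc j1; have [E2 /andP[p2 q2]] := tc j2.
have Lf y := L_ge0 (flip y).
have m1 : 0 < phi t (enum_val j1) < hwidth (enum_val j1).
  by rewrite p1 filling_hwidth (lt_le_trans q1)// lerDl.
have m2 : 0 <= phi t (enum_val j2) <= hwidth (enum_val j2).
  by rewrite ltW//= phi_width.
move: cj; rewrite E1 E2 => cj.
have [[yh _]|[yh dd]] := coord_mid_inj cs ej cj m1 m2.
  by apply: nj; exact: (enum_val_inj (esym yh)).
rewrite yh in q2 dd; move: q2; rewrite dd filling_hwidth ltrBlDl ltrD2r.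
by rewrite ltNge (ltW q1).
Qed.

Lemma filling_event k : (k < nst)%N -> forall e, 0 < e ->
  exists2 t, ftime k < t < ftime k.+1 + e & @stage_end_event R G filling_data k.+1 t.
Proof.
move=> kn e e0.
have tk : ftime k < ftime k.+1 by rewrite ftimeS.
have [x ax xe] : exists2 x, act (ftime k) x & tend x = ftime k.+1.
  have /mem_stage_times[E|E|[h E]] := ftime_mem kn.
  - by have := ftimeS_gt0 kn; rewrite E ltxx.
  - have [x ax] := act_exists (ftime_bounds kn); exists x => //.
    by apply/eqP; rewrite eq_le {1}E tend_le; have [] := act_stage kn ax.
  - case hN : (start h) => [v|]; last first.
      have := ftimeS_gt0 kn; rewrite E tstart_root ?ltxx//.
      by rewrite /up hN.
    have hup : up h = Some (par v) by rewrite /up hN.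
    have nx : ~~ opp (par v) by exact: (par_nopp par_end rank_par).
    have xe : tend (par v) = ftime k.+1 by rewrite -(tstart_up hup).
    exists (par v) => //; rewrite /act nx xe tk andbT.
    have [//|xs] := ftime_gap kn (tstart_mem (par v)).
    by have := tstart_lt_tend nx; rewrite xe ltNge xs.
have /and3P[nx _ _] := ax; have z0 := hspeed_gt0 nx.
have [j jx] := act_arm ax.
have EL : L x = phi (ftime k) x + hspeed x * (ftime k.+1 - ftime k).
  by rewrite -(progress_stage kn ax) ?progress_after ?xe// lexx ltW.
have [[v pv]|nv] := pselect (exists v, par v = x).
  exists (ftime k.+1 + e / 2); first by lra.
  left; exists j; rewrite filling_tip_coord jx.
  have Lf : L (flip x) = 0 by rewrite L_opp// -pv (opp_flip_par par_end).
  have Lw : L x = hwidth x by rewrite filling_hwidth Lf addr0.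
  have gt : hwidth x < phi (ftime k) x + hspeed x * (ftime k.+1 + e / 2 - ftime k).
    rewrite -Lw EL ltrD2l ltr_pM2l//; lra.
  have := par_end v; rewrite pv => /(start_vertex c0 cl)/end_vertexP.
  have sN : start (flip x) <> None by rewrite -pv par_end.
  move: gt (src_neq_tgt (hedge x)) sN; rewrite /= jx /hedge /= /in_edge /start /coord /hwidth /width /rlo /rhi.
  case: (x) => r [] /= + _.
    case: eqP => // E; rewrite E cl => gt _ _; apply/negP; rewrite negb_and -!ltNge.
    by apply/orP; right; move: gt; lra.
  case: eqP => // E; rewrite E c0 => gt _ _; apply/negP; rewrite negb_and -!ltNge.
  by apply/orP; left; lra.
have nv' v : par v <> x by move=> pv; apply: nv; exists v.
have tz : ftime k.+1 = zeta by rewrite -xe tend_leaf.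
have nf : ~~ opp (flip x) by apply/negP => /(opp_flipP par_end)[v /nv'].
have tf : tend (flip x) = zeta.
  apply: tend_leaf => v pv; move: nx; rewrite -(flipK x) -pv.
  by rewrite (opp_flip_par par_end).
have af : act (ftime k) (flip x).
  rewrite /act nf tf -tz tk andbT.
  have [//|xs] := ftime_gap kn (tstart_mem (flip x)).
  by have := tstart_lt_tend nf; rewrite tf -tz ltNge xs.
have [j' jf] := act_arm af.
have EL' : L (flip x) = phi (ftime k) (flip x) + hspeed (flip x) * (ftime k.+1 - ftime k).
  by rewrite -(progress_stage kn af) ?progress_after ?tf -?tz// lexx ltW.
exists (ftime k.+1); first by rewrite tk ltrDl.
right; exists j, j'; split.
- by move=> jj; have := flip_neq x; rewrite -jf -jx jj eqxx.
- by rewrite /= jx jf.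
- by rewrite !filling_tip_coord jx jf -EL -EL' coord_flip filling_hwidth addrK.
Qed.

Lemma filling_is_stage k : (k < nst)%N -> is_stage filling_data k.+1.
Proof.
move=> kn; have tb := ftime_bounds kn; have /andP[tb0 tb1] := tb.
have sh := filling_shape (ftime k); have cF : closed (F (ftime k)) by exact: filling_closed.
have norms a : outward_normal (F (ftime k)) a <->
    exists j : 'I_(narms filling_data k.+1), farm j = a.
  split=> [/(shape_normals c0 cl cs _ cF sh)[h [/(act_active _ tb1) ah ->]]|[j <-]].
    by have [j jh] := act_arm ah; exists j; rewrite /= jh.
  apply/(shape_normals c0 cl cs _ cF sh); exists (enum_val j); split=> //.
  by apply/act_active => //; have := enum_valP j; rewrite inE.
split=> /=.
- move=> FT; have [h ah] := act_exists tb; have [j jh] := act_arm ah.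
  have /(outward_normalP _ cF)[_ _ [t1 t10]] := (norms (farm j)).2 (ex_intro _ j erefl).
  by move=> /(_ (t1 / 2)); rewrite /= FT => /(_ _)[]//; rewrite divr_gt0//= ltr_pdivrMr// ltr_pMr// ltr1n.
- split=> // j j' E; apply: enum_val_inj.
  apply: (arm_of_active_inj cs sh _ _ E).
    by apply/act_active => //; have := enum_valP j; rewrite inE.
  by apply/act_active => //; have := enum_valP j'; rewrite inE.
- split; first by move=> j; exact: hspeed_ge0.
  rewrite -(big_enum_val hspeed) -(speed_sum tb).
  by apply: eq_bigl => h; rewrite inE.
- apply/eqP; rewrite eq_le; apply/andP; split.
    apply: lb_le_inf.
      have [t /andP[t0 _] te] := filling_event kn ltr01.
      by exists t.
    move=> t [t0 te]; rewrite leNgt; apply/negP => t1.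
    by apply: (filling_no_event kn _ te); rewrite t0.
  apply/ler_addgt0Pr => e e0; have [t /andP[t0 t1] te] := filling_event kn e0.
  apply: le_trans (ltW t1); apply: ge_inf => //; exists (ftime k) => s [/ltW//].
- by move=> t; exact: filling_stage_set.
Qed.

Lemma filling_is_flooding : is_flooding filling_data.
Proof.
split=> /=.
- by move=> s t /andP[_]; exact: filling_mono.
- by move=> t _; split; [exact: filling_closed|exact: filling_components].
- by split; [exact: ftime0|case=> // k /= kn; rewrite ftimeS].
- rewrite ftime_nst => t zt; apply/seteqP; split=> // p _.
  by apply: (filling_mono zt); rewrite filling_end.
- by case=> // k /= kn; exact: filling_is_stage.
Qed.

(** Every arm moves at constant speed, so that the entropy is the sum of the
    [- L h * ln (hspeed h)], and the logarithm of a speed is a sum over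
    ancestors. *)
Lemma filling_entropy : entropy filling_data = xln zeta - hook_cost up L.
Proof.
rewrite /entropy /= big_add1 big_mkord /=.
have -> : \sum_(k < nst) (ftime k.+1 - ftime k) *
    \sum_(j < #|[pred h | act (ftime k) h]|) hspeed (enum_val j) * ln (hspeed (enum_val j))
  = \sum_h L h * ln (hspeed h).
  transitivity (\sum_(k < nst) \sum_h (phi (ftime k.+1) h - phi (ftime k) h) * ln (hspeed h)).
    apply: eq_bigr => k _; rewrite -(big_enum_val (fun h => hspeed h * ln (hspeed h))).
    rewrite mulr_sumr big_mkcond; apply: eq_bigr => h _; rewrite inE.
    case: ifPn => [ah|nah]; last by rewrite progress_idle ?subrr ?mul0r.
    rewrite (@progress_stage k h (ftime k.+1))//; last by rewrite lexx andbT ltW// ftimeS.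
    by move: (phi _ h) => q; ring.
  rewrite exchange_big; apply: eq_bigr => h _ /=; rewrite -mulr_suml; congr (_ * _).
  rewrite -(big_mkord predT (fun k => phi (ftime k.+1) h - phi (ftime k) h)) telescope_sumr//.
  by rewrite ftime_nst ftime0 progress_after ?tend_le// progress_before ?subr0// tstart_ge0.
have E h : L h * ln (hspeed h) = L h * ln (a h) - L h * ln zeta
    - \sum_(x | pdesc h x) L h * (ln (b x) - ln (a x)).
  have [oh|nh] := boolP (opp h).
    by rewrite L_opp// !mul0r big1 ?subrr// => x _; rewrite mul0r.
  have lnU : ln (U h) = \sum_(x | pdesc h x) (ln (b x) - ln (a x)).
    rewrite /U; have := @pdesc_nopp h; rewrite !big_mkcond /=.
    have P x : pdesc h x -> 0 < b x /\ 0 < a x.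
      move=> hx; split; last exact/hook_gt0/(pdesc_nopp hx).
      apply: lt_le_trans (hook_gt0 nh) _; exact: (le_hook_pdesc hrk).
    move=> _; rewrite -!big_mkcond /=.
    suff [] : 0 < \prod_(x | pdesc h x) (b x / a x) /\
      ln (\prod_(x | pdesc h x) (b x / a x)) = \sum_(x | pdesc h x) (ln (b x) - ln (a x)) by [].
    apply: (big_rec2 (fun p q => 0 < p /\ ln p = q)); first by rewrite ltr01 ln1.
    move=> x q p hx [p0 <-]; have [bx axx] := P x hx.
    by rewrite mulr_gt0 ?divr_gt0// lnM ?posrE ?divr_gt0// ln_div.
  rewrite -mulr_sumr -lnU /hspeed ln_div ?posrE ?mulr_gt0 ?hook_gt0 ?unfilled_gt0//.
  by rewrite lnM ?posrE ?unfilled_gt0//; ring.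
rewrite (eq_bigr _ (fun h _ => E h)) !sumrB.
have -> : \sum_h L h * ln zeta = zeta * ln zeta by rewrite -mulr_suml.
rewrite (exchange_big_dep predT)//=.
have -> : \sum_x \sum_(h | pdesc h x) L h * (ln (b x) - ln (a x))
    = \sum_x (b x * ln (b x) - b x * ln (a x)).
  by apply: eq_bigr => x _; rewrite -mulr_suml -mulrBr.
have -> : hook_cost up L = \sum_h L h * ln (a h) - \sum_x (b x * ln (b x) - b x * ln (a x)).
  rewrite /hook_cost -sumrB; apply: eq_bigr => h _.
  by rewrite /xln {1}hookE; ring.
by rewrite /xln; move: (\sum_h _) (\sum_x _) (zeta * _) => A B C; ring.
Qed.

Lemma filling_sources : filling 0 = [set p | exists2 h : half, start h = None & p = hpt h 0].
Proof.
apply/seteqP; split=> [p [h h0 [d /andP[d0 dp] ->]]|p [h hN ->]]; last first.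
  by apply: filling_node; rewrite tstart_root// /up hN.
have hE : tstart h = 0 by apply/eqP; rewrite eq_le h0 tstart_ge0.
have dE : d = 0 by apply/eqP; rewrite eq_le d0 andbT (le_trans dp)// progress_before// hE.
exists h; last by rewrite dE.
case hN : (start h) => [v|//].
have hup : up h = Some (par v) by rewrite /up hN.
have := tstart_lt_tend (par_nopp par_end rank_par v).
by rewrite -(tstart_up hup) hE ltNge tstart_ge0.
Qed.

(** All gaps between consecutive sources are positive here. *)
Lemma filling_card : (filling 0 #= `I_(\sum_e n e))%card.
Proof.
pose T : finType := {e : edge G & 'I_(n e)}.
pose g (x : T) := pt (tag x) (c (tag x) (tagged x).+1).
have gb (x : T) : 0 < c (tag x) (tagged x).+1 < len (tag x).
  by apply: grid_interior; rewrite /= ltn_ord.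
have gin (x : T) : in_edge (tag x) (c (tag x) (tagged x).+1).
  by have /andP[h1 h2] := gb x; rewrite /in_edge !ltW.
have -> : filling 0 = g @` setT.
  rewrite filling_sources; apply/seteqP; split=> [p [h hN ->]|p [x _ <-]].
    have [e [[|i] [ie he hc]]] := start_None c hN; first by [].
    by exists (Tagged (fun e => 'I_(n e)) (Ordinal ie)) => //; rewrite /hpt he hc.
  have [r [re ri]] := @region_at R G n (tag x) (tagged x).+1 (ltn_ord (tagged x)).
  exists (r, true); first by rewrite /start /= ri.
  by rewrite /hpt /hedge /coord /= /rlo re ri addr0.
have -> : (\sum_e n e)%N = #|T| by rewrite card_tagged sumnE big_map big_enum; apply: eq_bigr => e _; rewrite card_ord.
rewrite (card_eql (inj_card_eq _)); first exact: card_eq_fin.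
move=> x y _ _ E.
have [ee cc] := pt_mid_inj (gin x) (gb y) E.
case: x y ee cc {E} => e i [e' i'] /= ee; subst e' => cc.
congr existT; apply: val_inj => /=; apply/eqP; apply: contraT => ii.
have lt j k : (j < k < n e)%N -> c e j.+1 < c e k.+1.
  move=> /andP[jk kn]; apply: (@lt_le_trans _ _ (c e j.+2)).
    by apply: filling_step; rewrite ltnW// (leq_ltn_trans jk kn).
  by apply: (c_mono cs); rewrite ltnS jk/= ltnS ltnW.
move: ii; rewrite neq_ltn => /orP[ii|ii].
  by have := lt i i'; rewrite ii ltn_ord cc ltxx => /(_ isT).
by have := lt i' i; rewrite ii ltn_ord cc ltxx => /(_ isT).
Qed.

End Positive.
End Filling.

(** * A flooding read along half-edges *)

(** The sources cut each edge into regions, between [c e i] and [c e i.+1] for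
    [i <= n e]; they are the inner cut points, and the half-edges starting
    there are those without a starting vertex.  Several sources may be put at
    the same place. *)
Record reading (R : realType) (G : metricGraph R) (n : edge G -> nat)
    (c : edge G -> nat -> R) (f : flooding_data G) : Prop := Reading {
  reading0 : forall e, c e 0 = 0;
  reading_last : forall e, c e (n e).+1 = len e;
  reading_step : forall e i, (i <= n e)%N -> c e i <= c e i.+1;
  reading_flooding : is_flooding f;
  reading_sources : forall p, f 0 p <-> exists2 h : half n, start h = None & p = hpt c h 0;
  reading_ex : exists p, f 0 p
}.

Section Reading.
Context {R : realType} {G : metricGraph R}.
Variables (n : edge G -> nat) (c : edge G -> nat -> R) (f : flooding_data G).
Hypothesis rd : reading n c f.
Let c0 := reading0 rd.
Let cl := reading_last rd.
Let cs := @reading_step _ _ _ _ _ rd.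
Let ff := reading_flooding rd.
Let sources := reading_sources rd.
Let source_ex := reading_ex rd.
Local Notation half := (half n).
Local Notation coord := (coord c).
Local Notation hpt := (hpt c).
Local Notation hwidth := (hwidth c).
Implicit Types (h x y : half) (v w : vertex G) (t s d : R) (k : nat).

Local Notation N := (nstages f).
Local Notation tm := (time f).

Lemma flood_mono s t : 0 <= s <= t -> f s `<=` f t.
Proof. by have [+ _ _ _ _] := ff; apply. Qed.

Lemma flood_closed t : 0 <= t -> closed (f t).
Proof. by move=> t0; have [_ /(_ t t0)[]] := ff. Qed.

Lemma time0 : tm 0 = 0. Proof. by have [_ _ [t0 _] _ _] := ff. Qed.

Lemma timeS k : (k < N)%N -> tm k < tm k.+1.
Proof. by move=> kN; have [_ _ [_ H] _ _] := ff; exact: (H k.+1). Qed.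

Lemma time_lt k l : (k < l <= N)%N -> tm k < tm l.
Proof. exact: (tm_mono timeS). Qed.

Lemma time_le k l : (k <= l <= N)%N -> tm k <= tm l.
Proof.
move=> /andP[]; rewrite leq_eqVlt => /orP[/eqP->//|kl lN].
by apply/ltW/time_lt; rewrite kl.
Qed.

Lemma time_ge0 k : (k <= N)%N -> 0 <= tm k.
Proof. by move=> kN; rewrite -time0; apply: time_le. Qed.

Lemma flood_end : f (tm N) = setT.
Proof. by have [_ _ _ H _] := ff; exact: H. Qed.

Lemma flood_stage k : (k < N)%N -> is_stage f k.+1.
Proof. by move=> kN; have [_ _ _ _ H] := ff; exact: (H k.+1). Qed.

Lemma source_flooded k h : (k <= N)%N -> start h = None -> f (tm k) (hpt h 0).
Proof.
move=> kN hN; apply: (@flood_mono 0); first by rewrite lexx time_ge0.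
by apply/sources; exists h.
Qed.

Definition along h (a : arm G) : bool := `[< exists2 d, 0 <= d < hwidth h & a = arm_of c h d >].

Lemma along_uniq a h h' : along h a -> along h' a -> h = h'.
Proof.
move=> /asboolP[d d01 ->] /asboolP[d' d'01 [ee bb xx]].
exact: (coord_half_inj cs ee bb xx).
Qed.

Definition hs k h : R := \sum_(j < narms f k | along h (farm j)) speed j.

Definition ph k h : R := \sum_(i < k) hs i.+1 h * (tm i.+1 - tm i).

Definition pht k t h : R := ph k h + hs k.+1 h * (t - tm k).

Lemma phtE k t h : pht k t h = ph k h + hs k.+1 h * (t - tm k).
Proof. by []. Qed.

Lemma phS k h : ph k.+1 h = pht k (tm k.+1) h.
Proof. by rewrite /ph big_ord_recr. Qed.

Lemma pht_start k h : pht k (tm k) h = ph k h.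
Proof. by rewrite /pht subrr mulr0 addr0. Qed.

Lemma ph0 h : ph 0 h = 0. Proof. by rewrite /ph big_ord0. Qed.

Lemma hs_ge0 k h : (k < N)%N -> 0 <= hs k.+1 h.
Proof. by move=> /flood_stage[_ _ [s0 _] _ _]; exact: sumr_ge0. Qed.

Lemma pht_mono k s t h : (k < N)%N -> s <= t -> pht k s h <= pht k t h.
Proof. by move=> kN st; rewrite lerD2l ler_wpM2l ?hs_ge0// lerD2r. Qed.

Section Stage.
Variable k : nat.
Hypothesis kN : (k < N)%N.
Local Notation t0 := (tm k).
Local Notation t1 := (tm k.+1).
Hypothesis shape0 : shape c (f t0) (ph k).
Local Notation act := (active c (f t0) (ph k)).

Let t0_ge0 : 0 <= t0. Proof. by apply: time_ge0; exact: ltnW. Qed.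
Let ph_ge0 h : 0 <= ph k h. Proof. by have [] := shape0. Qed.

Lemma arm_active (j : 'I_(narms f k.+1)) : exists2 h, act h & farm j = arm_of c h (ph k h).
Proof.
have [_ [_ nrm] _ _ _] := flood_stage kN.
have /(shape_normals c0 cl cs _ (flood_closed t0_ge0) shape0)[h [ah jh]] :=
  (nrm (farm j)).2 (ex_intro _ j erefl).
by exists h.
Qed.

Lemma active_arm h : act h -> exists j : 'I_(narms f k.+1), farm j = arm_of c h (ph k h).
Proof.
move=> ah; have [_ [_ nrm] _ _ _] := flood_stage kN.
apply/nrm/(shape_normals c0 cl cs _ (flood_closed t0_ge0) shape0).
by exists h.
Qed.

Lemma active_along h : act h -> along h (arm_of c h (ph k h)).
Proof. by move=> ah; apply/asboolP; exists (ph k h) => //; exact: active_lt shape0 ah. Qed.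

Lemma along_active h (j : 'I_(narms f k.+1)) : along h (farm j) ->
  act h /\ farm j = arm_of c h (ph k h).
Proof.
have [h' ah' jh'] := arm_active j; move=> hj.
have E : h = h' by apply: (along_uniq hj); rewrite jh'; exact: active_along.
by rewrite E.
Qed.

Lemma along_arm_uniq h (j j' : 'I_(narms f k.+1)) : along h (farm j) -> along h (farm j') -> j = j'.
Proof.
move=> /along_active[_ jh] /along_active[_ jh'].
by have [_ [inj _] _ _ _] := flood_stage kN; apply: inj; rewrite jh jh'.
Qed.

Lemma hs_arm h (j : 'I_(narms f k.+1)) : along h (farm j) -> hs k.+1 h = speed j.
Proof.
move=> hj; rewrite /hs (big_pred1 j)// => j'; apply/idP/eqP => [hj'|->//].
exact: along_arm_uniq hj' hj.
Qed.

Lemma hs_idle h : ~ act h -> hs k.+1 h = 0.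
Proof. by move=> nh; rewrite /hs big1// => j /along_active[]. Qed.

Lemma hs_active h : 0 < hs k.+1 h -> act h.
Proof. by move=> h0; apply: contrapT => /hs_idle E; rewrite E ltxx in h0. Qed.

Lemma hs_sum (F : R -> R) : F 0 = 0 ->
  \sum_h F (hs k.+1 h) = \sum_(j < narms f k.+1) F (speed j).
Proof.
move=> F0; transitivity (\sum_h \sum_(j < narms f k.+1 | along h (farm j)) F (speed j)).
  apply: eq_bigr => h _; have [[j hj]|no] := pselect (exists j : 'I_(narms f k.+1), along h (farm j)).
    rewrite (hs_arm hj) (big_pred1 j)// => j'; apply/idP/eqP => [hj'|->//].
    exact: along_arm_uniq hj' hj.
  rewrite hs_idle ?F0; last first.
    by move=> ah; have [j jh] := active_arm ah; apply: no; exists j; rewrite jh; exact: active_along.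
  by rewrite big1// => j hj; case: no; exists j.
rewrite (exchange_big_dep predT)//=; apply: eq_bigr => j _.
have [h ah jh] := arm_active j; rewrite (big_pred1 h)// => h'.
by apply/idP/eqP => [hj'|->]; [apply: (along_uniq hj')|]; rewrite jh; exact: active_along.
Qed.

Lemma tip_along h (j : 'I_(narms f k.+1)) t : along h (farm j) -> tip j t = hpt h (pht k t h)
  /\ tip_coord j t = coord h (pht k t h).
Proof.
move=> hj; have [ah jh] := along_active hj.
by rewrite /tip /tip_coord /pht (hs_arm hj) /hpt coordD jh /= mulrA.
Qed.

(** The end of a stage is an infimum. *)
Lemma no_event t : t0 < t < t1 -> ~ @stage_end_event R G f k.+1 t.
Proof.
move=> /andP[h0 h1] ev; have [_ _ _ E _] := flood_stage kN.
suff : t1 <= t by rewrite leNgt h1.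
by rewrite E; apply: ge_inf => //; exists t0 => s [/ltW].
Qed.

(** If the region of [h] were filled during the stage, then the arm of [h]
    would meet the opposite arm, or leave its edge, and so end the stage. *)
Lemma still_active h t : act h -> t0 <= t < t1 -> pht k t h + pht k t (flip h) < hwidth h.
Proof.
move=> ah /andP[tt0 tt1]; rewrite ltNge; apply/negP => ge.
have [Ah lt] := ah.
pose w := hwidth h - (ph k h + ph k (flip h)).
pose r := hs k.+1 h + hs k.+1 (flip h).
have w0 : 0 < w by rewrite subr_gt0.
have E s : pht k s h + pht k s (flip h) = hwidth h - w + r * (s - t0).
  by rewrite /pht /w /r; ring.
have rge : w <= r * (t - t0) by move: ge; rewrite E; lra.
have r0 : 0 < r.
  rewrite lt0r addr_ge0 ?hs_ge0// andbT; apply/eqP => r0.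
  by move: rge; rewrite r0 mul0r leNgt w0.
pose s := t0 + w / r.
have sE : pht k s h + pht k s (flip h) = hwidth h.
  by rewrite E /s (addrC t0) addrK mulrC divfK ?gt_eqF// subrK.
have s0 : t0 < s by rewrite ltrDl divr_gt0.
have s1 : s <= t by rewrite -lerBrDl ler_pdivrMr// mulrC.
have [j jh] := active_arm ah.
have hj : along h (farm j) by rewrite jh; exact: active_along.
have [af|naf] := pselect (act (flip h)); last first.
  have naf' : ~ f t0 (hpt (flip h) 0).
    by move=> Af; apply: naf; split=> //; rewrite flipK addrC hwidth_flip.
  case Sf: (start (flip h)) => [v|]; last by apply: naf'; apply: source_flooded => //; exact: ltnW.
  pose s' := (t1 + s) / 2.
  have s'0 : s < s' by rewrite /s'; lra.
  have s'1 : s' < t1 by rewrite /s'; lra.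
  apply: (@no_event s'); first by rewrite (lt_trans s0).
  left; exists j; have [_ ->] := tip_along s' hj; rewrite jh /=.
  apply: (coord_exit c0 cl Sf).
  have f0 q : pht k q (flip h) = 0.
    have [_ _ + _] := shape0 => /(_ _ naf') f0.
    by rewrite /pht f0 hs_idle// mul0r addr0.
  have := E s'; have := E s; have := sE; rewrite !f0 !addr0.
  have : 0 < r * (s' - s) by rewrite mulr_gt0// subr_gt0.
  move: (pht k s' h) (pht k s h) => A B; lra.
have [j' jf] := active_arm af.
have hj' : along (flip h) (farm j') by rewrite jf; exact: active_along.
apply: (@no_event s); first by rewrite s0/=; exact: le_lt_trans s1 tt1.
right; exists j, j'; split.
- by move=> jj; have := flip_neq h; rewrite (along_uniq hj' (h' := h)) ?eqxx// -jj.
- by rewrite jh jf.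
- have [_ ->] := tip_along s hj; have [_ ->] := tip_along s hj'.
  by rewrite coord_flip -sE addrK.
Qed.

Lemma pht_width h t : t0 <= t <= t1 -> pht k t h + pht k t (flip h) <= hwidth h.
Proof.
move=> /andP[tt0 tt1].
have [_ w0 _ _] := shape0.
have H x : act x -> pht k t x + pht k t (flip x) <= hwidth x.
  move=> ax; move: tt1; rewrite le_eqVlt => /orP[/eqP tE|tl]; last first.
    by apply/ltW/still_active => //; rewrite tt0.
  rewrite tE leNgt; apply/negP => gt; have [Ax lt] := ax.
  pose w := hwidth x - (ph k x + ph k (flip x)).
  pose r := hs k.+1 x + hs k.+1 (flip x).
  have wp : 0 < w by rewrite subr_gt0.
  have E s : pht k s x + pht k s (flip x) = hwidth x - w + r * (s - t0).
    by rewrite /pht /w /r; ring.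
  have rge : w < r * (t1 - t0) by move: gt; rewrite E; lra.
  have r0 : 0 < r.
    rewrite lt0r addr_ge0 ?hs_ge0// andbT; apply/eqP => r0.
    by move: rge; rewrite r0 mul0r ltNge ltW.
  have := @still_active x (t0 + w / r) ax.
  rewrite E lerDl divr_ge0 ?(ltW wp) ?(ltW r0)//= -ltrBrDl ltr_pdivrMr// (mulrC _ r) rge => /(_ isT).
  by rewrite (addrC t0) addrK mulrC divfK ?gt_eqF// subrK ltxx.
have [ah|nah] := pselect (act h); first exact: H.
have [af|naf] := pselect (act (flip h)); first by have := H _ af; rewrite flipK addrC.
by rewrite /pht !hs_idle// !mul0r !addr0.
Qed.

Lemma pht_ge0 h t : t0 <= t -> 0 <= pht k t h.
Proof. by move=> tt; rewrite addr_ge0// mulr_ge0 ?hs_ge0// subr_ge0. Qed.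

Lemma pht_le_width h t : t0 <= t <= t1 -> 0 <= pht k t h <= hwidth h.
Proof.
move=> tt; have /andP[tt0 _] := tt; rewrite pht_ge0//=.
by apply: le_trans (pht_width h tt); rewrite lerDl pht_ge0.
Qed.

Lemma stage_setP t p : t0 <= t <= t1 -> f t p <->
  f t0 p \/ exists h s, [/\ act h, t0 <= s <= t & p = hpt h (pht k s h)].
Proof.
move=> tt; have [_ _ _ _ /(_ t tt) ->] := flood_stage kN; split.
  move=> [?|[j [s [ss ->]]]]; [by left|right].
  have [h ah jh] := arm_active j; exists h, s; split=> //.
  by have [] := @tip_along h j s; rewrite ?jh//; exact: active_along.
move=> [?|[h [s [ah ss ->]]]]; [by left|right].
have [j jh] := active_arm ah; exists j, s; split=> //.
have hj : along h (farm j) by rewrite jh; exact: active_along.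
by have [-> _] := tip_along s hj.
Qed.

Lemma stage_shape t : t0 <= t <= t1 -> shape c (f t) (pht k t).
Proof.
move=> tt; have /andP[tt0 tt1] := tt; have [_ _ s3 s4] := shape0.
have sub : f t0 `<=` f t by apply: flood_mono; rewrite t0_ge0.
have P h d : f t (hpt h 0) -> 0 <= d <= hwidth h -> d <= pht k t h -> f t (hpt h d).
  move=> fh d01 dp; have /andP[d0 dw] := d01; have [dl|dl] := leP d (ph k h).
    have [Ah|nAh] := pselect (f t0 (hpt h 0)).
      by apply: sub; apply/s4 => //; left.
    by have -> : d = 0; [apply/eqP; rewrite eq_le d0 andbT -(s3 _ nAh)|].
  have h0 : 0 < hs k.+1 h.
    rewrite lt0r hs_ge0// andbT; apply/eqP => h0.
    by move: dp; rewrite /pht h0 mul0r addr0 leNgt dl.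
  apply/stage_setP => //; right; exists h, (t0 + (d - ph k h) / hs k.+1 h).
  split; first exact: hs_active.
    rewrite lerDl divr_ge0 ?subr_ge0 ?(ltW dl) ?(ltW h0)//= -lerBrDl ler_pdivrMr//.
    by move: dp; rewrite /pht; lra.
  by congr hpt; rewrite /pht (addrC t0) addrK mulrC divfK ?gt_eqF// addrC subrK.
split.
- by move=> h; exact: pht_ge0.
- by move=> h; exact: pht_width.
- move=> h nf; have nf0 : ~ f t0 (hpt h 0) by move=> /sub.
  by rewrite /pht (s3 _ nf0) hs_idle ?mul0r ?addr0// => -[].
move=> h d d01; have /andP[d0 dw] := d01; split; last first.
  move=> [[fh dp]|[fh dp]]; first exact: P.
  have := P (flip h) (hwidth h - d) fh; rewrite hpt_flip subKr; apply=> //.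
  by rewrite subr_ge0 dw hwidth_flip gerBl.
have [->|dn] := eqVneq d 0; first by move=> fh; left; split=> //; exact: pht_ge0.
have [->|dnw] := eqVneq d (hwidth h).
  by move=> fh; right; rewrite subrr pht_ge0// hpt_flip subr0.
have dm : 0 < d < hwidth h by rewrite lt0r dn d0 lt_neqAle dnw dw.
move=> /(stage_setP _ tt)[/(s4 h d d01)[[fh dp]|[fh dp]]|[y [s [[Ay lt] /andP[ss0 ss1] E]]]].
- by left; split; [exact: sub|rewrite (le_trans dp)// -(pht_start k h) pht_mono].
- by right; split; [exact: sub|rewrite (le_trans dp)// -(pht_start k) pht_mono].
have yw : 0 <= pht k s y <= hwidth y by apply: pht_le_width; rewrite ss0 (le_trans ss1).
have [[yh dd]|[yh dd]] := hpt_mid_inj c0 cl cs (esym E) dm yw.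
  by left; split; [apply: sub; rewrite -yh|rewrite -dd yh pht_mono].
by right; split; [apply: sub; rewrite -yh|rewrite -dd yh pht_mono].
Qed.

End Stage.

Lemma shape_at k : (k <= N)%N -> shape c (f (tm k)) (ph k).
Proof.
elim: k => [_|k IH kN]; last first.
  have := stage_shape kN (IH (ltnW kN)) (t := tm k.+1).
  have -> : pht k (tm k.+1) = ph k.+1 by apply/funext => h; rewrite phS.
  by apply; rewrite lexx ltW// timeS.
have z : ph 0 = (fun=> 0) by apply/funext => h; exact: ph0.
rewrite z time0; split=> [//|h|//|h d d01]; first by rewrite addr0 hwidth_ge0.
have /andP[d0 dw] := d01; split; last first.
  move=> [[fh dp]|[fh dp]].
    by have -> : d = 0; [apply/eqP; rewrite eq_le dp|].
  have -> : d = hwidth h by apply/eqP; rewrite eq_le dw -subr_le0.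
  by move: fh; rewrite hpt_flip subr0.
have [-> fh|dn] := eqVneq d 0; first by left.
have [-> fh|dnw] := eqVneq d (hwidth h); first by right; rewrite hpt_flip subr0 subrr.
have dm : 0 < d < hwidth h by rewrite lt0r dn d0 lt_neqAle dnw dw.
move=> /sources[y _ E].
have zw : 0 <= (0 : R) <= hwidth y by rewrite lexx hwidth_ge0.
have /andP[dm0 dm1] := dm.
have [[_ dd]|[_ dd]] := hpt_mid_inj c0 cl cs (esym E) dm zw.
  by rewrite -dd ltxx in dm0.
by move: dm1; rewrite -subr_gt0 -dd ltxx.
Qed.

Lemma hs_total k : (k < N)%N -> \sum_h hs k.+1 h = 1.
Proof.
move=> kN; rewrite (hs_sum kN (shape_at (ltnW kN)) (F := id))//.
by have [_ _ [_ ->]] := flood_stage kN.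
Qed.

Lemma ph_step k h : (k < N)%N -> ph k h <= ph k.+1 h.
Proof. by move=> kN; rewrite phS -(pht_start k h) pht_mono// ltW// timeS. Qed.

Lemma ph_sum k : (k <= N)%N -> \sum_h ph k h = tm k.
Proof.
elim: k => [_|k IH kN]; first by rewrite time0 big1// => h _; exact: ph0.
rewrite (eq_bigr _ (fun h _ => phS k h)) /pht big_split /= IH ?(ltnW kN)//.
by rewrite -mulr_suml hs_total// mul1r addrC subrK.
Qed.

Lemma ph_le k l h : (k <= l <= N)%N -> ph k h <= ph l h.
Proof. exact: (phi_mono ph_step). Qed.

Lemma ph_ge0 k h : (k <= N)%N -> 0 <= ph k h.
Proof. by move=> kN; have [s _ _ _] := shape_at kN. Qed.

Lemma ph_le_width k h : (k <= N)%N -> ph k h <= hwidth h.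
Proof. by move=> kN; have /andP[] := shape_le_width h (shape_at kN). Qed.

Lemma ph_full h : ph N h + ph N (flip h) = hwidth h.
Proof.
have [s1 s2 _ s4] := shape_at (leqnn N); apply/eqP; rewrite eq_le s2 leNgt; apply/negP => lt.
pose d := (ph N h + (hwidth h - ph N (flip h))) / 2.
have p0 := s1 h; have q0 := s1 (flip h).
have : f (tm N) (hpt h d) by rewrite flood_end.
move=> /s4[|[_]|[_]]; rewrite /d; lra.
Qed.

Lemma ph_edge e : \sum_(h | hedge h == e) ph N h = len e.
Proof.
rewrite sum_half_edge -(sum_width c0 cl); apply: eq_bigr => r _.
exact: (ph_full (r, true)).
Qed.

Lemma time_end : tm N = graph_length G.
Proof.
rewrite -ph_sum// /graph_length (partition_big (hedge (n:=n)) predT)//=.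
by apply: eq_bigr => e _; exact: ph_edge.
Qed.

Lemma time_stage t : 0 <= t < tm N -> exists2 k, (k < N)%N & tm k <= t < tm k.+1.
Proof.
move=> /andP[t0]; suff H m : (m <= N)%N -> t < tm m -> exists2 k, (k < N)%N & tm k <= t < tm k.+1.
  exact: H.
elim: m => [_|k IH kN tk]; first by rewrite time0 ltNge t0.
have [tl|tl] := leP (tm k) t; first by exists k; rewrite ?tl.
by apply: IH => //; exact: ltnW.
Qed.

Lemma ph_pos_active k h : (k <= N)%N -> 0 < ph k h ->
  exists2 i, (i < k)%N & active c (f (tm i)) (ph i) h.
Proof.
move=> kN; apply: contraPP => nex; rewrite /ph big1 ?ltxx// => i _.
have iN : (i < N)%N by apply: leq_trans (ltn_ord i) kN.
rewrite (hs_idle iN (shape_at (ltnW iN))) ?mul0r// => ai.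
by apply: nex; exists i.
Qed.

Lemma ph_pos_start k h : (k < N)%N -> 0 < ph k.+1 h -> f (tm k) (hpt h 0).
Proof.
move=> kN /(ph_pos_active kN)[i ik [fi _]].
have iN : (i <= N)%N by apply: leq_trans (ltnW kN).
by apply: (flood_mono _ fi); rewrite time_ge0//= time_le// (ik : (i <= k)%N) ltnW.
Qed.

(** ** The vertices *)

Lemma vertex_half v : exists h : half, start h = Some v.
Proof.
have [e []] : exists e, src e = v \/ tgt e = v.
- have [p _] := source_ex; have [e [_ _]] := gspace_ptP p.
  have [u uv] : exists u, v != u.
    by have [ve|ve] := eqVneq v (src e); [exists (tgt e); rewrite ve src_neq_tgt|exists (src e)].
  have /connectP[[|w s]] := graph_connected v u; first by move=> _ /eqP; rewrite eq_sym (negbTE uv).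
  rewrite /= => /andP[/existsP[e' /eqP E] _] _; exists e'.
  have : v \in [set src e'; tgt e']%SET by rewrite E !inE eqxx.
  by rewrite !inE => /orP[/eqP ->|/eqP ->]; [left|right].
- move=> <-; have [r [re ri]] := @region_at R G n e 0 isT.
  by exists (r, true); rewrite /start /= ri /hedge /= re.
move=> <-; have [r [re ri]] := @region_at R G n e (n e) (leqnn _).
by exists (r, false); rewrite /start /hedge /= ri re eqxx.
Qed.

Definition vertex_pt v : gspace G := hpt (projT1 (cid (vertex_half v))) 0.

Lemma node_in h : in_edge (hedge h) (coord h 0).
Proof. by apply: (coord_in c0 cl cs); rewrite lexx hwidth_ge0. Qed.

Lemma vertex_ptE v e (x : R) : in_edge e x -> end_vertex e x = Some v -> pt e x = vertex_pt v.
Proof.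
move=> ex ev; rewrite /vertex_pt; case: cid => h hv /=.
apply/pt_eqP => //; first exact: node_in.
by right; exists v; split=> //; exact: start_vertex.
Qed.

Lemma vertex_pt_end v e (x : R) : in_edge e x -> vertex_pt v = pt e x -> end_vertex e x = Some v.
Proof.
rewrite /vertex_pt; case: cid => h hv /= ex.
have hv' := start_vertex c0 cl hv.
move=> /(pt_eqP (node_in h) ex)[[ee xx]|[w [h1 h2]]]; first by rewrite -ee -xx.
by rewrite h2 -h1.
Qed.

Lemma start_pt h v : start h = Some v -> hpt h 0 = vertex_pt v.
Proof. by move=> hv; apply: vertex_ptE (node_in h) _; exact: start_vertex. Qed.

Lemma start_pt_inj h v w : start h = Some v -> hpt h 0 = vertex_pt w -> v = w.
Proof.
move=> /(start_vertex c0 cl) hv /esym/(vertex_pt_end (node_in h)).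
by rewrite hv => -[].
Qed.

(** The stage of arrival ranks the vertices: the half-edge that first reaches
    a vertex starts at a source or at a vertex that was reached earlier. *)
Lemma arrival_ex : exists kap : vertex G -> nat, forall v,
  [/\ (kap v <= N)%N, f (tm (kap v)) (vertex_pt v)
    & forall k, (k <= N)%N -> f (tm k) (vertex_pt v) -> (kap v <= k)%N].
Proof.
suff H v : exists k, [/\ (k <= N)%N, f (tm k) (vertex_pt v)
    & forall i, (i <= N)%N -> f (tm i) (vertex_pt v) -> (k <= i)%N].
  by have [kap kapP] := choice H; exists kap.
have ex : exists k, (k <= N)%N && `[< f (tm k) (vertex_pt v) >].
  by exists N; rewrite leqnn; apply/asboolP; rewrite flood_end.
case: (ex_minnP ex) => k /andP[kN /asboolP fk] mink; exists k; split=> // i iN fi.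
by apply: mink; rewrite iN; apply/asboolP.
Qed.

Definition arrival : vertex G -> nat := projT1 (cid arrival_ex).

Lemma arrivalP v : [/\ (arrival v <= N)%N, f (tm (arrival v)) (vertex_pt v)
    & forall k, (k <= N)%N -> f (tm k) (vertex_pt v) -> (arrival v <= k)%N].
Proof. by rewrite /arrival; case: cid. Qed.

(** If a source lies on the vertex, an empty half-edge leading from this
    source to the vertex plays the part of the arriving one, so that the
    vertex still has a parent. *)
Lemma arriving_half v : exists h, [/\ start (flip h) = Some v, ph (arrival v) h = hwidth h
  & forall w, start h = Some w -> (arrival w < arrival v)%N].
Proof.
have [kN fk mink] := arrivalP v; case E: (arrival v) kN fk mink => [|k] kN fk mink.
  rewrite time0 in fk; have /sources[h hN hp] := fk.
  have [e [i [/andP[i1 ie] he hc]]] := start_None c hN.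
  have hv := vertex_pt_end (node_in h) hp; rewrite he hc in hv.
  have ne0 : n e != 0 by rewrite -lt0n (leq_trans i1).
  have [[ci sv]|[ci sv]] := end_vertexP hv.
    have [r [re ri]] := @region_at R G n e 0 isT; exists (r, false).
    rewrite /flip /start /hedge /= ri re eqxx eq_sym (negbTE ne0) sv; split=> //.
    rewrite ph0; apply/eqP; rewrite eq_le hwidth_ge0//= /hwidth /width /rhi /rlo /= re ri c0 subr0.
    by rewrite -ci; apply: (c_mono cs); rewrite i1 leqW.
  have [r [re ri]] := @region_at R G n e (n e) (leqnn _); exists (r, true).
  rewrite /flip /start /hedge /= ri re eqxx (negbTE ne0) sv; split=> //.
  rewrite ph0; apply/eqP; rewrite eq_le hwidth_ge0//= /hwidth /width /rhi /rlo /= re ri cl -ci subr_le0.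
  by apply: (c_mono cs); rewrite ie leqnSn.
have sh := shape_at (ltnW kN).
have tt : tm k <= tm k.+1 <= tm k.+1 by rewrite lexx ltW// timeS.
have nfk : ~ f (tm k) (vertex_pt v) by move=> /(mink _ (ltnW kN)); rewrite ltnn.
have /(stage_setP kN sh _ tt)[//|[h [s [[fh lt] ss hs]]]] := fk.
have /andP[d0 dw] := pht_le_width kN sh h (t := s) (introT andP (conj (elimTF andP ss).1 (elimTF andP ss).2)).
have sin : in_edge (hedge h) (coord h (pht k s h)) by apply: (coord_in c0 cl cs); rewrite d0.
have hv := vertex_pt_end sin hs.
have [dE|dE] := end_vertex_half c0 cl cs (introT andP (conj d0 dw)) hv.
  by case: nfk; rewrite hs dE.
have hf : hpt (flip h) 0 = vertex_pt v by rewrite hpt_flip subr0 -dE hs.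
exists h; split.
- case S: (start (flip h)) => [w|]; first by rewrite (start_pt_inj S hf).
  by case: nfk; rewrite -hf; apply: source_flooded => //; exact: ltnW.
- have /andP[_ s1] := ss; apply/eqP; rewrite eq_le (ph_le_width _ kN)/= -dE phS.
  exact: pht_mono.
- move=> w hw; have [_ _ minw] := arrivalP w; rewrite ltnS.
  by apply: minw; rewrite ?(ltnW kN)// -(start_pt hw).
Qed.

Definition par v : half := projT1 (cid (arriving_half v)).

Lemma parP v : [/\ start (flip (par v)) = Some v, ph (arrival v) (par v) = hwidth (par v)
  & forall w, start (par v) = Some w -> (arrival w < arrival v)%N].
Proof. by rewrite /par; case: cid. Qed.

Lemma par_end v : start (flip (par v)) = Some v. Proof. by have [] := parP v. Qed.

Lemma arrival_par v w : start (par v) = Some w -> (arrival w < arrival v)%N.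
Proof. by have [_ _ H] := parP v; exact: H. Qed.

Local Notation up := (up par).
Local Notation opp := (opp par).
Local Notation pdesc := (pdesc up).
Local Notation desc := (desc up).

Lemma par_full k v : (arrival v <= k <= N)%N -> ph k (par v) = hwidth (par v).
Proof.
move=> /andP[ak kN]; have [_ E _] := parP v.
by apply/eqP; rewrite eq_le ph_le_width//= -E ph_le// ak.
Qed.

Lemma opp_ph k h : (k <= N)%N -> opp h -> ph k h = 0.
Proof.
move=> kN /oppP[v hv pv]; have [aN _ _] := arrivalP v.
have E : ph N (flip h) = hwidth h by rewrite -pv par_full ?aN ?leqnn// pv.
apply/eqP; rewrite eq_le ph_ge0// andbT.
have : ph N h = 0 by have := ph_full h; rewrite E; lra.
by move=> <-; rewrite ph_le// kN leqnn.
Qed.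

Lemma ph_feasible : feasible (hedge (n:=n)) (@len R G) opp (ph N).
Proof.
split=> [h|e|h oh]; [exact: ph_ge0|exact: ph_edge|exact: opp_ph].
Qed.

Lemma reached_start k h v : (k <= N)%N -> start h = Some v ->
  f (tm k) (hpt h 0) <-> (arrival v <= k)%N.
Proof.
move=> kN hv; rewrite (start_pt hv); have [aN fa amin] := arrivalP v.
split=> [|ak]; first exact: amin.
by apply: (flood_mono _ fa); rewrite time_ge0//= time_le// ak.
Qed.

(** Arms only start at flooded points, and [par v] has run its full width
    when [v] is flooded. *)
Lemma anc_full k x y : (k <= N)%N -> f (tm k) (hpt y 0) -> pdesc y x -> ph k x = hwidth x.
Proof.
move=> kN; move: {2}(half_rank arrival y) (leqnn (half_rank arrival y)) => m.
elim: m y => [|m IH] y ym fy yx; have [z yz zx] := pdesc_up yx; have := half_rank_up arrival_par yz.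
  by move=> h; have := leq_trans h ym.
move=> zm; have /upP[v yv pv] := yz.
have av := (reached_start kN yv).1 fy.
have zfull : ph k z = hwidth z by rewrite -pv par_full// av.
have [<-//|nzx] := eqVneq z x.
apply: (IH z) => //; first exact: leq_trans zm ym; last by apply/andP.
case Sz: (start z) => [w|]; last by apply: source_flooded.
apply/(reached_start kN Sz); apply: leq_trans av.
by apply/ltnW/arrival_par; rewrite pv.
Qed.

Lemma ph_order k x y : (k < N)%N -> ph k x < ph k.+1 x -> pdesc y x -> ph k.+1 y = 0.
Proof.
move=> kN mx yx; apply/eqP; rewrite eq_le ph_ge0// andbT leNgt; apply/negP => yp.
have E := anc_full (ltnW kN) (ph_pos_start kN yp) yx.
by move: mx; rewrite E ltNge ph_le_width.
Qed.

Lemma entropy_progression : entropy f = progression_entropy N tm ph.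
Proof.
rewrite /entropy /progression_entropy big_add1 big_mkord; congr (- _).
apply: eq_bigr => k _; have kN := ltn_ord k; congr (_ * _).
rewrite -(hs_sum kN (shape_at (ltnW kN)) (F := fun z => z * ln z)) ?mul0r//.
apply: eq_bigr => h _; have d0 : tm k.+1 - tm k != 0 by rewrite subr_eq0 gt_eqF// timeS.
by rewrite phS /pht addrC addrA addNr add0r mulfK.
Qed.

Lemma entropy_le : entropy f <= xln (tm N) - hook_cost up (ph N).
Proof.
rewrite entropy_progression.
exact: (progression_entropy_le (half_rank_up arrival_par) time0 timeS ph0 ph_step ph_sum ph_order).
Qed.

End Reading.

(** * Readings of a flooding of maximal entropy *)

Section Optimum.
Context {R : realType} {G : metricGraph R}.
Variables (n : edge G -> nat) (c : edge G -> nat -> R) (f : flooding_data G).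
Hypothesis rd : reading n c f.
Local Notation half := (half n).
Local Notation coord := (coord c).
Local Notation hpt := (hpt c).
Local Notation hwidth := (hwidth c).
Implicit Types (h x y : half) (v w : vertex G) (t s d : R) (k : nat).
Local Notation N := (nstages f).
Local Notation tm := (time f).
Local Notation zeta := (tm N).
Local Notation hs := (@hs R G n c f).
Local Notation ph := (@ph R G n c f).
Local Notation pht := (@pht R G n c f).
Local Notation par := (par rd).
Local Notation up := (up par).
Local Notation opp := (opp par).
Local Notation arrival := (arrival rd).
Local Notation L := (ph N).
Local Notation a := (hook up L).
Local Notation b := (subhook up L).
Local Notation pdesc := (pdesc up).
Local Notation desc := (desc up).

Hypothesis maxf : forall L', generic (hedge (n:=n)) (@len R G) opp L' ->
  xln zeta - hook_cost up L' <= entropy f.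

Let par_end := par_end rd.
Let rank_par := @arrival_par _ _ _ _ _ rd.
Let hrk := half_rank_up rank_par.
Let feas := ph_feasible rd.

Lemma cost_bound L' : feasible (hedge (n:=n)) (@len R G) opp L' ->
  xln zeta - entropy f <= hook_cost up L'.
Proof.
move=> fL; apply: (generic_bound (ed := hedge (n:=n)) (@len_gt0 R G) (edge_nonopp_half par_end rank_par)) fL => L'' /maxf.
lra.
Qed.

Let entropy_max : xln zeta - hook_cost up L <= progression_entropy N tm ph.
Proof.
rewrite -(@entropy_progression _ _ _ _ _ rd).
by have := cost_bound feas; lra.
Qed.

(** The number [xln zeta - entropy f] separates the two costs, by
    [entropy_le] and [cost_bound]. *)
Lemma reading_minimal L' : feasible (hedge (n:=n)) (@len R G) opp L' ->
  hook_cost up L <= hook_cost up L'.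
Proof.
move=> /cost_bound h; apply: le_trans h.
have := entropy_le rd; lra.
Qed.

Let Lge0 h : 0 <= L h. Proof. exact: (ph_ge0 rd). Qed.

Lemma dphE k h : ph k.+1 h - ph k h = hs k.+1 h * (tm k.+1 - tm k).
Proof. by rewrite phS phtE addrC addrA addNr add0r. Qed.

Lemma movingE k h : (k < N)%N -> moving ph k h <-> 0 < hs k.+1 h.
Proof.
move=> kN; rewrite /moving -subr_gt0 dphE pmulr_lgt0// subr_gt0.
exact: (timeS rd).
Qed.

Lemma time_lt_end k : (k < N)%N -> tm k < zeta.
Proof. by move=> kN; apply: (time_lt rd); rewrite kN leqnn. Qed.

Lemma hs_speed k h : (k < N)%N -> 0 < hs k.+1 h ->
  hs k.+1 h * (zeta - tm k) = L h - ph k h + b h.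
Proof.
move=> kN /(movingE _ kN) mh.
have := moving_speed hrk (time0 rd) (timeS rd) (ph0 c f) (ph_step rd) (ph_sum rd)
  (@ph_order _ _ _ _ _ rd) entropy_max kN mh.
rewrite dphE /remaining => E.
have d0 : tm k.+1 - tm k != 0 by rewrite subr_eq0 gt_eqF// (timeS rd).
by apply: (mulIf d0); rewrite -E mulrAC.
Qed.

(** Both sides decrease at the same rate during a stage, so the relation that
    holds at its beginning persists. *)
Lemma hs_speed_at k h t : (k < N)%N -> 0 < hs k.+1 h ->
  L h - pht k t h + b h = hs k.+1 h * (zeta - t).
Proof.
move=> kN h0; have := hs_speed kN h0; rewrite /pht.
by move: (hs k.+1 h) (L h) (ph k h) (b h) => p q r s; lra.
Qed.

(** The speed of such an arm is its own remainder divided by the remaining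
    time, so this remainder is proportional to the remaining time. *)
Lemma leaf_unfinished k h t : (k < N)%N -> tm k <= t < zeta -> b h = 0 ->
  0 < L h -> pht k t h < L h.
Proof.
move=> kN /andP[t0 tz] b0 L0.
have := hs_ge0 rd h kN; rewrite le_eqVlt => /orP[/eqP h0|h0]; last first.
  have := hs_speed_at t kN h0; rewrite b0 addr0.
  have : 0 < hs k.+1 h * (zeta - t) by rewrite mulr_gt0// subr_gt0.
  by lra.
rewrite phtE -h0 mul0r addr0.
have := (remaining_gt0 hrk (time0 rd) (timeS rd) (ph0 c f) (ph_step rd) (ph_sum rd)
  (@ph_order _ _ _ _ _ rd) entropy_max kN L0 b0).
by rewrite /remaining subr_gt0.
Qed.

Lemma par_L v : L (par v) = hwidth (par v).
Proof.
by apply: par_full; rewrite leqnn andbT; have [] := arrivalP rd v.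
Qed.

Lemma anc_full_L k x y : (k <= N)%N -> f (tm k) (hpt y 0) -> pdesc y x -> ph k x = L x.
Proof.
move=> kN fy yx; have E := anc_full kN fy yx; apply/eqP; rewrite eq_le ph_le ?kN ?leqnn//=.
by rewrite E; exact: ph_le_width.
Qed.

Lemma active_nopp k h : (k <= N)%N -> active c (f (tm k)) (ph k) h -> ~~ opp h.
Proof.
move=> kN [fh lt]; apply/negP => /oppP[v hv pv].
have av := (reached_start rd kN hv).1 fh.
have := @par_full _ _ _ _ _ rd k v; rewrite av kN pv => /(_ isT) E.
by move: lt; rewrite E hwidth_flip ltNge lerDr (ph_ge0 rd).
Qed.

Lemma leaf_hook h : (forall v, par v <> h) -> a h = L h.
Proof. by move=> lh; rewrite hookE (subhook_leaf rank_par L lh) addr0. Qed.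

(** An arm at rest would leave its half-edge empty, and lengthening this
    half-edge would gain at an infinite rate. *)
Lemma active_moves k h : (k < N)%N -> active c (f (tm k)) (ph k) h -> 0 < hs k.+1 h.
Proof.
move=> kN ah; have nh := active_nopp (ltnW kN) ah; have [fh lt] := ah.
have tt : tm k <= tm k < zeta by rewrite lexx time_lt_end.
have := @ph_le _ _ _ _ _ rd k N h; rewrite (ltnW kN) leqnn => /(_ isT).
rewrite le_eqVlt => /orP[/eqP E|rem0]; last first.
  have := @remaining_covered _ _ _ _ hrk N tm ph (time0 rd) (timeS rd) (ph0 c f) (ph_step rd) (ph_sum rd)
    (@ph_order _ _ _ _ _ rd) entropy_max k h kN.
  rewrite /remaining subr_gt0 => /(_ rem0)[x mx hx].
  have [hxE|hxn] := eqVneq h x; first by apply/(movingE _ kN); rewrite hxE.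
  have hpx : pdesc h x by apply/andP.
  have := anc_full_L (ltnW kN) fh hpx => Ex.
  by move: mx; rewrite /moving Ex ltNge ph_le// kN leqnn.
have lw : L h < hwidth h.
  by rewrite -E; apply: le_lt_trans lt; rewrite lerDl (ph_ge0 rd)// ltnW.
have lh v : par v <> h by move=> pv; move: lw; rewrite -pv par_L ltxx.
have := Lge0 h; rewrite le_eqVlt => /orP[/eqP L0|L0]; last first.
  by have := leaf_unfinished kN tt (subhook_leaf rank_par L lh) L0; rewrite pht_start E ltxx.
exfalso; apply: (minimiser_no_idle (@len_gt0 R G) feas reading_minimal nh).
  by rewrite leaf_hook.
move=> y hy by0; rewrite hookE by0 addr0; apply/eqP; rewrite eq_le Lge0 andbT leNgt; apply/negP => Ly.
have := anc_full_L (ltnW kN) fh hy => Ey.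
have := remaining_gt0 hrk (time0 rd) (timeS rd) (ph0 c f) (ph_step rd) (ph_sum rd)
  (@ph_order _ _ _ _ _ rd) entropy_max kN Ly by0.
by rewrite /remaining Ey subrr ltxx.
Qed.

(** A gap of length zero between two sources could be widened at an infinite
    rate of gain. *)
Lemma gap_gt0 h : start h = None -> start (flip h) = None -> 0 < hwidth h.
Proof.
move=> hN fN; rewrite lt_neqAle (hwidth_ge0 (@reading_step _ _ _ _ _ rd)) andbT; apply/eqP => w0.
have L0 : L h = 0.
  by apply/eqP; rewrite eq_le Lge0 andbT w0 ph_le_width.
have lh v : par v <> h by move=> pv; move: fN; rewrite -pv par_end.
apply: (minimiser_no_idle (@len_gt0 R G) feas reading_minimal (root_nopp par hN)).
  by rewrite leaf_hook.
by move=> y /pdesc_up[z]; rewrite root_up.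
Qed.

Lemma root_balance r r' : start r = None -> start r' = None -> r != r' -> hedge r = hedge r' ->
  0 < L r -> a r <= a r'.
Proof.
move=> rN r'N rr' ee L0.
exact: (minimiser_balance feas reading_minimal (root_up par rN) (root_up par r'N) rr' ee (root_nopp par r'N) L0).
Qed.

(** At all times the arms inside the subtree receive the same share of the
    total speed, by [remaining_scale]. *)
Lemma branch_progress k t h : (k < N)%N -> (forall y, pdesc h y -> L y = 0) ->
  (\sum_(x | desc x h) pht k t x) * zeta = a h * t.
Proof.
move=> kN anc0; have z0 : 0 < zeta by rewrite -(time0 rd) time_lt_end// (leq_trans _ kN).
have anc k' (k'N : (k' <= N)%N) y : pdesc h y -> remaining N ph k' y = 0.
  move=> /anc0 Ly; rewrite /remaining Ly; apply/eqP; rewrite sub0r oppr_eq0.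
  rewrite eq_le (ph_ge0 rd)// andbT -Ly ph_le// k'N leqnn//.
have sc k' (k'N : (k' < N)%N) : (\sum_(x | desc x h) hs k'.+1 x) * (zeta - tm k')
   = \sum_(x | desc x h) (L x - ph k' x).
  have := remaining_scale hrk (time0 rd) (timeS rd) (ph0 c f) (ph_step rd) (ph_sum rd)
    (@ph_order _ _ _ _ _ rd) entropy_max k'N (anc k' (ltnW k'N)).
  rewrite (eq_bigr _ (fun x _ => dphE k' x)) -mulr_suml mulrAC => E.
  have d0 : tm k'.+1 - tm k' != 0 by rewrite subr_eq0 gt_eqF// (timeS rd).
  exact: (mulIf d0).
have mid k' s : (k' < N)%N -> (\sum_(x | desc x h) ph k' x) * zeta = a h * tm k' ->
    (\sum_(x | desc x h) pht k' s x) * zeta = a h * s.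
  move=> k'N IH; have := sc _ k'N; rewrite sumrB -/(a h).
  rewrite (eq_bigr _ (fun x _ => phtE c f k' s x)) big_split /= -mulr_suml.
  have zk : zeta - tm k' != 0 by rewrite subr_eq0 gt_eqF// time_lt_end.
  move: IH zk; move: (\sum_(x | _) ph k' x) (\sum_(x | _) hs _ x) (a h) (tm k') z0 => P Q A T z0 IH zk E.
  have E2 : Q * zeta = A.
    apply: (mulIf zk); have -> : Q * zeta * (zeta - T) = (Q * (zeta - T)) * zeta by ring.
    by rewrite E mulrBl IH mulrBr.
  rewrite mulrDl IH; have -> : Q * (s - T) * zeta = (Q * zeta) * (s - T) by ring.
  by rewrite E2; ring.
apply: (mid) => //; elim: k kN => [_|k IH kN].
  by rewrite big1 ?mul0r ?(time0 rd) ?mulr0// => x _; exact: ph0.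
rewrite (eq_bigr _ (fun x _ => phS c f k x)); apply: mid; first exact: ltnW.
by apply: IH; exact: ltnW.
Qed.

End Optimum.

(** * Lengths of subsets of the metric graph *)

Section Length.
Context {R : realType} {G : metricGraph R}.

Lemma total_length_le (C D : set (gspace G)) : C `<=` D -> total_length C <= total_length D.
Proof.
move=> CD; apply: ler_sum => e _.
have mle (A B : set R) : A `<=` B -> (lebesgue_measure A <= lebesgue_measure B)%E.
  move=> AB; rewrite /lebesgue_measure /lebesgue_stieltjes_measure /measure_extension.
  exact: le_mu_ext.
have fin (A : set (gspace G)) : (lebesgue_measure [set x | in_edge e x /\ A (pt e x)] \is a fin_num)%E.
  rewrite ge0_fin_numE//.
  have sub : [set x | in_edge e x /\ A (pt e x)] `<=` `[0, len e]%classic.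
    by move=> x [ex _]; rewrite /= in_itv.
  apply: le_lt_trans (mle _ _ sub) _; rewrite lebesgue_measure_itv /=.
  by case: ifP => _; rewrite ?ltry.
by rewrite fine_le// mle// => x [ex Cx]; split=> //; exact: CD.
Qed.

Lemma measure_disjoint_union (I : choiceType) (s : seq I) (F : I -> set R) : uniq s ->
  (forall i, measurable (F i)) ->
  (forall i j x, i \in s -> j \in s -> F i x -> F j x -> i = j) ->
  lebesgue_measure (\big[setU/set0]_(i <- s) F i) = (\sum_(i <- s) lebesgue_measure (F i))%E.
Proof.
move=> us mF; elim: s us => [|i s IH] /=; first by rewrite !big_nil measure0.
move=> /andP[ni us] dis; rewrite !big_cons -IH//; last first.
  by move=> j l x js ls; apply: dis; rewrite inE ?js ?ls orbT.
have mB : measurable (\big[setU/set0]_(j <- s) F j).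
  elim: (s) => [|j l mS]; first by rewrite big_nil; exact: measurable0.
  by rewrite big_cons; apply: measurableU => //; exact: mF.
rewrite measureU; [by []|exact: mF|exact: mB|].
apply/seteqP; split=> // x [Fx]; rewrite -bigcup_seq => -[j /= js Fj].
have E : i = j by apply: (dis i j x) => //; rewrite inE ?eqxx ?js ?orbT.
by move: ni; rewrite E js.
Qed.

Variables (n : edge G -> nat) (c : edge G -> nat -> R).
Hypotheses (c0 : forall e, c e 0 = 0) (cl : forall e, c e (n e).+1 = len e).
Hypothesis cs : forall e i, (i <= n e)%N -> c e i <= c e i.+1.
Local Notation half := (half n).
Local Notation coord := (coord c).
Local Notation hpt := (hpt c).
Local Notation hwidth := (hwidth c).
Implicit Types (h : half) (d : R).

(** Only the end points of the intervals are undecided, and they do not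
    count. *)
Lemma total_length_half (C : set (gspace G)) (s p : half -> R) :
  (forall h, 0 <= s h <= p h) -> (forall h, p h + p (flip h) <= hwidth h) ->
  (forall h d, s h < d < p h -> C (hpt h d)) ->
  (forall q, C q -> exists h d, s h <= d <= p h /\ q = hpt h d) ->
  total_length C = \sum_h (p h - s h).
Proof.
move=> sp pw lower upper.
rewrite (partition_big (hedge (n:=n)) predT)//=; apply: eq_bigr => e _.
have p0 h : 0 <= p h by have /andP[h1 h2] := sp h; exact: le_trans h2.
have pw1 h : p h <= hwidth h by apply: le_trans (pw h); rewrite lerDl.
pose I h : set R := coord h @` `]s h, p h[.
have IE h : exists u v : R, [/\ I h = `]u, v[%classic, u <= v & v - u = p h - s h].
  have /andP[_ spp] := sp h; case: (h) spp => r [] spp.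
    exists (coord (r, true) (s (r, true))), (coord (r, true) (p (r, true))); rewrite /I /coord /=; split; [|lra|lra].
    apply/seteqP; split=> x /=.
      by move=> [d]; rewrite !in_itv /= => /andP[? ?] <-; lra.
    by rewrite in_itv /= => /andP[? ?]; exists (x - rlo c r); rewrite ?in_itv /=; lra.
  exists (coord (r, false) (p (r, false))), (coord (r, false) (s (r, false))); rewrite /I /coord /=; split; [|lra|lra].
  apply/seteqP; split=> x /=.
    by move=> [d]; rewrite !in_itv /= => /andP[? ?] <-; lra.
  by rewrite in_itv /= => /andP[? ?]; exists (rhi c r - x); rewrite ?in_itv /=; lra.
have mI h : measurable (I h) by have [u [v [-> _ _]]] := IE h; exact: measurable_itv.
have muI h : lebesgue_measure (I h) = (p h - s h)%:E.
  have [u [v [-> uv <-]]] := IE h; rewrite lebesgue_measure_itv /= lte_fin.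
  by have [//|] := ltP u v => vu; have -> : v - u = 0 by apply/eqP; rewrite subr_eq0 eq_le uv vu.
pose S := [seq h <- enum {: half} | hedge h == e].
have SE h : (h \in S) = (hedge h == e) by rewrite mem_filter mem_enum andbT.
pose Y := \big[setU/set0]_(h <- S) I h.
have YE x : Y x <-> exists2 h, hedge h = e & I h x.
  rewrite /Y -bigcup_seq; split=> [[h /= hS Ih]|[h he Ih]].
    by exists h => //; apply/eqP; rewrite -SE.
  by exists h => //=; rewrite SE he.
have muY : lebesgue_measure Y = (\sum_(h | hedge h == e) (p h - s h))%:E.
  rewrite /Y measure_disjoint_union//; last first.
  - move=> h h' x; rewrite !SE => /eqP he /eqP h'e [d + xd] [d' + xd'].
    rewrite /= !in_itv /= => /andP[d1 d2] /andP[d1' d2'].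
    have /andP[s0 _] := sp h; have /andP[s0' _] := sp h'.
    have dm : 0 < d < hwidth h.
      by rewrite (le_lt_trans s0 d1) (lt_le_trans d2).
    have d'm : 0 <= d' <= hwidth h'.
      by rewrite (ltW (le_lt_trans s0' d1')) (le_trans (ltW d2')).
    have [[->//]|[hh dd]] := coord_mid_inj cs (etrans he (esym h'e)) (etrans xd (esym xd')) dm d'm.
    by exfalso; have := pw h; rewrite -hh; lra.
  - by rewrite filter_uniq// enum_uniq.
  rewrite (eq_bigr (fun h => (p h - s h)%:E)); last by move=> h _; rewrite muI.
  by rewrite sumEFin big_filter big_enum_cond; congr EFin; apply: eq_bigl => h; rewrite andbC.
pose X := [set x | in_edge e x /\ C (pt e x)].
pose F : set R := [set 0; len e] `|` [set` [seq coord h (s h) | h <- enum {: half}]]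
   `|` [set` [seq coord h (p h) | h <- enum {: half}]].
have fF : finite_set F.
  by rewrite !finite_setU; do !split; rewrite ?finite_set1//; exact: finite_seq.
have YX : Y `<=` X.
  move=> x /YE[h he [d /= + <-]]; rewrite in_itv /= => dd.
  have /andP[s0 _] := sp h; have /andP[d1 d2] := dd; split.
    rewrite -he; apply: (coord_in c0 cl cs).
    by rewrite (ltW (le_lt_trans s0 d1)) (le_trans (ltW d2)).
  by rewrite -he; exact: lower.
have XY : X `<=` Y `|` F.
  move=> x [ex /upper[h [d [/andP[d1 d2] E]]]].
  have /andP[s0 _] := sp h.
  have hin : in_edge (hedge h) (coord h d).
    by apply: (coord_in c0 cl cs); rewrite (le_trans s0) ?(le_trans d2).
  have [[ee ->]|[v [/end_vertexP[[-> _]|[-> _]] _]]] := (pt_eqP ex hin).1 E; last 2 first.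
  - by right; left; left; left.
  - by right; left; left; right.
  have [ds|ds] := eqVneq d (s h).
    by right; left; right; apply/mapP; exists h; rewrite ?mem_enum// ds.
  have [dp|dp] := eqVneq d (p h).
    by right; right; apply/mapP; exists h; rewrite ?mem_enum// dp.
  left; apply/YE; exists h => //; exists d => //=.
  by rewrite in_itv /= !lt_neqAle eq_sym ds d1 dp d2.
have XE : X = Y `|` (X `&` F).
  apply/seteqP; split=> x; last by move=> [/YX//|[]].
  by move=> Xx; have [Yx|Fx] := XY x Xx; [left|right].
have cF : countable (X `&` F) by apply/finite_set_countable; apply: sub_finite_set fF => x [].
have mY : measurable Y.
  rewrite /Y; elim: (S) => [|h l mS]; first by rewrite big_nil; exact: measurable0.
  by rewrite big_cons; apply: measurableU => //; exact: mI.
have mF : measurable (X `&` F).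
  by apply: countable_measurable => // x; exact: measurable_set1.
have m0 : lebesgue_measure (X `&` F) = 0%E by exact: countable_lebesgue_measure0.
rewrite -/X XE measureU0; [|exact: mY|exact: mF|exact: m0].
by move: muY; rewrite /= => ->.
Qed.

End Length.

(** * The flooded set before the final time is a union of trees *)

(** Each of the two arcs of the loop between [s1] and [s2] has to pass
    through [z], but a loop takes each value once. *)
Lemma loop_no_cut (R : realType) (G : metricGraph R) (g : R -> gspace G) (D E : set (gspace G)) z :
  {within `[0, 1], continuous g} ->
  (forall s t : R, 0 <= s < 1 -> 0 <= t < 1 -> g s = g t -> s = t) -> g 0 = g 1 ->
  closed D -> closed E -> (forall s : R, 0 <= s <= 1 -> D (g s) \/ E (g s)) ->
  D `&` E `<=` [set z] ->
  forall s1 s2 : R, 0 <= s1 <= 1 -> 0 <= s2 <= 1 -> D (g s1) -> E (g s2) ->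
    g s1 <> z -> g s2 <> z -> False.
Proof.
move=> gc gi g01; wlog : D E / True by move=> H; apply: H.
move=> _ cD cE cov DE s1 s2.
wlog s12 : D E cD cE cov DE s1 s2 / s1 < s2.
  move=> W i1 i2 D1 E2 n1 n2.
  have [lt|gt|eq] := ltgtP s1 s2; first exact: (W D E cD cE cov DE s1 s2).
    apply: (W E D cE cD _ _ s2 s1) => //; first by move=> s /cov[]; [right|left].
    by rewrite setIC.
  by apply: n1; apply: DE; split=> //; rewrite eq.
move=> /andP[s10 _] /andP[_ s21] D1 E2 n1 n2.
have con (u v : R) : 0 <= u -> v <= 1 -> connected (g @` `[u, v]).
  move=> u0 v1; apply: connected_continuous_connected; first exact: segment_connected.
  apply: continuous_subspaceW gc => x /=; rewrite !in_itv /= => /andP[xu xv].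
  by rewrite (le_trans u0 xu) (le_trans xv v1).
have meet (C : set (gspace G)) : connected C -> C (g s1) -> C (g s2) ->
    (forall p, C p -> exists2 s : R, 0 <= s <= 1 & g s = p) -> C z.
  move=> cC C1 C2 Cg; apply: contrapT => nz.
  have [||CD|CE] := connected_closed_split cC cD cE.
  - by move=> p /Cg[s s01 <-]; case: (cov s s01); [left|right].
  - apply/seteqP; split=> // p [[Cp Dp] Ep]; apply: nz.
    by have <- : p = z by apply: DE.
  - by apply: n2; apply: DE; split=> //; exact: CD.
  - by apply: n1; apply: DE; split=> //; exact: CE.
have [s sin gs] : (g @` `[s1, s2]) z.
  apply: meet; first exact: con.
  - by exists s1 => //=; rewrite in_itv /= lexx ltW.
  - by exists s2 => //=; rewrite in_itv /= lexx ltW.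
  - move=> p [s /=]; rewrite in_itv /= => /andP[h1 h2] <-; exists s => //.
    by rewrite (le_trans s10 h1) (le_trans h2 s21).
have [s' s'in gs'] : exists2 s' : R, (0 <= s' <= s1) || (s2 <= s' <= 1) & g s' = z.
  have : (g @` `[0, s1] `|` g @` `[s2, 1]) z.
    apply: meet.
    - apply: connectedU.
      + exists (g 0); split; first by exists 0; rewrite //= in_itv /= lexx.
        by exists 1; rewrite //= in_itv /= lexx s21.
      + exact: (con 0 s1 (lexx _) (ltW (lt_le_trans s12 s21))).
      + exact: (con s2 1 (le_trans s10 (ltW s12)) (lexx _)).
    - by left; exists s1 => //=; rewrite in_itv /= lexx s10.
    - by right; exists s2 => //=; rewrite in_itv /= lexx s21.
    - move=> p [] [s' /=]; rewrite in_itv /= => /andP[h1 h2] <-; exists s' => //.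
        by rewrite h1 (le_trans h2)// (le_trans (ltW s12)).
      by rewrite h2 andbT (le_trans _ h1)// (le_trans s10)// ltW.
  move=> [] [s' /=]; rewrite in_itv /= => h <-; exists s' => //; rewrite h ?orbT//.
move: sin; rewrite /= in_itv /= => /andP[h1 h2].
have h1' : s1 < s by rewrite lt_neqAle h1 andbT; apply/eqP => ss; apply: n1; rewrite ss.
have h2' : s < s2 by rewrite lt_neqAle h2 andbT; apply/eqP => ss; apply: n2; rewrite -ss.
have s0 : 0 <= s < 1 by rewrite (le_trans s10 h1) (lt_le_trans h2' s21).
have [s'1|s'1] := eqVneq s' 1.
  have := gi 0 s; rewrite lexx ltr01 s0 g01 -s'1 gs' gs => /(_ isT isT erefl) ss.
  by move: h1'; rewrite -ss ltNge s10.
have s'0 : 0 <= s' < 1.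
  rewrite lt_neqAle s'1 /=; case/orP: s'in => /andP[p1 p2].
    by rewrite p1 (le_trans p2)// (le_trans (ltW s12)).
  by rewrite p2 andbT (le_trans _ p1)// (le_trans s10)// ltW.
have ss := gi s s' s0 s'0 (etrans gs (esym gs')).
case/orP: s'in => /andP[p1 p2]; first by move: h1'; rewrite ss ltNge p2.
by move: h2'; rewrite ss ltNge p1.
Qed.

Section Snapshot.
Context {R : realType} {G : metricGraph R}.
Variables (n : edge G -> nat) (c : edge G -> nat -> R) (f : flooding_data G).
Hypothesis rd : reading n c f.
Let c0 := reading0 rd.
Let cl := reading_last rd.
Let cs := @reading_step _ _ _ _ _ rd.
Local Notation half := (half n).
Local Notation coord := (coord c).
Local Notation hpt := (hpt c).
Local Notation hwidth := (hwidth c).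
Local Notation hseg := (hseg c).
Implicit Types (h x y z : half) (v w : vertex G) (d e : R) (p q : gspace G).
Local Notation N := (nstages f).
Local Notation tm := (time f).
Local Notation zeta := (tm N).
Local Notation hs := (@hs R G n c f).
Local Notation ph := (@ph R G n c f).
Local Notation pht := (@pht R G n c f).
Local Notation par := (par rd).
Local Notation up := (up par).
Local Notation opp := (opp par).
Local Notation L := (ph N).
Local Notation pdesc := (pdesc up).
Local Notation desc := (desc up).
Hypothesis maxf : forall L', generic (hedge (n:=n)) (@len R G) opp L' ->
  xln zeta - hook_cost up L' <= entropy f.
Let par_end := par_end rd.
Let rank_par := @arrival_par _ _ _ _ _ rd.
Let hrk := half_rank_up rank_par.

Lemma up_startP x y : up x = Some y -> exists2 v, start x = Some v & par v = y.
Proof. by move=> /upP. Qed.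

Lemma up_None x : up x = None -> start x = None.
Proof. by case E: (start x) => [v|//]; have -> : up x = Some (par v) by apply/upP; exists v. Qed.

Lemma root_ex x : exists r, desc x r /\ start r = None.
Proof.
move: {2}(half_rank (arrival rd) x) (leqnn (half_rank (arrival rd) x)) => m.
elim: m x => [|m IH] x xm; case E: (up x) => [y|].
- by have := leq_trans (hrk E) xm.
- by exists x; rewrite desc_refl up_None.
- have [r [yr rN]] := IH y (leq_trans (hrk E) xm).
  by exists r; rewrite (desc_trans (desc_up E) yr).
- by exists x; rewrite desc_refl up_None.
Qed.

Definition root x : half := projT1 (cid (root_ex x)).

Lemma rootP x : desc x (root x) /\ start (root x) = None.
Proof. by rewrite /root; case: cid. Qed.

Lemma desc_root r y : start r = None -> desc r y -> y = r.
Proof. by move=> rN /descP[->//|[w]]; rewrite (root_up par rN). Qed.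

Lemma root_desc x r : start r = None -> desc x r -> root x = r.
Proof.
move=> rN xr; have [xr' r'N] := rootP x.
have [h|h] := desc_comp hrk xr xr'; first by rewrite (desc_root rN h).
by rewrite (desc_root r'N h).
Qed.

Lemma root_id r : start r = None -> root r = r.
Proof. by move=> rN; apply: root_desc => //; exact: desc_refl. Qed.

Lemma root_mono x y : desc x y -> root x = root y.
Proof.
by move=> xy; have [yr rN] := rootP y; apply: root_desc => //; exact: desc_trans xy yr.
Qed.

Definition origin x : gspace G := hpt (root x) 0.

Lemma origin_source x : f 0 (origin x).
Proof. by apply/(reading_sources rd); exists (root x) => //; have [] := rootP x. Qed.

Lemma origin_root r : start r = None -> origin r = hpt r 0.
Proof. by move=> rN; rewrite /origin root_id. Qed.

Lemma origin_desc x y : desc x y -> origin x = origin y.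
Proof. by move=> xy; rewrite /origin (root_mono xy). Qed.

Lemma par_width v w : start (par v) = Some w -> 0 < hwidth (par v).
Proof.
by move=> sw; rewrite (full_edge_width c0 cl sw (par_end v)) len_gt0.
Qed.

Lemma hpt_end v : hpt (par v) (hwidth (par v)) = vertex_pt rd v.
Proof. by rewrite -(start_pt rd (par_end v)) hpt_flip subr0. Qed.

Variables (k : nat) (t : R).
Hypotheses (kN : (k < N)%N) (tt : tm k <= t < tm k.+1).
Let sh0 := shape_at rd (ltnW kN).
Local Notation phi := (pht k t).
Local Notation A := (f t).
Let tt' : tm k <= t <= tm k.+1. Proof. by case/andP: tt => -> /ltW. Qed.
Let sh : shape c A phi := stage_shape rd kN sh0 tt'.
Let phi_ge0 h : 0 <= phi h. Proof. by have [] := sh. Qed.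
Let phi_width h : phi h <= hwidth h. Proof. by have /andP[] := shape_le_width h sh. Qed.
Let w_ge0 h : 0 <= hwidth h. Proof. exact: hwidth_ge0. Qed.
Hint Resolve phi_ge0 phi_width w_ge0 : core.

Let t_ge0 : 0 <= t.
Proof. by case/andP: tt => h _; apply: le_trans h; apply: (time_ge0 rd); exact: ltnW. Qed.

Lemma t_lt_end : tm k <= t < zeta.
Proof.
case/andP: tt => -> h /=; apply: lt_le_trans h _; apply: (time_le rd); rewrite kN leqnn//.
Qed.

Definition started x : Prop := f (tm k) (hpt x 0).

Lemma started_now x : started x -> A (hpt x 0).
Proof. by apply: (flood_mono rd); case/andP: tt => -> _; rewrite (time_ge0 rd)// ltnW. Qed.

(** An arm that reaches a vertex ends the stage. *)
Lemma now_started x : A (hpt x 0) -> started x.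
Proof.
move=> /(stage_setP rd kN sh0 _ tt')[//|[h [s [ah /andP[s0 s1] E]]]].
case S: (start x) => [v|]; last by apply: (source_flooded rd) => //; exact: ltnW.
have ss : tm k <= s <= tm k.+1 by rewrite s0 (le_trans s1)//; case/andP: tt'.
have hd := pht_le_width rd kN sh0 h ss.
have hv : end_vertex (hedge h) (coord h (pht k s h)) = Some v.
  by apply: (vertex_pt_end (rd := rd)); [exact: (coord_in c0 cl cs)|rewrite -(start_pt rd S)].
have [d0|dw] := end_vertex_half c0 cl cs hd hv.
  by rewrite /started E d0; case: ah.
have : pht k s h + pht k s (flip h) < hwidth h.
  by apply: (still_active rd kN sh0) => //; rewrite s0 (le_lt_trans s1)//; case/andP: tt.
by rewrite dw ltNge lerDl (pht_ge0 rd kN sh0).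
Qed.

Lemma phi_started x : 0 < phi x -> started x.
Proof.
move=> px; apply: now_started; apply: contrapT => nA.
by have [_ _ s3 _] := sh; move: px; rewrite s3 ?ltxx.
Qed.

Lemma phi_opp x : opp x -> phi x = 0.
Proof.
move=> ox; apply/eqP; rewrite eq_le phi_ge0 andbT.
rewrite -[leRHS](opp_ph (k := k.+1) kN ox) (phS c f k x).
by apply: (pht_mono rd) => //; case/andP: tt'.
Qed.

Lemma phi_par v x : start x = Some v -> started x -> phi (par v) = hwidth (par v).
Proof.
move=> xv sx; have av := (reached_start rd (ltnW kN) xv).1 sx.
apply/eqP; rewrite eq_le phi_width /=.
have := @par_full _ _ _ _ _ rd k v; rewrite av ltnW// => /(_ isT) <-.
by rewrite -(pht_start c f k (par v)) (pht_mono rd)//; case/andP: tt.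
Qed.

Lemma node_end v x : start x = Some v -> hpt x 0 = hpt (par v) (hwidth (par v)).
Proof. by move=> xv; rewrite hpt_end (start_pt rd xv). Qed.

Lemma phi_leaf x : subhook up L x = 0 -> 0 < L x -> phi x < L x.
Proof. by apply: (leaf_unfinished maxf kN); exact: t_lt_end. Qed.

Lemma phi_le_L x : phi x <= L x.
Proof.
apply: (@le_trans _ _ (ph k.+1 x)); last by apply: (ph_le rd); rewrite kN leqnn.
by rewrite (phS c f k x); apply: (pht_mono rd) => //; case/andP: tt'.
Qed.

(** Apart from the sources, every flooded point has exactly one address, by
    [point_address] and [address_uniq]. *)
Definition address x d : Prop := 0 < d <= phi x.

Lemma address_bounds x d : address x d -> 0 <= d <= hwidth x.
Proof. by move=> /andP[d0 dp]; rewrite ltW//= (le_trans dp). Qed.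

Lemma address_end x d : address x d -> d = hwidth x -> exists v, par v = x.
Proof.
move=> /andP[d0 dp] dw; apply: contrapT => nv.
have lx v : par v <> x by move=> pv; apply: nv; exists v.
have L0 : 0 < L x by apply: lt_le_trans (phi_le_L x); exact: lt_le_trans dp.
have := phi_leaf (subhook_leaf rank_par L lx) L0; rewrite ltNge => /negP; apply.
by rewrite (le_trans (ph_le_width rd _ (leqnn N)))// -dw.
Qed.

(** Two arms in the same region do not meet before the final time: one of
    them still moves, or both are dead ends. *)
Lemma address_flip x d d' : address x d -> address (flip x) d' -> d + d' < hwidth x.
Proof.
move=> /andP[d0 dp] /andP[d'0 d'p]; apply: (@le_lt_trans _ _ (phi x + phi (flip x))).
  exact: lerD.
have [ax|nax] := pselect (active c (f (tm k)) (ph k) x).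
  exact: (still_active rd kN sh0).
have [af|naf] := pselect (active c (f (tm k)) (ph k) (flip x)).
  by have := still_active rd kN sh0 af tt; rewrite flipK addrC.
have lx v : par v <> x.
  move=> pv; have := phi_opp (opp_flip_par par_end v); rewrite pv => E.
  by move: d'p; rewrite E leNgt d'0.
have lf v : par v <> flip x.
  move=> pv; have := phi_opp (opp_flip_par par_end v); rewrite pv flipK => E.
  by move: dp; rewrite E leNgt d0.
have Lx : 0 < L x by apply: lt_le_trans (phi_le_L x); exact: lt_le_trans dp.
have Lf : 0 < L (flip x) by apply: lt_le_trans (phi_le_L _); exact: lt_le_trans d'p.
by rewrite -(ph_full rd x) ltrD// phi_leaf// (subhook_leaf rank_par).
Qed.

Lemma address_uniq x d y e : address x d -> address y e -> hpt x d = hpt y e -> x = y /\ d = e.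
Proof.
move=> ax ay E; have [dw|dw] := eqVneq d (hwidth x); last first.
  have dm : 0 < d < hwidth x.
    by have /andP[-> _] := ax; have /andP[_ ?] := address_bounds ax; rewrite lt_neqAle dw.
  have [[-> ->]//|[yx ee]] := hpt_mid_inj c0 cl cs (esym E) dm (address_bounds ay).
  by rewrite yx in ay; have := address_flip ax ay; rewrite ee addrC subrK ltxx.
have [v pv] := address_end ax dw.
have Ev : hpt y e = vertex_pt rd v by rewrite -E dw -pv hpt_end.
have yb := address_bounds ay.
have hv : end_vertex (hedge y) (coord y e) = Some v.
  by apply: (vertex_pt_end (rd := rd)); [exact: (coord_in c0 cl cs)|rewrite -Ev].
have [e0|ew] := end_vertex_half c0 cl cs yb hv; first by move: ay; rewrite /address e0 ltxx.
have [w pw] := address_end ay ew.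
have vw : w = v.
  apply: (start_pt_inj (rd := rd) (par_end w)).
  by rewrite hpt_flip subr0 pw -ew Ev.
by rewrite dw ew -pv -pw vw.
Qed.

Lemma source_address q x d : f 0 q -> address x d -> q <> hpt x d.
Proof.
move=> fq ax E; have := fq => /(reading_sources rd)[s sN sE].
have [dw|dw] := eqVneq d (hwidth x); last first.
  have dm : 0 < d < hwidth x.
    by have /andP[-> _] := ax; have /andP[_ ?] := address_bounds ax; rewrite lt_neqAle dw.
  have z0 : 0 <= (0 : R) <= hwidth s by rewrite lexx w_ge0.
  have [[_ e0]|[_ e0]] := hpt_mid_inj c0 cl cs (etrans (esym sE) E) dm z0.
    by move: dm; rewrite -e0 ltxx.
  by move: dm => /andP[_]; rewrite -subr_gt0 -e0 ltxx.
have [v pv] := address_end ax dw.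
have Ev : q = vertex_pt rd v by rewrite E dw -pv hpt_end.
have [_ _ amin] := arrivalP rd v.
have a0 : arrival rd v = 0.
  by apply/eqP; rewrite -leqn0; apply: amin => //; rewrite (time0 rd) -Ev.
have [_ + _] := parP rd v; rewrite a0 ph0 pv -dw => d0.
by move: ax; rewrite /address -d0 ltxx.
Qed.

(** A parent of width zero, at a source placed on a vertex, has no addresses;
    hence the last case. *)
Lemma node_address x : started x -> start x = None \/
  exists2 y, up x = Some y & hpt x 0 = hpt y (hwidth y) /\
    (address y (hwidth y) \/ (start y = None /\ hpt x 0 = hpt y 0)).
Proof.
move=> sx; case S: (start x) => [v|]; [right|by left].
exists (par v); first by apply/upP; exists v.
split; first exact: node_end.
have := w_ge0 (par v); rewrite le_eqVlt => /orP[/eqP w0|w0]; [right|left].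
  split; last by rewrite (node_end S) -w0.
  by case S': (start (par v)) => [w|//]; have := par_width S'; rewrite -w0 ltxx.
by rewrite /address w0 (phi_par S sx) lexx.
Qed.

Lemma point_address p : A p ->
  f 0 p \/ exists x d, address x d /\ p = hpt x d.
Proof.
have nodeP x : started x -> f 0 (hpt x 0) \/ exists y d, address y d /\ hpt x 0 = hpt y d.
  move=> sx; have [xN|[y _ [E [ay|[yN E0]]]]] := node_address sx.
  - by left; apply/(reading_sources rd); exists x.
  - by right; exists y, (hwidth y).
  - by left; apply/(reading_sources rd); exists y.
have [u [ux [eu ->]]] := gspace_ptP p.
have [h [d [<- dw <-]]] := cover c0 cl eu; rewrite -/(hpt h d).
have [_ _ _ s4] := sh; move=> /s4-/(_ dw)[[A0 dp]|[A0 dp]]; have /andP[d0 dw'] := dw.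
  move: d0; rewrite le_eqVlt => /orP[/eqP <-|d0]; first exact/nodeP/now_started.
  by right; exists h, d; split=> //; apply/andP.
have -> : hpt h d = hpt (flip h) (hwidth h - d) by rewrite hpt_flip subKr.
move: dw'; rewrite le_eqVlt => /orP[/eqP ->|dlt].
  by rewrite subrr; exact/nodeP/now_started.
by right; exists (flip h), (hwidth h - d); split=> //; rewrite /address subr_gt0 dlt.
Qed.

Lemma address_point x d : 0 <= d <= phi x -> started x -> A (hpt x d).
Proof.
move=> /andP[d0 dp] sx; have [_ _ _ s4] := sh; apply/s4; first by rewrite d0 (le_trans dp).
by left; split=> //; exact: started_now.
Qed.

(** ** Unions of arms *)

Definition arms (P : half -> Prop) : set (gspace G) :=
  [set p | exists2 x, started x /\ P x & hseg x 0 (phi x) p].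

Lemma arms_closed P : closed (arms P).
Proof. by apply: closed_finU => x _; exact: hseg_closed. Qed.

Lemma arms_sub P : arms P `<=` A.
Proof. by move=> p [x [sx _] [d dp ->]]; exact: address_point. Qed.

Lemma mem_arms (P : half -> Prop) x d : P x -> address x d -> arms P (hpt x d).
Proof.
move=> Px /andP[d0 dp]; exists x; first by split=> //; apply: phi_started; exact: lt_le_trans dp.
by exists d => //; rewrite ltW.
Qed.

Lemma mem_arms_root (P : half -> Prop) x : P x -> start x = None -> arms P (hpt x 0).
Proof.
move=> Px xN; exists x; first by split=> //; apply: (source_flooded rd) => //; exact: ltnW.
by exists 0 => //; rewrite lexx phi_ge0.
Qed.

Lemma arms_address P p : (forall x y, up x = Some y -> P x -> P y) -> arms P p ->
  (exists2 x, P x & start x = None /\ p = hpt x 0) \/ exists x d, [/\ P x, address x d & p = hpt x d].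
Proof.
move=> Pup [x [sx Px] [d /andP[d0 dp] ->]].
move: d0; rewrite le_eqVlt => /orP[/eqP <-|d0]; last by right; exists x, d; split=> //; apply/andP.
have [xN|[y xy [E [ay|[yN E0]]]]] := node_address sx.
- by left; exists x.
- by right; exists y, (hwidth y); split=> //; exact: Pup xy Px.
- by left; exists y => //; exact: Pup xy Px.
Qed.

Lemma origin_up q x y : up x = Some y -> (origin x = q) -> (origin y = q).
Proof. by move=> /desc_up/origin_desc ->. Qed.

Definition tree q := arms (fun x => origin x = q).

Lemma tree_disjoint q : tree q `&` arms (fun x => origin x <> q) = set0.
Proof.
apply/seteqP; split=> // p [].
move=> /(arms_address (@origin_up q)) H1 /arms_address H2.
have {}H2 := H2 (fun x y xy nx ny => nx (etrans (origin_desc (desc_up xy)) ny)).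
case: H1 H2 => [[x xq [xN px]]|[x [d [xq ax px]]]] [[y yq [yN py]]|[y [e [yq ay py]]]].
- by apply: yq; rewrite (origin_root yN) -py px -(origin_root xN).
- apply: (source_address _ ay (q := p)) => //; apply/(reading_sources rd); by exists x.
- apply: (source_address _ ax (q := p)) => //; apply/(reading_sources rd); by exists y.
- by have [xy _] := address_uniq ax ay (etrans (esym px) py); apply: yq; rewrite -xy.
Qed.

Lemma tree_cover q : A `<=` tree q `|` arms (fun x => origin x <> q).
Proof.
move=> p /point_address[/(reading_sources rd)[s sN ->]|[x [d [ax ->]]]].
  by have [sq|sq] := pselect (origin s = q); [left|right]; exact: mem_arms_root.
by have [sq|sq] := pselect (origin x = q); [left|right]; exact: mem_arms.
Qed.

Lemma tree_source q : f 0 q -> tree q q.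
Proof.
move=> /(reading_sources rd)[s sN ->]; apply: mem_arms_root => //; exact: origin_root.
Qed.

(** ** Connectedness *)

(** Used for a whole tree, with [W] the flooded set, and for its part on one
    side of a cut. *)
Lemma chain (W : set (gspace G)) x : started x ->
  (forall y, pdesc x y -> hseg y 0 (hwidth y) `<=` W) -> W (hpt x 0) ->
  connected_component W (origin x) (hpt x 0).
Proof.
move: {2}(half_rank (arrival rd) x) (leqnn (half_rank (arrival rd) x)) => m.
elim: m x => [|m IH] x xm sx anc Wx; have [xN|[y xy [E _]]] := node_address sx.
- by rewrite (origin_root xN); exact: connected_component_refl.
- by have := leq_trans (hrk xy) xm.
- by rewrite (origin_root xN); exact: connected_component_refl.
have xpy : pdesc x y := up_pdesc hrk xy (desc_refl up y).
have sy : started y.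
  have [v xv <-] := up_startP xy; have av := (reached_start rd (ltnW kN) xv).1 sx.
  case S: (start (par v)) => [w|]; last by apply: (source_flooded rd) => //; exact: ltnW.
  apply/(reached_start rd (ltnW kN) S); apply: leq_trans av.
  exact/ltnW/(rank_par S).
have Wseg := anc y xpy.
have hy0 : hseg y 0 (hwidth y) (hpt y 0) by exists 0 => //; rewrite lexx w_ge0.
rewrite (origin_desc (desc_up xy)); apply: (@connected_component_trans _ _ (hpt y 0)).
  apply: IH => //; [exact: leq_trans (hrk xy) xm| |exact: Wseg].
  by move=> z yz; apply: anc; apply: (up_pdesc hrk xy); case/andP: yz.
apply: (connected_component_max hy0 Wseg); first exact: hseg_connected.
by exists (hwidth y) => //; rewrite lexx w_ge0.
Qed.

Lemma anc_arm x y : started x -> pdesc x y -> started y /\ phi y = hwidth y.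
Proof.
move=> sx xy; have E := anc_full (ltnW kN) sx xy.
split; last first.
  apply/eqP; rewrite eq_le phi_width /= -E -(pht_start c f k y) (pht_mono rd)//.
  by case/andP: tt.
move: {2}(half_rank (arrival rd) x) (leqnn (half_rank (arrival rd) x)) => m.
elim: m x sx xy => [|m IH] x sx xy xm; have [z xz zy] := pdesc_up xy.
  by have := leq_trans (hrk xz) xm.
have sz : started z.
  have [v xv <-] := up_startP xz; have av := (reached_start rd (ltnW kN) xv).1 sx.
  case S: (start (par v)) => [w|]; last by apply: (source_flooded rd) => //; exact: ltnW.
  apply/(reached_start rd (ltnW kN) S); apply: leq_trans av.
  exact/ltnW/(rank_par S).
have [<-//|nzy] := eqVneq z y.
by apply: (IH z) => //; [apply/andP|exact: leq_trans (hrk xz) xm].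
Qed.

(** The arms from the other sources form a closed set disjoint from this
    tree, and [chain] connects the tree. *)
Lemma tree_component q : f 0 q -> connected_component A q = tree q.
Proof.
move=> fq; apply/seteqP; split.
  have cc : connected_component A q q.
    by apply: connected_component_refl; apply: (flood_mono rd _ fq); rewrite lexx t_ge0.
  have [||sub|sub] := connected_closed_split (@component_connected _ A q)
    (@arms_closed (fun x => origin x = q)) (@arms_closed (fun x => origin x <> q)).
  - by move=> p /connected_component_sub/(@tree_cover q).
  - apply/seteqP; split=> // p [[_ h1] h2].
    by rewrite -(tree_disjoint q); split.
  - exact: sub.
  - have : (tree q `&` arms (fun x => origin x <> q)) q by split; [exact: tree_source|exact: sub].
    by rewrite tree_disjoint.
move=> p [x [sx xq] [d dp ->]].
have ch : connected_component A (origin x) (hpt x 0).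
  apply: chain => //; last exact: started_now.
  move=> y xy _ [e ew ->]; have [sy py] := anc_arm sx xy.
  by apply: address_point => //; rewrite py.
rewrite -xq; apply: connected_component_trans ch _.
have hx0 : hseg x 0 (phi x) (hpt x 0) by exists 0 => //; rewrite lexx phi_ge0.
apply: (connected_component_max hx0); first by move=> _ [e ew ->]; exact: address_point.
  exact: hseg_connected.
by exists d.
Qed.

Lemma component_tree C : is_component A C -> exists2 q, f 0 q & C = tree q.
Proof.
move=> [p Ap ->]; have [q fq Tp] : exists2 q, f 0 q & tree q p.
  have [fp|[x [d [ax ->]]]] := point_address Ap; first by exists p => //; exact: tree_source.
  by exists (origin x); [exact: origin_source|exact: mem_arms].
exists q => //; rewrite -(tree_component fq); apply/esym/same_connected_component.
by rewrite tree_component.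
Qed.

(** ** Cutting a tree at an address *)

Section Cut.
Variables (y : half) (e : R).
Hypothesis ay : address y e.

Definition beyond : set (gspace G) := hseg y e (phi y) `|` arms (fun x => pdesc x y).
Definition before : set (gspace G) := hseg y 0 e `|` arms (fun x => ~ desc x y).

Let ye : 0 <= e /\ e <= phi y. Proof. by have /andP[/ltW ? ?] := ay. Qed.

Lemma beyond_closed : closed beyond.
Proof. by apply: closedU; [apply: hseg_closed => //; case: ye|exact: arms_closed]. Qed.

Lemma before_closed : closed before.
Proof.
apply: closedU; last exact: arms_closed.
by apply: hseg_closed => //; case: ye => _ h; exact: le_trans h _.
Qed.

Lemma cut_cover : A `<=` beyond `|` before.
Proof.
move=> p /point_address[/(reading_sources rd)[s sN ->]|[x [d [ax ->]]]].
  right; have [ds|ds] := pselect (desc s y); last by right; exact: mem_arms_root.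
  by rewrite -(desc_root sN ds); left; exists 0 => //; rewrite lexx; case: ye.
have [dx|dx] := pselect (desc x y); last by right; right; exact: mem_arms.
have [xy|xy] := eqVneq x y; last by left; right; apply: mem_arms => //; apply/andP.
have /andP[d0 dp] := ax; rewrite xy in dp *.
have [ed|de] := leP e d; [left|right]; left; exists d => //; rewrite ?ed//.
by rewrite (ltW d0) ltW.
Qed.

Lemma beyond_address p : beyond p -> exists x d,
  [/\ address x d, p = hpt x d & (x = y /\ e <= d) \/ pdesc x y].
Proof.
move=> [[d /andP[d0 dp] ->]|[x [sx xy] [d /andP[d0 dp] ->]]].
  exists y, d; split=> //; last by left.
  by rewrite /address dp (lt_le_trans _ d0)//; case/andP: ay.
move: d0; rewrite le_eqVlt => /orP[/eqP <-|d0]; last first.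
  by exists x, d; split=> //; [apply/andP|right].
have [z xz zy] := pdesc_up xy; have [xN|[z' xz' [E H]]] := node_address sx.
  by rewrite (root_up par xN) in xz.
move: xz'; rewrite xz => -[?]; subst z'.
have az : address z (hwidth z).
  case: H => // -[zN E0]; have yz := desc_root zN zy; subst z.
  have [_ yw] := anc_arm sx xy; rewrite /address yw lexx andbT -yw.
  by have /andP[h1 h2] := ay; exact: lt_le_trans h2.
exists z, (hwidth z); split=> //; have [zyE|nzy] := eqVneq z y; last by right; apply/andP.
by left; split=> //; rewrite zyE (le_trans ye.2).
Qed.

Lemma before_address p : before p -> f 0 p \/ exists x d,
  [/\ address x d, p = hpt x d & (x = y /\ d <= e) \/ ~ desc x y].
Proof.
have nodeP x : started x -> (forall z, up x = Some z -> ~ desc z y) ->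
    f 0 (hpt x 0) \/ exists z d, [/\ address z d, hpt x 0 = hpt z d & ~ desc z y].
  move=> sx nx; have [xN|[z xz [E [az|[zN E0]]]]] := node_address sx.
  - by left; apply/(reading_sources rd); exists x.
  - by right; exists z, (hwidth z); split=> //; exact: nx.
  - by left; apply/(reading_sources rd); exists z.
have fin q : f 0 q \/ (exists z d, [/\ address z d, q = hpt z d & ~ desc z y]) ->
    f 0 q \/ exists x d, [/\ address x d, q = hpt x d & (x = y /\ d <= e) \/ ~ desc x y].
  by move=> [?|[z [d [az E nz]]]]; [left|right; exists z, d; split=> //; right].
move=> [[d /andP[d0 dp] ->]|[x [sx xy] [d /andP[d0 dp] ->]]].
  move: d0; rewrite le_eqVlt => /orP[/eqP <-|d0]; last first.
    right; exists y, d; split=> //; last by left.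
    by rewrite /address d0 (le_trans dp)//; case: ye.
  apply/fin/nodeP; first by apply: phi_started; have /andP[h1 h2] := ay; exact: lt_le_trans h2.
  move=> z yz zy; by case/andP: (up_pdesc hrk yz zy) => _; rewrite eqxx.
move: d0; rewrite le_eqVlt => /orP[/eqP <-|d0]; last first.
  by right; exists x, d; split=> //; [apply/andP|right].
apply/fin/nodeP => // z xz zy; apply: xy; exact: desc_trans (desc_up xz) zy.
Qed.

Lemma cut_point : beyond `&` before `<=` [set hpt y e].
Proof.
move=> p [/beyond_address[x [d [ax px hx]]] /before_address[fp|[z [d' [az pz hz]]]]].
  by case: (source_address fp ax).
have [xz dd] := address_uniq ax az (etrans (esym px) pz); subst z d'.
case: hx => [[xy ed]|/andP[xy1 xy2]].
  case: hz => [[_ de]|nxy]; last by case: nxy; rewrite xy; exact: desc_refl.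
  by rewrite /= px xy; congr hpt; apply/eqP; rewrite eq_le de.
by case: hz => [[xy _]|nxy]; [rewrite xy eqxx in xy2|case: nxy].
Qed.

End Cut.


(** Points that a cut slightly before the address leaves on the side of the
    source. *)
Definition precedes q x d : Prop :=
  f 0 q \/ exists z d', [/\ address z d', q = hpt z d', ~ pdesc z x & z = x -> d' < d].

(** If both points lie on the same half-edge the cut is made halfway between
    them. *)
Lemma cut_between x d q : address x d -> precedes q x d -> exists e,
  [/\ address x e, beyond x e (hpt x d), before x e q, hpt x d <> hpt x e & q <> hpt x e].
Proof.
move=> ax pq.
have half_ax : address x (d / 2).
  by move: ax; rewrite /address => /andP[? ?]; rewrite divr_gt0//=; lra.
have cut e : address x e -> e < d -> beyond x e (hpt x d) /\ hpt x d <> hpt x e.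
  move=> ae ed; split; first by left; exists d => //; have /andP[_ ->] := ax; rewrite ltW.
  by move=> /(address_uniq ax ae)[_ E]; rewrite E ltxx in ed.
have d0 : 0 < d by case/andP: ax.
have hd : d / 2 < d by lra.
case: pq => [fq|[z [d' [az -> nzx zx]]]].
  exists (d / 2); have [b1 b2] := cut _ half_ax hd; split=> //; last exact: (source_address fq).
  move: fq => /(reading_sources rd)[s sN ->].
  have [ds|ds] := pselect (desc s x); last by right; exact: mem_arms_root.
  by left; rewrite -(desc_root sN ds); exists 0 => //; rewrite lexx divr_ge0// ltW.
have [zE|zE] := eqVneq z x.
  subst z; have dd := zx erefl.
  have am : address x ((d + d') / 2).
    by move: ax az; rewrite /address => /andP[? ?] /andP[? ?]; apply/andP; split; lra.
  have dm : (d + d') / 2 < d by lra.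
  have [b1 b2] := cut _ am dm; exists ((d + d') / 2); split=> //.
    by left; exists d' => //; have /andP[? _] := az; apply/andP; split; lra.
  by move=> /(address_uniq az am)[_ E]; exfalso; lra.
have [b1 b2] := cut _ half_ax hd; exists (d / 2); split=> //.
  by right; apply: mem_arms => // zx'; apply: nzx; apply/andP.
by move=> /(address_uniq az half_ax)[E _]; rewrite E eqxx in zE.
Qed.

(** Two points of the loop are separated by a cut at an address, unless both
    are sources, which lie in different components. *)
Lemma no_loop : ~ has_loop A.
Proof.
move=> [g [gc gi g01 gA]].
have i0 : 0 <= (0 : R) <= 1 by rewrite lexx ler01.
have i1 : 0 <= (2^-1 : R) <= 1 by lra.
have nq : g 0 <> g 2^-1.
  have h : 0 <= (2^-1 : R) < 1 by lra.
  have h0 : 0 <= (0 : R) < 1 by lra.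
  by move=> /(gi _ _ h0 h)/esym/eqP; rewrite invr_eq0 pnatr_eq0.
have sep x d s1 s2 : 0 <= s1 <= 1 -> 0 <= s2 <= 1 -> g s1 = hpt x d -> address x d ->
    precedes (g s2) x d -> False.
  move=> s1i s2i E ax pq; have [e [ae h1 h2 h3 h4]] := cut_between ax pq.
  apply: (loop_no_cut gc gi g01 (beyond_closed ae) (before_closed ae) _ (cut_point ae) s1i s2i).
  - by move=> s /gA/(cut_cover ae).
  - by rewrite E.
  - exact: h2.
  - by rewrite E.
  - exact: h4.
case: (point_address (gA _ i0)) => [f0|[x [d [ax Ex]]]];
  case: (point_address (gA _ i1)) => [f1|[z [d' [az Ez]]]].
- have gcon : connected (g @` `[0, 1]).
    by apply: connected_continuous_connected; [exact: segment_connected|exact: gc].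
  have [||sub|sub] := connected_closed_split gcon
      (@arms_closed (fun x => origin x = g 0)) (@arms_closed (fun x => origin x <> g 0)).
  + by move=> _ [s /= + <-]; rewrite in_itv /= => /gA/(@tree_cover (g 0)).
  + by rewrite -setIA tree_disjoint setI0.
  + have /sub /(arms_address (@origin_up (g 0))) : (g @` `[0, 1]) (g 2^-1).
      by exists 2^-1 => //=; rewrite in_itv.
    move=> [[x xo [xN E]]|[x [d [_ ax E]]]]; last exact: (source_address f1 ax E).
    by apply: nq; rewrite E -xo (origin_root xN).
  + have : (tree (g 0) `&` arms (fun x => origin x <> g 0)) (g 0).
      split; first exact: tree_source.
      by apply: sub; exists 0 => //=; rewrite in_itv.
    by rewrite tree_disjoint.
- by apply: (sep z d' 2^-1 0) => //; left.
- by apply: (sep x d 0 2^-1) => //; left.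
have [zx|zx] := pselect (pdesc z x).
  apply: (sep z d' 2^-1 0) => //; right; exists x, d; split=> //.
    move=> xz; case/andP: zx => zx /eqP; apply; case/andP: xz => xz _.
    exact: (desc_anti hrk zx xz).
  by move=> xz; case/andP: zx; rewrite xz eqxx.
have [E|E] := eqVneq z x; last first.
  apply: (sep x d 0 2^-1) => //; right; exists z, d'; split=> // E'; by rewrite E' eqxx in E.
subst z; have [lt|gt|eq] := ltgtP d d'.
- by apply: (sep x d' 2^-1 0) => //; right; exists x, d; split.
- by apply: (sep x d 0 2^-1) => //; right; exists x, d'; split.
- by apply: nq; rewrite Ex Ez eq.
Qed.


(** ** Leaves of the graph *)

Lemma start_inj x y v : hedge x = hedge y -> start x = Some v -> start y = Some v -> x = y.
Proof.
case: x y => r bx [r' b']; rewrite /start /hedge /= => ee.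
case: bx; case: b'; case: eqP => // h1; case: eqP => // h2 [<-].
- by move=> _; congr pair; apply: region_ext => //; rewrite h1 h2.
- by move=> [E]; have := src_neq_tgt (redge r); rewrite -E ee eqxx.
- by move=> [E]; have := src_neq_tgt (redge r); rewrite -E ee eqxx.
- by move=> _; congr pair; apply: region_ext => //; rewrite h1 h2 ee.
Qed.

Lemma start_incident x v : start x = Some v -> (src (hedge x) == v) || (tgt (hedge x) == v).
Proof. by rewrite /start; case: ifP => _; case: ifP => // _ [->]; rewrite eqxx ?orbT. Qed.

(** The only half-edge that starts at a leaf leads back into the region of
    the arriving one. *)
Lemma leaf_subhook v : vdegree v = 1%N -> subhook up L (par v) = 0.
Proof.
move=> /eqP/cards1P[e eE]; rewrite (subhook_children hrk) big1// => x /eqP/upP[w xw pw].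
have wv : w = v by have := par_end w; rewrite pw (par_end v) => -[].
have inc y : start y = Some v -> hedge y = e.
  by move=> /start_incident yv; apply/set1P; rewrite -eE inE.
have -> : x = flip (par v).
  by apply: (start_inj (v := v)) => //; rewrite ?(inc x) ?(inc (flip (par v)))// -?wv.
have ov := opp_flip_par par_end v.
by rewrite hookE (subhook_opp par_end rank_par L ov) (opp_ph _ ov) ?addr0.
Qed.

Lemma vertex_point_pt v p : is_vertex_point v p -> p = vertex_pt rd v.
Proof.
have l (g : edge G) := len_gt0 g.
move=> [g [[<- ->]|[<- ->]]]; apply: vertex_ptE.
- by rewrite /in_edge lexx ltW.
- by rewrite /end_vertex eqxx.
- by rewrite /in_edge lexx ltW.
- by rewrite /end_vertex eqxx gt_eqF.
Qed.

(** An arm that reached a leaf early would be a finished dead end. A source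
    placed there would have an empty hook on one side, against the balance of
    the two sides. *)
Lemma no_leaf v p : vdegree v = 1%N -> is_vertex_point v p -> ~ A p.
Proof.
move=> dv /vertex_point_pt -> Av; have b0 := leaf_subhook dv.
have [w0|wn] := eqVneq (hwidth (par v)) 0; last first.
  have sx : started (flip (par v)).
    by apply: now_started; rewrite (start_pt rd (par_end v)).
  have := phi_par (par_end v) sx.
  have wp : 0 < hwidth (par v) by rewrite lt_neqAle eq_sym wn w_ge0.
  have := phi_leaf b0; rewrite (par_L rd) => /(_ wp) + E; by rewrite E ltxx.
have pN : start (par v) = None.
  by case S: (start (par v)) => [w|//]; have := par_width S; rewrite w0 ltxx.
have a0 : hook up L (par v) = 0 by rewrite hookE b0 (par_L rd) w0 addr0.
have [x [xe xw]] : exists x, hedge x = hedge (par v) /\ 0 < hwidth x.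
  apply: contrapT => nx; have := len_gt0 (hedge (par v)).
  rewrite -(sum_width c0 cl) ltNge => /negP; apply; apply: sumr_le0 => r /eqP re.
  by rewrite leNgt; apply/negP => rw; apply: nx; exists (r, true).
wlog xN : x xe xw / start x = None.
  move=> W; case S: (start x) => [w|]; last exact: (W x).
  case S': (start (flip x)) => [w'|]; last exact: (W (flip x)).
  have n0 : n (hedge (par v)) = 0%N.
    rewrite -xe; move: S S'; case: (x) => r []; rewrite /start /hedge /=.
      by case: eqP => // -> _; case: eqP.
    by case: eqP => // <- _; case: eqP.
  have i0 : ridx (par v).1 = 0%N by apply/eqP; rewrite -leqn0 -n0 ridx_le.
  by move: pN; rewrite /start i0 n0 eqxx; case: ifP.
have ax : active c (f (tm 0)) (ph 0) x.
  split; last by rewrite !ph0 addr0.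
  by apply: (source_flooded rd).
have N0 : (0 < N)%N by exact: leq_trans kN.
have h1 := active_moves maxf N0 ax.
have Lx : 0 < L x.
  apply: (@lt_le_trans _ _ (ph 1 x)); last by apply: (ph_le rd); rewrite N0 leqnn.
  by rewrite phS phtE ph0 add0r mulr_gt0// subr_gt0 (timeS rd).
have := root_balance maxf xN pN _ xe Lx; rewrite a0 => le0; have {le0} : hook up L x <= 0.
  by apply: le0; apply/eqP => E; move: xw; rewrite E w0 ltxx.
by rewrite leNgt (lt_le_trans Lx)// hookE lerDl subhook_ge0// => y; exact: (ph_ge0 rd).
Qed.
(** ** One tree for each source *)

Lemma tree_source_uniq p q : f 0 q -> tree p q -> q = p.
Proof.
move=> fq /(arms_address (@origin_up p))[[x xo [xN E]]|[x [d [_ ax E]]]].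
  by rewrite E -xo (origin_root xN).
by case: (source_address fq ax E).
Qed.

Lemma components_sources : ([set C | is_component A C] #= f 0)%card.
Proof.
have -> : [set C | is_component A C] = tree @` f 0.
  apply/seteqP; split=> [C /component_tree[q fq ->]|_ [q fq <-]]; first by exists q.
  exists q; last by rewrite tree_component.
  by apply: (flood_mono rd _ fq); rewrite lexx t_ge0.
apply: inj_card_eq => p q; rewrite !inE => fp fq E.
by apply: (tree_source_uniq fp); rewrite -E; exact: (tree_source fp).
Qed.

(** ** The two sides of an address *)

Section Sides.
Variables (y : half) (e : R).
Hypothesis ay : address y e.

(** The side of the source when the tree is cut at the address; the other
    side is [crown]. *)
Definition trunk : set (gspace G) :=
  arms (fun x => origin x = origin y /\ ~ desc x y) `|` [set p | exists2 d, 0 <= d < e & p = hpt y d].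
Definition crown : set (gspace G) :=
  [set p | exists2 d, e < d <= phi y & p = hpt y d] `|` arms (fun x => pdesc x y).

Let yw d : 0 <= d <= phi y -> 0 <= d <= hwidth y.
Proof. by move=> /andP[-> d2]; exact: le_trans d2 _. Qed.

Let e_ge0 : 0 <= e. Proof. by case/andP: ay => /ltW. Qed.
Let e_le : e <= phi y. Proof. by case/andP: ay. Qed.
Let sy : started y.
Proof. by apply: phi_started; case/andP: ay => h; exact: lt_le_trans. Qed.

Let trunk_up x z : up x = Some z -> origin x = origin y /\ ~ desc x y -> origin z = origin y /\ ~ desc z y.
Proof.
move=> xz [xo nx]; rewrite (origin_up xz xo); split=> // zy.
by apply: nx; exact: desc_trans (desc_up xz) zy.
Qed.

Lemma trunk_cut : ~ trunk (hpt y e).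
Proof.
move=> [/(arms_address trunk_up)[[x _ [xN E]]|[x [d [[_ nxy] ax E]]]]|[d /andP[d0 de] E]].
- have fx : f 0 (hpt x 0) by apply/(reading_sources rd); exists x.
  by apply: (source_address fx ay).
- by have [xy _] := address_uniq ay ax E; apply: nxy; rewrite -xy desc_refl.
have := hpt_inj c0 cl cs (yw (introT andP (conj e_ge0 e_le))) _ E.
by rewrite d0 (le_trans (ltW de) (le_trans e_le _))// => /(_ isT) E'; rewrite E' ltxx in de.
Qed.

Lemma crown_cut : e < phi y -> ~ crown (hpt y e).
Proof.
move=> ey [[d /andP[ed dp] E]|[x [sx xy] [d /andP[d0 dp] E]]].
  have := hpt_inj c0 cl cs (yw (introT andP (conj e_ge0 e_le))) _ E.
  rewrite (le_trans e_ge0 (ltW ed)) (le_trans dp)// => /(_ isT) E'; by rewrite E' ltxx in ed.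
have : beyond y (phi y) (hpt y e) by right; exists x => //; exists d; rewrite ?d0.
have ap : address y (phi y) by rewrite /address lexx (le_lt_trans e_ge0 ey).
move=> /(beyond_address ap)[z [d' [az E' H]]].
have [yz ed] := address_uniq ay az E'; case: H => [[_ ye]|]; first by move: ey; rewrite ed ltNge ye.
by rewrite -yz => /andP[_]; rewrite eqxx.
Qed.

Lemma tree_sides : tree (origin y) `<=` trunk `|` crown `|` [set hpt y e].
Proof.
move=> p [x [sx xo] [d /andP[d0 dp] ->]].
have [xy|xy] := pselect (desc x y); last by left; left; left; exists x => //; exists d; rewrite ?d0.
have [E|E] := eqVneq x y; last first.
  by left; right; right; exists x; [split=> //; apply/andP|exists d; rewrite ?d0].
move: dp; rewrite E => dp; have [lt|gt|->] := ltgtP d e; last by right.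
- by left; left; right; exists d; rewrite ?d0.
- by left; right; left; exists d; rewrite ?gt.
Qed.

Lemma trunk_tree : trunk `<=` tree (origin y).
Proof.
move=> p [[x [sx [xo _]] px]|[d /andP[d0 de] ->]]; first by exists x.
by exists y => //; exists d => //; rewrite d0 (le_trans (ltW de)).
Qed.

Lemma crown_tree : crown `<=` tree (origin y).
Proof.
move=> p [[d /andP[ed de] ->]|[x [sx xy] px]].
  by exists y => //; exists d => //; rewrite (le_trans e_ge0 (ltW ed)).
by exists x => //; split=> //; apply: origin_desc; case/andP: xy.
Qed.

Lemma trunk_origin : trunk (origin y).
Proof.
have [yr rN] := rootP y; have [E|E] := eqVneq (root y) y.
  by right; exists 0; rewrite /origin ?E// lexx; case/andP: ay.
left; apply: mem_arms_root => //; rewrite (origin_root rN); split=> // ry.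
by move/eqP: E; apply; exact/esym/(desc_root rN ry).
Qed.

Lemma trunk_connected : connected trunk.
Proof.
have anc_trunk x : started x -> (forall z, pdesc x z -> origin z = origin y /\ ~ desc z y) ->
    forall z, pdesc x z -> hseg z 0 (hwidth z) `<=` trunk.
  by move=> sx H z xz p pz; have [sz ez] := anc_arm sx xz; left; exists z; rewrite ?ez; [split=> //; exact: H|].
suff -> : trunk = connected_component trunk (origin y) by exact: component_connected.
apply/seteqP; split; last exact: connected_component_sub.
have link x d : started x -> origin x = origin y -> (forall z, pdesc x z -> ~ desc z y) ->
    0 <= d <= hwidth x -> hseg x 0 d `<=` trunk ->
    connected_component trunk (origin y) `|` [set p | exists2 d', 0 <= d' <= d & p = hpt x d'] `<=`
    connected_component trunk (origin y).
  move=> sx xo nx /andP[d0 dw] sub; have x0 : hseg x 0 d (hpt x 0) by exists 0 => //; rewrite lexx.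
  move=> p [//|[d' d'd ->]].
  apply: connected_component_trans (_ : connected_component trunk (hpt x 0) _).
    rewrite -xo; apply: chain => //; last exact: sub.
    apply: anc_trunk => // z xz; split; last exact: nx.
    by rewrite -xo; apply/esym/origin_desc; case/andP: xz.
  apply: (connected_component_max x0 sub); first exact: hseg_connected.
  by exists d'.
move=> p [[x [sx [xo nx]] [d dd ->]]|[d /andP[d0 de] ->]].
  apply: (link x (phi x)) => //; last by right; exists d.
  - by move=> z /andP[xz _] zy; apply: nx; exact: desc_trans xz zy.
  - by rewrite phi_ge0 phi_width.
  - by move=> q qx; left; exists x.
apply: (link y d) => //; last by right; exists d => //; rewrite lexx d0.
- by move=> z /andP[yz /eqP ne] zy; apply: ne; exact: (desc_anti hrk).
- by rewrite d0 (le_trans (ltW de) (le_trans e_le _)).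
- move=> _ [d' /andP[d'0 d'd] ->]; right; exists d' => //; by rewrite d'0 (le_lt_trans d'd).
Qed.

Let chain_down (W : set (gspace G)) x : started x -> pdesc x y ->
  (forall z, pdesc x z -> pdesc z y -> hseg z 0 (hwidth z) `<=` W) -> W (hpt x 0) ->
  connected_component W (hpt y (hwidth y)) (hpt x 0).
Proof.
move: {2}(half_rank (arrival rd) x) (leqnn (half_rank (arrival rd) x)) => m.
elim: m x => [|m IH] x xm sx xy anc Wx; have [z xz zy] := pdesc_up xy.
  by have := leq_trans (hrk xz) xm.
have [v xv zv] := up_startP xz.
have E : hpt x 0 = hpt z (hwidth z) by rewrite -zv; exact: node_end.
have [zE|zE] := eqVneq z y; first by rewrite -zE -E; exact: connected_component_refl.
have pz : pdesc z y by apply/andP.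
have xpz : pdesc x z := up_pdesc hrk xz (desc_refl up z).
have [sz _] := anc_arm sx xpz; have Wseg := anc z xpz pz.
have hz0 : hseg z 0 (hwidth z) (hpt z 0) by exists 0 => //; rewrite lexx w_ge0.
apply: (@connected_component_trans _ _ (hpt z 0)).
  apply: IH => //; [exact: leq_trans (hrk xz) xm| |exact: Wseg].
  by move=> u zu uy; apply: anc => //; apply: (up_pdesc hrk xz); case/andP: zu.
apply: (connected_component_max hz0 Wseg); first exact: hseg_connected.
by rewrite E; exists (hwidth z) => //; rewrite lexx w_ge0.
Qed.

Lemma crown_connected : e < phi y -> connected crown.
Proof.
move=> ey; have b0 : crown (hpt y (phi y)) by left; exists (phi y) => //; rewrite ey lexx.
suff -> : crown = connected_component crown (hpt y (phi y)) by exact: component_connected.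
apply/seteqP; split; last exact: connected_component_sub.
move=> p [[d /andP[ed de] ->]|[x [sx xy] [d dd ->]]].
  have sub : hseg y d (phi y) `<=` crown.
    move=> _ [d' /andP[h1 h2] ->]; left; exists d' => //; by rewrite h2 (lt_le_trans ed).
  apply: (connected_component_max _ sub).
  - by exists (phi y) => //; rewrite de lexx.
  - by apply: hseg_connected => //; exact: le_trans e_ge0 (ltW ed).
  - by exists d => //; rewrite lexx.
have sub : hseg x 0 (phi x) `<=` crown by move=> q qx; right; exists x.
have x0 : hseg x 0 (phi x) (hpt x 0) by exists 0 => //; rewrite lexx phi_ge0.
apply: (@connected_component_trans _ _ (hpt x 0)); last first.
  apply: (connected_component_max x0 sub); first exact: hseg_connected.
  by exists d.
have [_ ->] := anc_arm sx xy; apply: chain_down => //; last exact: sub.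
move=> z xz zy q qz; right; have [sz ez] := anc_arm sx xz; exists z; first by split.
by rewrite ez.
Qed.

End Sides.
(** ** Lengths and centroids *)

Lemma total_length_arms (P : half -> Prop) :
  total_length (arms P) = \sum_(x | `[< P x >]) phi x.
Proof.
pose p x := if `[< P x >] then phi x else 0.
have p0 x : 0 <= p x by rewrite /p; case: ifP.
have pphi x : p x <= phi x by rewrite /p; case: ifP.
rewrite (total_length_half c0 cl cs (s := fun=> 0) (p := p)).
- by rewrite [RHS]big_mkcond /=; apply: eq_bigr => x _; rewrite subr0.
- by move=> x; rewrite /= lexx p0.
- by move=> x; have [_ w _ _] := sh; apply: le_trans (w x); exact: lerD.
- move=> x d /andP[d0 dp]; apply: mem_arms; last by rewrite /address d0 (le_trans (ltW dp)).
  by move: dp; rewrite /p; case: ifP => [/asboolP//|_]; rewrite ltNge ltW.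
- move=> q [x [_ Px] [d dd ->]]; exists x, d; split=> //.
  by rewrite /p; case: asboolP.
Qed.

(** A source placed on a vertex has an empty root half-edge, whose children
    carry the arms that leave this vertex; so [h] is a root or a child of an
    empty one. *)
Lemma first_arm x : 0 < phi x -> exists h, [/\ desc x h, forall y, pdesc h y -> L y = 0,
  hpt h 0 = origin x & 0 < hwidth h].
Proof.
move=> px; have [xr rN] := rootP x; have sx := phi_started px.
have := w_ge0 (root x); rewrite le_eqVlt => /orP[/eqP w0|w0]; last first.
  by exists (root x); split=> // y /pdesc_up[z]; rewrite root_up.
have L0 : L (root x) = 0.
  by apply/eqP; rewrite eq_le (ph_ge0 rd) ?leqnn// andbT w0 ph_le_width.
have [h xh hr] : exists2 h, desc x h & up h = Some (root x).
  have xne : x != root x.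
    by apply/eqP => E; have := lt_le_trans px (phi_width x); rewrite E -w0 ltxx.
  move: xr xne; move: (root x) => r; move: {2}(half_rank (arrival rd) x) (leqnn (half_rank (arrival rd) x)) => m.
  elim: m (x) => [|m IH] z zm zr zne; have [|u zu ur] := @pdesc_up _ up z r; try by apply/andP.
    by have := leq_trans (hrk zu) zm.
  have [E|E] := eqVneq u r; first by exists z; [exact: desc_refl|rewrite -E].
  have [h uh hr] := IH u (leq_trans (hrk zu) zm) ur E.
  by exists h => //; exact: desc_trans (desc_up zu) uh.
have [v hv pv] := up_startP hr.
exists h; split=> //.
- move=> y /pdesc_up[z]; rewrite hr => -[<-] ry.
  by rewrite (desc_root rN ry).
- by rewrite (node_end hv) pv -w0.
have [<-//|ne] := eqVneq x h; first exact: lt_le_trans px (phi_width x).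
have /pdesc_up[z' _ _] : pdesc x h by apply/andP.
have [z hz xz] : exists2 z, up z = Some h & desc x z.
  move: xh ne; move: {2}(half_rank (arrival rd) x) (leqnn (half_rank (arrival rd) x)) => m.
  elim: m (x) => [|m IH] y ym yh yne; have [|u yu uh] := @pdesc_up _ up y h; try by apply/andP.
    by have := leq_trans (hrk yu) ym.
  have [E|E] := eqVneq u h; first by exists y; [rewrite -E|exact: desc_refl].
  have [w wh uw] := IH u (leq_trans (hrk yu) ym) uh E.
  by exists w => //; exact: desc_trans (desc_up yu) uw.
have [w _ pw] := up_startP hz.
by rewrite -pw; apply: (par_width (w := v)); rewrite pw.
Qed.

(** This is assumed in terms of [f] alone because it is proved for each arm in
    a reading of its own, with the source placed on the edge of this arm. *)
Hypothesis balanced : forall j : 'I_(narms f 1),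
  2 * speed j * t <= total_length (connected_component A (anchor (farm j))).

Let N0 : (0 < N)%N. Proof. exact: leq_trans kN. Qed.
Let zeta_gt0 : 0 < zeta. Proof. by rewrite -(time0 rd) (time_lt rd)// N0 leqnn. Qed.

Lemma first_arm_half h q : f 0 q -> (forall y, pdesc h y -> L y = 0) -> hpt h 0 = q -> 0 < hwidth h ->
  2 * (\sum_(x | desc x h) phi x) <= total_length (tree q).
Proof.
move=> fq anc hq hw; have a0 : active c (f (tm 0)) (ph 0) h.
  by split; rewrite ?(time0 rd) ?hq// !ph0 addr0.
have h1 := active_moves maxf N0 a0.
have [j jh] := active_arm rd N0 (shape_at rd (leq0n _)) a0.
have aj : along c h (farm j) by rewrite jh; apply: (active_along (shape_at rd (leq0n _))).
have hsj := hs_arm rd N0 (shape_at rd (leq0n _)) aj.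
have := hs_speed maxf N0 h1; rewrite ph0 (time0 rd) !subr0 -hookE hsj => E.
have := branch_progress maxf t kN anc; rewrite -E => E2.
have -> : \sum_(x | desc x h) phi x = speed j * t.
  by apply: (mulIf (lt0r_neq0 zeta_gt0)); rewrite E2; ring.
rewrite mulrA; have := balanced j; rewrite jh /anchor /arm_of /= ph0 -/(hpt h 0) hq.
by rewrite tree_component.
Qed.

(** A connected set that avoids the source stays in the subtree of one arm
    leaving this source. *)
Lemma centroid_source q : f 0 q -> is_centroid (tree q) q.
Proof.
move=> fq; split; first exact: tree_source.
have T0 : 0 <= total_length (tree q).
  by rewrite total_length_arms; apply: sumr_ge0.
move=> C Csub Ccon; have [[p Cp]|nC] := pselect (exists p, C p); last first.
  have -> : C = arms (fun=> False).
    by apply/seteqP; split=> [p Cp|p [x [_ []]]]; case: nC; exists p.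
  rewrite total_length_arms big1 ?divr_ge0// => x /asboolP[].
have [Tp pq] := Csub p Cp.
have [x [d [ax xo px]]] : exists x d, [/\ address x d, origin x = q & p = hpt x d].
  have := Tp => /(arms_address (@origin_up q))[[x xo [xN E]]|[x [d [xo ax E]]]]; last by exists x, d.
  by case: pq; rewrite /= E -xo (origin_root xN).
have [h [xh anc hq hw]] : exists h, [/\ desc x h, forall y, pdesc h y -> L y = 0,
    hpt h 0 = origin x & 0 < hwidth h].
  by apply: first_arm; case/andP: ax => d0; exact: lt_le_trans.
have Dq p' : arms (fun y => desc y h) p' -> p' <> q ->
    exists y e, [/\ address y e, desc y h & p' = hpt y e].
  move=> [y [sy yh] [e /andP[e0 ep] E]] nq.
  move: e0; rewrite le_eqVlt => /orP[/eqP e0|e0]; last by exists y, e; split=> //; apply/andP.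
  have [yE|yE] := eqVneq y h; first by case: nq; rewrite E -e0 yE hq.
  have /pdesc_up[u yu uh] : pdesc y h by apply/andP.
  have [yN|[u' yu' [E2 H]]] := node_address sy; first by rewrite (root_up par yN) in yu.
  move: yu'; rewrite yu => -[?]; subst u'.
  case: H => [au|[uN E3]]; first by exists u, (hwidth u); split=> //; rewrite E -e0.
  by case: nq; rewrite E -e0 E3 -xo -hq (desc_root uN uh).
have [||CD|CE] := connected_closed_split Ccon
    (@arms_closed (fun y => desc y h)) (@arms_closed (fun y => ~ desc y h)).
- move=> z /Csub[/(@arms_sub _)/point_address[/(reading_sources rd)[s sN ->]|[y [e [ay ->]]]] _].
    by have [sq|sq] := pselect (desc s h); [left|right]; exact: mem_arms_root.
  by have [sq|sq] := pselect (desc y h); [left|right]; exact: mem_arms.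
- apply/seteqP; split=> // z [[/Csub[_ zq] /Dq H]].
  have [y [e [ay yh zE]]] := H zq.
  move=> /arms_address[].
  + by move=> u w uw nu wh; apply: nu; exact: desc_trans (desc_up uw) wh.
  + move=> [u _ [uN E]]; apply: (source_address _ ay zE).
    by apply/(reading_sources rd); exists u.
  + move=> [u [e' [nu au E]]]; have [yu _] := address_uniq ay au (etrans (esym zE) E).
    by apply: nu; rewrite -yu.
- apply: le_trans (total_length_le CD) _; rewrite ler_pdivlMr// mulrC.
  rewrite total_length_arms (eq_bigl (fun y => desc y h)); last by move=> y; apply: asboolb.
  by apply: (first_arm_half fq) => //; rewrite hq.
- exfalso; move: (CE p Cp) => /arms_address[].
  + by move=> u w uw nu wh; apply: nu; exact: desc_trans (desc_up uw) wh.
  + move=> [u _ [uN E]]; apply: (source_address _ ax px).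
    by apply/(reading_sources rd); exists u.
  + move=> [u [e' [nu au E]]]; have [yu _] := address_uniq ax au (etrans (esym px) E).
    by apply: nu; rewrite -yu.
Qed.

(** The trunk of any other point contains the source side of the tree, at
    least half of it, and a piece of positive length besides. *)
Lemma centroid_uniq q (v : gspace G) : f 0 q -> is_centroid (tree q) v -> v = q.
Proof.
move=> fq [Tv cent]; have [//|vq] := pselect (v = q); exfalso.
have [x [d [ax xo vx]]] : exists x d, [/\ address x d, origin x = q & v = hpt x d].
  have := Tv => /(arms_address (@origin_up q))[[x xo [xN E]]|[x [d [xo ax E]]]]; last by exists x, d.
  by case: vq; rewrite /= E -xo (origin_root xN).
have /andP[d0 dp] := ax.
have [h [xh anc hq hw]] := first_arm (lt_le_trans d0 dp).
have half_h : 2 * (\sum_(y | desc y x) phi y) <= total_length (tree q).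
  apply: le_trans (first_arm_half fq anc (etrans hq xo) hw); rewrite ler_pM2l//.
  rewrite [leRHS]big_mkcond [leLHS]big_mkcond /=; apply: ler_sum => y _.
  case: ifP => [yx|_]; last by case: ifP.
  by rewrite (desc_trans yx xh).
have := cent (trunk x d); rewrite -{1}xo vx => /(_ _ (trunk_connected ax))/wrap[].
  by move=> p tp; split; [exact: (trunk_tree ax)|move=> /= E; apply: (trunk_cut ax); rewrite -E].
pose p y := if y == x then d else if `[< origin y = q /\ ~ desc y x >] then phi y else 0.
have p0 y : 0 <= p y by rewrite /p; case: ifP => _; [exact: ltW|case: ifP].
have pphi y : p y <= phi y by rewrite /p; case: eqP => [->//|_]; case: ifP.
rewrite (total_length_half c0 cl cs (s := fun=> 0) (p := p)); last 4 first.
- by move=> y; rewrite /= lexx p0.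
- by move=> y; have [_ w _ _] := sh; apply: le_trans (w y); exact: lerD.
- move=> y e; rewrite /p; case: eqP => [->|_] /andP[e0 ep]; first by right; exists e; rewrite ?(ltW e0).
  move: ep; case: asboolP => [[yo ny]|_] ep; last by move: ep; rewrite ltNge ltW.
  by left; apply: mem_arms; [rewrite xo|apply/andP; split=> //; exact: ltW].
- move=> p' [[y [_ [yo ny]] [e ee ->]]|[e /andP[e0 ed] ->]].
    exists y, e; split=> //; rewrite /p; case: eqP => [E|_]; first by case: ny; rewrite E desc_refl.
    by case: asboolP => //; rewrite -xo; case.
  by exists x, e; split=> //; rewrite /p eqxx e0 ltW.
rewrite (eq_bigr (fun y => (if `[< origin y = q >] then phi y else 0)
    - (if desc y x then phi y else 0) + (if y == x then d else 0))); last first.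
  move=> y _; rewrite subr0 /p; case: eqP => [->|yx].
    by rewrite desc_refl; case: asboolP => // _; rewrite subrr add0r.
  rewrite addr0; have [yd|yd] := boolP (desc y x).
    case: asboolP => [[_ []]//|_]; case: asboolP => [_|[]]; first by rewrite subrr.
    by rewrite -xo; exact: origin_desc.
  rewrite subr0; case: asboolP => [[? _]|H]; case: asboolP => // yo.
  by case: H; split=> //; apply/negP.
rewrite big_split sumrB /= -!big_mkcond big_pred1_eq -total_length_arms -/(tree q).
move: half_h; move: (total_length _) (\sum_(y | desc y x) _) => T S hT.
lra.
Qed.

Lemma centroids : f 0 = [set v | exists2 T, is_component A T & is_centroid T v].
Proof.
apply/seteqP; split=> [q fq|v [T /component_tree[q fq ->] /(centroid_uniq fq) ->]//].
exists (tree q); last exact: centroid_source.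
exists q; last by rewrite tree_component.
by apply: (flood_mono rd _ fq); rewrite lexx t_ge0.
Qed.

End Snapshot.

(** * Arms from one stage to the next *)

Section Arms.
Context {R : realType} {G : metricGraph R}.
Variables (n : edge G -> nat) (c : edge G -> nat -> R) (f : flooding_data G).
Hypothesis rd : reading n c f.
Let c0 := reading0 rd.
Let cl := reading_last rd.
Let cs := @reading_step _ _ _ _ _ rd.
Local Notation half := (half n).
Local Notation hpt := (hpt c).
Local Notation hwidth := (hwidth c).
Implicit Types (h x y z : half) (v w : vertex G) (d e t : R) (p q : gspace G) (k : nat).
Local Notation N := (nstages f).
Local Notation tm := (time f).
Local Notation zeta := (tm N).
Local Notation hs := (@hs R G n c f).
Local Notation ph := (@ph R G n c f).
Local Notation pht := (@pht R G n c f).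
Local Notation par := (par rd).
Local Notation up := (up par).
Local Notation L := (ph N).
Local Notation a := (hook up L).
Local Notation b := (subhook up L).
Local Notation pdesc := (pdesc up).
Local Notation desc := (desc up).
Hypothesis maxf : forall L', generic (hedge (n:=n)) (@len R G) (opp par) L' ->
  xln zeta - hook_cost up L' <= entropy f.
Local Notation act k := (active c (f (tm k)) (ph k)).
Let rank_par := @arrival_par _ _ _ _ _ rd.
Let hrk := half_rank_up rank_par.
Let shk k (kN : (k < N)%N) : shape c (f (tm k)) (ph k) := shape_at rd (ltnW kN).
Let w_ge0 h : 0 <= hwidth h. Proof. exact: hwidth_ge0. Qed.

Lemma sister h : start h = None -> exists h',
  [/\ start h' = None, hedge h' = hedge h, hpt h' 0 = hpt h 0 & h' != h].
Proof.
case: h => r []; rewrite /start /=; case: eqP => // rn _.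
  have [r' [re ri]] := @region_at R G n (redge r) (ridx r).-1 (leq_trans (leq_pred _) (ridx_le r)).
  have r1 : (ridx r).-1.+1 = ridx r by rewrite prednK// lt0n; exact/eqP.
  exists (r', false); split=> //=; last by apply/eqP => -[].
    rewrite ri /hedge /= re; case: eqP => // E.
    by have := ridx_le r; rewrite -E -r1 ltnn.
  by rewrite /hpt /coord /hedge /= /rhi /rlo ri re r1 subr0 addr0.
have rlt : (ridx r < n (redge r))%N by rewrite ltn_neqAle ridx_le andbT; exact/eqP.
have [r' [re ri]] := @region_at R G n (redge r) (ridx r).+1 rlt.
exists (r', true); split=> //=; last by apply/eqP => -[].
  by rewrite ri.
by rewrite /hpt /coord /hedge /= /rhi /rlo ri re subr0 addr0.
Qed.

(** An arm that starts at an end of its edge, at the place of a source, would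
    have no room in front of it. *)
Lemma root_start (r h : half) : start r = None -> hedge r = hedge h -> coord c r 0 = coord c h 0 ->
  0 < hwidth h -> start h = None.
Proof.
move=> /(start_None c)[g [i [/andP[i1 ig] rg rc]]] rh E w0.
have gh : g = hedge h by rewrite -rg.
rewrite rc gh in E; rewrite gh in ig; clear gh rg rc rh.
case: h w0 E ig => -[{}g z] [] /=; rewrite /start /hwidth /width /coord /rlo /rhi /hedge /= => w0 E ig.
  case: eqP => // z0; move: w0 E; rewrite z0 c0 subr0 addr0 => w0 E.
  by have := c_mono cs (e := g) (i := 1) (j := i); rewrite E i1 leqW// => /(_ isT); rewrite leNgt w0.
case: eqP => // z0; move: w0 E; rewrite z0 cl subr0 subr_gt0 => w0 E.
by have := c_mono cs (e := g) (i := i) (j := n g); rewrite E ig leqnSn => /(_ isT); rewrite leNgt w0.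
Qed.

(** The two arms leaving a source inside an edge compete for the position of
    this source, so each of them floods at most half of what both reach. *)
Lemma root_arm_balance k t (kN : (k < N)%N) (j : 'I_(narms f 1)) h :
  tm k <= t < tm k.+1 -> along c h (farm j) -> start h = None ->
  2 * speed j * t <= total_length (connected_component (f t) (anchor (farm j))).
Proof.
move=> tt jh hN; have N0 : (0 < N)%N by exact: leq_trans kN.
have z0 : 0 < zeta by rewrite -(time0 rd) (time_lt rd)// N0 leqnn.
have t0 : 0 <= t by case/andP: tt => h1 _; apply: le_trans h1; apply: (time_ge0 rd); exact: ltnW.
have [ah jE] := along_active rd N0 (shk N0) jh.
have h1 := active_moves maxf N0 ah.
have hsj := hs_arm rd N0 (shk N0) jh.
have := hs_speed maxf N0 h1; rewrite ph0 (time0 rd) !subr0 -hookE hsj => aE.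
have Lh : 0 < L h.
  apply: (@lt_le_trans _ _ (ph 1 h)); last by apply: (ph_le rd); rewrite N0 leqnn.
  by rewrite phS phtE ph0 add0r mulr_gt0// subr_gt0 (timeS rd).
have [h' [h'N he hp hne]] := sister hN.
have hh' : h != h' by rewrite eq_sym.
have ahh := root_balance maxf hN h'N hh' (esym he) Lh.
have -> : anchor (farm j) = hpt h 0 by rewrite jE ph0.
have fq : f 0 (hpt h 0) by apply/(reading_sources rd); exists h.
rewrite (tree_component maxf kN tt fq) (total_length_arms rd kN tt).
have anc x : start x = None -> forall y, pdesc x y -> L y = 0.
  by move=> xN y /pdesc_up[z]; rewrite root_up.
have bp := branch_progress maxf t kN (anc _ hN).
have bp' := branch_progress maxf t kN (anc _ h'N).
have le_sum : \sum_(x | desc x h) pht k t x + \sum_(x | desc x h') pht k t x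
    <= \sum_(x | `[< origin rd x = hpt h 0 >]) pht k t x.
  rewrite (big_mkcond (fun x => desc x h)) (big_mkcond (fun x => desc x h')) -big_split /= [leRHS]big_mkcond /=.
  apply: ler_sum => x _; have px : 0 <= pht k t x.
    by apply: (pht_ge0 rd kN (shk kN)); case/andP: tt.
  have [xh|nxh] := boolP (desc x h).
    have nxh' : desc x h' = false.
      apply/negP => xh'; move: hne.
      by rewrite -(root_desc hN xh) -(root_desc h'N xh') eqxx.
    rewrite nxh' addr0; case: asboolP => // -[].
    by rewrite (origin_desc xh) origin_root.
  rewrite add0r; have [xh'|_] := boolP (desc x h'); last by case: ifP.
  by case: asboolP => // -[]; rewrite (origin_desc xh') origin_root.
apply: le_trans le_sum; rewrite -(ler_pM2r z0) [leRHS]mulrDl bp bp'.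
have -> : 2 * speed j * t * zeta = a h * t + a h * t by rewrite -aE; ring.
by rewrite lerD2l ler_wpM2r.
Qed.

Lemma narms_active k : (k < N)%N -> narms f k.+1 = #|[set h | `[< act k h >]]%SET|.
Proof.
move=> kN; have ex j := arm_active rd kN (shk kN) j.
pose g j := s2val (cid2 (ex j)).
have gP j : act k (g j) /\ farm j = arm_of c (g j) (ph k (g j)).
  by rewrite /g; case: cid2.
have [_ [finj _] _ _ _] := flood_stage rd kN.
have ginj : injective g.
  by move=> i j E; apply: finj; have [_ ->] := gP i; have [_ ->] := gP j; rewrite E.
rewrite -[LHS]card_ord -cardsT -(card_imset _ ginj); apply: eq_card => h; rewrite inE.
apply/imsetP/asboolP => [[j _ ->]|ah]; first by case: (gP j).
have [j jE] := active_arm rd kN (shk kN) ah; exists j => //.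
have [aj jE'] := gP j.
by apply: (arm_of_active_inj cs (shk kN)) => //; rewrite -jE.
Qed.

(** An arm can only stop at a vertex with something left to flood behind it,
    since two arms do not meet and dead ends are not exhausted before the
    final time. *)
Lemma next_arm k h : (k.+1 < N)%N -> act k h ->
  exists h', act k.+1 h' /\ (h' = h \/ up h' = Some h /\ ~ act k h').
Proof.
move=> kN ah; have kN' : (k < N)%N by exact: ltnW.
have [fh _] := ah; have hs0 := active_moves maxf kN' ah.
have phk h' : 0 <= ph k.+1 h' by apply: (ph_ge0 rd); exact: ltnW.
have fh1 : f (tm k.+1) (hpt h 0).
  by apply: (flood_mono rd _ fh); rewrite (time_ge0 rd) ?(ltnW kN')//= ltW// (timeS rd).
have [lt|] := ltP (ph k.+1 h + ph k.+1 (flip h)) (hwidth h); first by exists h; split; [split|left].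
move=> ge; have le1 h' : ph k.+1 h' <= L h' by apply: (ph_le rd); rewrite leqnn (ltnW kN).
have Eh : ph k.+1 h = L h.
  apply/eqP; rewrite eq_le le1 /=; have := le1 (flip h); have := ph_full rd h; lra.
have Lh : 0 < L h.
  rewrite -Eh phS phtE ltr_wpDl ?(ph_ge0 rd) ?(ltnW kN')// mulr_gt0// subr_gt0.
  exact: (timeS rd).
have b0 : b h <> 0.
  move=> b0; have tt : tm k.+1 <= tm k.+1 < zeta by rewrite lexx (time_lt rd)// kN leqnn.
  by have := leaf_unfinished maxf kN tt b0 Lh; rewrite pht_start Eh ltxx.
have [x xh ax] : exists2 x, up x = Some h & a x <> 0.
  apply: contrapT => nx; apply: b0; rewrite (subhook_children hrk) big1// => x /eqP xh.
  by apply: contrapT => ax; apply: nx; exists x.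
have [v xv pv] := up_startP xh.
have Lw : L h = hwidth h by rewrite -pv (par_L rd).
have E : hpt x 0 = hpt h (hwidth h).
  by rewrite (start_pt rd xv) -pv hpt_end.
have Lx : 0 < L x.
  rewrite lt_neqAle eq_sym (ph_ge0 rd)// andbT; apply/eqP => Lx.
  have [[w pw]|nw] := pselect (exists w, par w = x).
    have := @par_width _ _ _ _ _ rd w v; rewrite pw xv => /(_ erefl).
    by have := par_L rd w; rewrite pw Lx => <-; rewrite ltxx.
  apply: ax; rewrite hookE (subhook_leaf rank_par) ?addr0// => w pw.
  by apply: nw; exists w.
have nfx : ~ f (tm k) (hpt x 0).
  move=> fx; have xph : pdesc x h := up_pdesc hrk xh (desc_refl up h).
  have := anc_full (ltnW kN') fx xph; rewrite -Lw -Eh phS phtE => Ek.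
  have : 0 < hs k.+1 h * (tm k.+1 - tm k) by rewrite mulr_gt0// subr_gt0 (timeS rd).
  move: Ek; lra.
have px : ph k.+1 x = 0.
  apply/eqP; rewrite eq_le phk andbT leNgt; apply/negP => p0.
  by apply: nfx; exact: (ph_pos_start rd kN').
exists x; split; last by right; split=> // -[].
split; last first.
  by rewrite px add0r; have := ph_full rd x; have := le1 (flip x); lra.
have [_ _ _ s4] := shape_at rd (ltnW kN).
rewrite E; apply/s4; first by rewrite w_ge0 lexx.
by left; split=> //; rewrite Eh Lw.
Qed.

Lemma narms_mono k : (k.+1 < N)%N -> (narms f k.+1 <= narms f k.+2)%N.
Proof.
move=> kN; rewrite (narms_active (ltnW kN)) (narms_active kN).
pose g h := if pselect (act k h) is left ah then projT1 (cid (next_arm kN ah)) else h.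
have gP h : act k h -> act k.+1 (g h) /\ (g h = h \/ up (g h) = Some h /\ ~ act k (g h)).
  by rewrite /g => ah; case: pselect => // ah'; case: cid.
pose S : {set half} := [set h | `[< act k h >]]%SET.
have ginj : {in S &, injective g}.
  move=> x y; rewrite !inE => /asboolP/asboolP ax /asboolP/asboolP ay E.
  have [_ [xE|[xu nx]]] := gP x ax; have [_ [yE|[yu ny]]] := gP y ay.
  - by rewrite -xE -yE.
  - by case: ny; rewrite -E xE.
  - by case: nx; rewrite E yE.
  - by move: xu; rewrite E yu => -[].
rewrite -/S -(card_in_imset ginj); apply: subset_leq_card; apply/fintype.subsetP => _ /imsetP[x + ->].
by rewrite !inE => /asboolP/asboolP ax; apply/asboolP/asboolP; case: (gP _ ax).
Qed.

(** An arm that keeps its anchor has been at rest during a stage. *)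
Lemma no_dormant_arm : ~ has_dormant_arm f.
Proof.
move=> [[|[|k]]] [i [j [/= kN]]]; [by []|by []|].
rewrite /= in i j *; have kN' : (k < N)%N by exact: ltnW.
have [h ai iE] := arm_active rd kN' (shk kN') i.
have [h' aj jE] := arm_active rd kN (shk kN) j.
have hi := active_along (shk kN') ai; have hj := active_along (shk kN) aj.
rewrite -iE in hi; rewrite -jE in hj.
have [-> _] := tip_along rd kN (shk kN) (tm k.+1) hj.
have [-> _] := tip_along rd kN' (shk kN') (tm k) hi.
rewrite !pht_start => E _.
have move1 x : act k x -> ph k x < ph k.+1 x.
  move=> ax; rewrite phS phtE ltrDl mulr_gt0 ?(active_moves maxf kN' ax)// subr_gt0.
  exact: (timeS rd).
have b1 := active_lt (shk kN') ai; have b2 := active_lt (shk kN) aj.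
have [sh1 sh2 _ _] := shape_at rd (ltnW kN).
have b1' : 0 <= ph k h <= hwidth h by case/andP: b1 => -> /ltW.
have b2' : 0 <= ph k.+1 h' <= hwidth h' by case/andP: b2 => -> /ltW.
have mi := move1 h ai; have s2h := sh2 h.
have [d0|d0] := eqVneq (ph k h) 0; last first.
  have dm : 0 < ph k h < hwidth h by case/andP: b1 => p0 ->; rewrite lt_neqAle eq_sym d0 p0.
  have [[hE pE]|[hE pE]] := hpt_mid_inj c0 cl cs E dm b2'.
    by move: mi; rewrite -pE hE ltxx.
  by move: mi s2h; rewrite -hE pE; lra.
have [e0|e0] := eqVneq (ph k.+1 h') 0; last first.
  have dm : 0 < ph k.+1 h' < hwidth h' by case/andP: b2 => p0 ->; rewrite lt_neqAle eq_sym e0 p0.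
  have [[hE pE]|[hE pE]] := hpt_mid_inj c0 cl cs (esym E) dm b1'.
    by move: e0; rewrite -hE; move: b2; rewrite -hE; move: mi; rewrite pE hE ltxx.
  by move: b2; rewrite -hwidth_flip -hE; move: pE; rewrite d0; lra.
have ah' : act k h'.
  have [fh _] := ai; split; first by move: E; rewrite d0 e0 => ->.
  have [_ lt] := aj; apply: le_lt_trans lt; apply: lerD; apply: (ph_le rd); rewrite leqnSn ltnW//.
by have := move1 h' ah'; rewrite e0 ltNge (ph_ge0 rd)// ltnW.
Qed.

End Arms.

(** * The part of the graph flooded through an arm *)

Lemma connected_between (T : topologicalType) (A B : set T) :
  connected A -> A `<=` B -> B `<=` closure A -> connected B.
Proof.
move=> cA AB BA U [z Uz] [C1 oC1 C1E] [C2 cC2 C2E].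
have AC : A `<=` C2.
  suff <- : A `&` C2 = A by move=> p [].
  apply: cA; last by exists C2.
    have [Bz C1z] : (B `&` C1) z by rewrite -C1E.
    have [p [Ap C1p]] := BA z Bz C1 (open_nbhs_nbhs (conj oC1 C1z)).
    have : (B `&` C1) p by split=> //; exact: AB.
    by rewrite -C1E C2E => -[_ C2p]; exists p.
  exists C1 => //; apply/seteqP; split=> p [Ap Cp]; split=> //.
    by have : (B `&` C2) p; [split=> //; exact: AB|rewrite -C2E C1E => -[]].
  by have : (B `&` C1) p; [split=> //; exact: AB|rewrite -C1E C2E => -[]].
rewrite C2E; apply/seteqP; split=> [p []//|p Bp]; split=> //.
by rewrite (iffLR (closure_id C2) cC2); exact: closureS AC _ (BA p Bp).
Qed.

(** Limit points of [V] belong to the component of [y], so a component that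
    misses [y] consists of limit points of [U]. *)
Lemma component_side (T : topologicalType) (U V X C : set T) (v y : T) :
  connected U -> connected V -> V y -> closed [set v] ->
  U `<=` X `\ v -> V `<=` X `\ v -> X `<=` closure (U `|` V `|` [set v]) ->
  (exists2 p, (X `\ v) p & C = connected_component (X `\ v) p) -> ~ C y ->
  U `<=` C /\ C `<=` closure U.
Proof.
move=> cU cV Vy cv UX VX Xcl [p0 Xp0 CE] nCy.
have C0 : C p0 by rewrite CE; exact: connected_component_refl.
have CX : C `<=` X `\ v by rewrite CE; exact: connected_component_sub.
have stick W p : connected W -> W `<=` X `\ v -> C p -> closure W p -> W `<=` C.
  move=> cW WX Cp Wp q Wq.
  have Cpp : C = connected_component (X `\ v) p.
    by rewrite CE; apply: same_connected_component; rewrite -CE.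
  rewrite Cpp; apply: (connected_component_max (B := W `|` [set p])); [by right| | |by left].
    by move=> r [/WX//|->]; exact: CX.
  apply: (connected_between cW); first by move=> r; left.
  by move=> r [/subset_closure//|->].
have nV p : C p -> ~ closure V p by move=> Cp /(stick V p cV VX Cp)/(_ y Vy).
have CU : C `<=` closure U.
  move=> p Cp; have [Xp pv] := CX p Cp.
  have : (closure U `|` closure V `|` [set v]) p.
    have cl3 : closed (closure U `|` closure V `|` [set v]).
      by apply: closedU => //; apply: closedU; exact: closed_closure.
    rewrite (iffLR (closure_id _) cl3); apply: closureS (Xcl p Xp).
    by move=> q [[/subset_closure|/subset_closure]|]; [left; left|left; right|right].
  by move=> [[//|/(nV p Cp)]|/pv].
by split=> //; apply: (stick U p0 cU UX C0); exact: CU.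
Qed.

Section Branch.
Context {R : realType} {G : metricGraph R}.
Variables (n : edge G -> nat) (c : edge G -> nat -> R) (f : flooding_data G).
Hypothesis rd : reading n c f.
Let c0 := reading0 rd.
Let cl := reading_last rd.
Let cs := @reading_step _ _ _ _ _ rd.
Local Notation half := (half n).
Local Notation hpt := (hpt c).
Local Notation hwidth := (hwidth c).
Local Notation hseg := (hseg c).
Implicit Types (x z : half) (d e s : R) (p q : gspace G).
Local Notation N := (nstages f).
Local Notation tm := (time f).
Local Notation zeta := (tm N).
Local Notation hs := (@hs R G n c f).
Local Notation ph := (@ph R G n c f).
Local Notation pht := (@pht R G n c f).
Local Notation par := (par rd).
Local Notation up := (up par).
Local Notation L := (ph N).
Local Notation a := (hook up L).
Local Notation b := (subhook up L).
Local Notation pdesc := (pdesc up).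
Local Notation desc := (desc up).
Hypothesis maxf : forall L', generic (hedge (n:=n)) (@len R G) (opp par) L' ->
  xln zeta - hook_cost up L' <= entropy f.
Let w_ge0 x : 0 <= hwidth x. Proof. exact: hwidth_ge0. Qed.
Let L_ge0 x : 0 <= L x. Proof. exact: (ph_ge0 rd). Qed.
Let L_width x : L x <= hwidth x. Proof. exact: (ph_le_width rd). Qed.
Hint Resolve w_ge0 L_ge0 L_width : core.

Variables (k : nat) (t : R) (h : half) (j : 'I_(narms f k.+1)).
Hypotheses (kN : (k < N)%N) (tt : tm k < t < tm k.+1) (jh : along c h (farm j)).
Let shk : shape c (f (tm k)) (ph k) := shape_at rd (ltnW kN).
Local Notation m := N.-1.
Let mN : (m < N)%N. Proof. by rewrite prednK// (leq_trans _ kN). Qed.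
Let mS : m.+1 = N. Proof. by rewrite prednK// (leq_trans _ kN). Qed.

Let phi0 := pht k t h.
Let v := hpt h phi0.

Let hs0 : 0 < hs k.+1 h.
Proof. by apply: (active_moves maxf kN); have [] := along_active rd kN shk jh. Qed.

Let t_ltS : tm k < t /\ t < tm k.+1. Proof. by case/andP: tt. Qed.

Let phi0_gt0 : 0 < phi0.
Proof.
rewrite /phi0 phtE ltr_wpDl ?(ph_ge0 rd) 1?ltnW// mulr_gt0// subr_gt0.
by case: t_ltS.
Qed.

Let phi0_ltS : phi0 < ph k.+1 h.
Proof. by rewrite phS !phtE ltrD2l ltr_pM2l// ltrD2r; case: t_ltS. Qed.

Let phi0_L : phi0 < L h.
Proof. by apply: lt_le_trans phi0_ltS _; apply: (ph_le rd); rewrite kN leqnn. Qed.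

Let phi0_w : 0 < phi0 < hwidth h.
Proof. by rewrite phi0_gt0 (lt_le_trans phi0_L). Qed.

(* A time after [t], within the last stage. *)
Let t1 := (Num.max t (tm m) + zeta) / 2.

Let t_zeta : t < zeta.
Proof. by have [_ h1] := t_ltS; apply: lt_le_trans h1 _; apply: (time_le rd); rewrite kN leqnn. Qed.

Let t1P : [/\ t < t1, tm m <= t1 & t1 < zeta].
Proof.
have mz : tm m < zeta by apply: (time_lt rd); rewrite mN leqnn.
have mx : Num.max t (tm m) < zeta by rewrite gt_max t_zeta mz.
have tx : t <= Num.max t (tm m) by rewrite le_max lexx.
have tmx : tm m <= Num.max t (tm m) by rewrite le_max lexx orbT.
by rewrite /t1; split; lra.
Qed.

Definition late s : Prop := t1 <= s < zeta.

Let late1 : late t1. Proof. by have [_ _ h1] := t1P; rewrite /late lexx. Qed.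

Let late_stage s : late s -> tm m <= s < tm m.+1.
Proof. by move=> /andP[h1 h2]; have [_ h3 _] := t1P; rewrite (le_trans h3 h1) mS. Qed.

Let late_ge0 s : late s -> 0 <= s.
Proof.
move=> ls; have /andP[h1 _] := late_stage ls; apply: le_trans h1.
by apply: (time_ge0 rd); exact: leq_pred.
Qed.

Let L_end x : L x = pht m zeta x.
Proof. by have := phS c f m x; rewrite mS. Qed.

Let pht_le_L s x : late s -> pht m s x <= L x.
Proof. by move=> /andP[_ /ltW sz]; rewrite L_end; exact: (pht_mono rd). Qed.

Let phi0_late s : late s -> phi0 < pht m s h.
Proof.
move=> ls; have /andP[h1 h2] := late_stage ls.
have [km|km] := eqVneq k m.
  rewrite /phi0 -km !phtE ltrD2l ltr_pM2l// ltrD2r.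
  by have [h3 _ _] := t1P; apply: lt_le_trans h3 _; case/andP: ls.
apply: lt_le_trans phi0_ltS _; apply: (@le_trans _ _ (ph m h)).
  apply: (ph_le rd); rewrite leq_pred andbT.
  by rewrite ltn_neqAle km -ltnS mS.
by rewrite -(pht_start c f m h); apply: (pht_mono rd).
Qed.

Let late_address s : late s -> address c f m s h phi0.
Proof. by move=> ls; rewrite /address phi0_gt0 ltW//; exact: phi0_late. Qed.

(** Speeds are at most 1, so what is missing of an extent at time [s] is at
    most [zeta - s]. *)
Let late_reach x d : d < L x -> exists2 s, late s & d <= pht m s x.
Proof.
move=> dL; have H1 : hs m.+1 x <= 1.
  rewrite -(hs_total rd mN) (bigD1 x)//= lerDl.
  by apply: sumr_ge0 => z _; exact: (hs_ge0 rd).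
pose s := Num.max t1 (zeta - (L x - d)).
have st1 : t1 <= s by rewrite /s le_max lexx.
have sd : zeta - (L x - d) <= s by rewrite /s le_max lexx orbT.
have sz : s < zeta by rewrite gt_max; have [_ _ ->] := t1P; rewrite /=; lra.
exists s; first by rewrite /late st1.
have := L_end x; rewrite !phtE => E; have : hs m.+1 x * (zeta - s) <= zeta - s.
  by rewrite -[leRHS]mul1r ler_wpM2r// subr_ge0 ltW.
move: E; move: (hs _ x) (ph m x) (L x) (tm m) dL sd => H P l T dL sd E.
have : H * (zeta - s) = H * (zeta - T) - H * (s - T) by ring.
lra.
Qed.

Definition behind : set (gspace G) := \bigcup_(s in late) trunk rd m s h phi0.
Definition ahead : set (gspace G) := \bigcup_(s in late) crown rd m s h phi0.

Let basinE y : f 0 y -> basin_union f y = \bigcup_(s in late) tree rd m s y.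
Proof.
move=> fy; apply/seteqP; split=> p.
  move=> [s /= /andP[s0 sz] [B [By Bs cB] Bp]].
  have ls : late (Num.max s t1).
    have [_ _ h1] := t1P; rewrite /late le_max lexx orbT gt_max h1 andbT/=.
    by rewrite (time_end rd).
  exists (Num.max s t1) => //.
  rewrite -(tree_component maxf mN (late_stage ls) fy); exists B => //; split=> // q /Bs.
  by apply: (flood_mono rd); rewrite s0 le_max lexx.
move=> [s ls]; rewrite -(tree_component maxf mN (late_stage ls) fy) => cp.
by exists s => //=; rewrite late_ge0//= -(time_end rd); case/andP: ls.
Qed.

Let closure_min (A B : set (gspace G)) : closed B -> A `<=` B -> closure A `<=` B.
Proof. by move=> cB AB; rewrite (iffLR (closure_id B) cB); exact: closureS. Qed.

Let tip_origin y : f 0 y -> basin f y v -> origin rd h = y.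
Proof.
move=> fy; have /[apply] : basin f y `<=` [set p | exists2 x, origin rd x = y & hseg x 0 (L x) p].
  apply: closure_min; first by apply: closed_finU => x _; exact: hseg_closed.
  rewrite basinE// => p [s ls [x [sx xo] [d /andP[d0 dp] ->]]]; exists x => //.
  by exists d => //; rewrite d0 (le_trans dp (pht_le_L x ls)).
move=> [x xo [d /andP[d0 dL] E]].
have dw : 0 <= d <= hwidth x by rewrite d0 (le_trans dL).
have [[<- _]//|[xE dE]] := hpt_mid_inj c0 cl cs (esym E) phi0_w dw.
by exfalso; move: dL; rewrite dE xE; have := ph_full rd h; have := phi0_L; lra.
Qed.

Let ahead_connected : connected ahead.
Proof.
apply: bigcup_connected.
  exists (hpt h (pht m t1 h)) => s ls; left; exists (pht m t1 h) => //.
  rewrite phi0_late//=; apply: (pht_mono rd) => //; by case/andP: ls.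
by move=> s ls; apply: (crown_connected mN (late_stage ls) (late_address ls)); exact: phi0_late.
Qed.

Let behind_connected : connected behind.
Proof.
apply: bigcup_connected; last first.
  by move=> s ls; exact: (trunk_connected mN (late_stage ls) (late_address ls)).
by exists (origin rd h) => s ls; exact: (trunk_origin rd mN (late_stage ls) (late_address ls)).
Qed.

(** All that lies ahead of the tip is flooded through this arm, and
    [hs_speed_at] gives its length. *)
Lemma branch_length y C : f 0 y -> basin f y (tip j t) -> branch f y (tip j t) C ->
  0 < speed j /\ total_length C = speed j * (zeta - t).
Proof.
have [-> _] := tip_along rd kN shk t jh; rewrite -/phi0 -/v.
have <- := hs_arm rd kN shk jh.
move=> fy bv [nCy comp]; split=> //; have oy := tip_origin fy bv.
have vE : [set v] = hseg h phi0 phi0.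
  apply/seteqP; split=> [p ->|p [d dd ->]]; first by exists phi0; rewrite ?lexx.
  by congr hpt; apply/eqP; rewrite eq_le andbC.
have cv : closed [set v].
  by rewrite vE; apply: hseg_closed => //; [exact: ltW|case/andP: phi0_w => _ /ltW].
have aheadB : ahead `<=` basin_union f y `\ v.
  rewrite basinE// -oy => p [s ls cp]; split.
    by exists s => //; exact: (crown_tree mN (late_stage ls) (late_address ls)).
  move=> /= pv; apply: (crown_cut maxf mN (late_stage ls) (late_address ls) (phi0_late ls)).
  by rewrite -/v -pv.
have behindB : behind `<=` basin_union f y `\ v.
  rewrite basinE// -oy => p [s ls cp]; split.
    by exists s => //; exact: (trunk_tree mN (late_stage ls) (late_address ls)).
  move=> /= pv; apply: (trunk_cut maxf mN (late_stage ls) (late_address ls)).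
  by rewrite -/v -pv.
have Bsides : basin_union f y `<=` ahead `|` behind `|` [set v].
  rewrite basinE// -oy => p [s ls /(tree_sides phi0)[[tp|cp]|->]]; last by right.
    by left; right; exists s.
  by left; left; exists s.
have sub : basin_union f y `<=` basin f y by exact: subset_closure.
have By : behind y.
  by exists t1 => //; rewrite -oy; exact: (trunk_origin rd mN (late_stage late1) (late_address late1)).
have [UC CU] : ahead `<=` C /\ C `<=` closure ahead.
  case: comp => -[p Xp CE].
    apply: (component_side (X := basin f y) ahead_connected behind_connected By cv) => //.
    - by move=> q /aheadB[/sub].
    - by move=> q /behindB[/sub].
    - exact: closureS.
    - by exists p.
  apply: (component_side (X := basin_union f y) ahead_connected behind_connected By cv) => //.
  - by move=> q /Bsides; exact: subset_closure.
  - by exists p.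
pose s0 x := if x == h then phi0 else 0.
pose p0 x := if desc x h then L x else 0.
have CF : C `<=` [set p | exists2 x, desc x h & hseg x (s0 x) (L x) p].
  move=> p /CU; apply: closure_min.
    by apply: closed_finU => x _; apply: hseg_closed => //; rewrite /s0; case: ifP => // _; exact: ltW.
  move=> q [s ls [[d /andP[d0 dp] ->]|[x [sx /andP[xh ne]] [d /andP[d0 dp] ->]]]].
    exists h; first exact: desc_refl.
    by exists d => //; rewrite /s0 eqxx ltW//= (le_trans dp (pht_le_L h ls)).
  by exists x => //; exists d => //; rewrite /s0 (negbTE ne) d0 (le_trans dp (pht_le_L x ls)).
rewrite (total_length_half c0 cl cs (s := s0) (p := p0)).
- rewrite sumrB /p0 -big_mkcond /= -/(a h) /s0 -big_mkcond big_pred1_eq.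
  by rewrite -(hs_speed_at maxf t kN hs0) hookE; rewrite -/phi0; ring.
- move=> x; rewrite /s0 /p0; case: eqP => [->|_]; first by rewrite desc_refl !ltW.
  by case: ifP => _; rewrite lexx ?L_ge0.
- move=> x; have p0L z : p0 z <= L z by rewrite /p0; case: ifP.
  by apply: le_trans (lerD (p0L x) (p0L (flip x))) _; rewrite (ph_full rd).
- move=> x d /andP[sd]; rewrite /p0; case: ifP => [xh dL|_]; last first.
    by move=> d0; move: sd; rewrite /s0; case: eqP => _ h1;
      have := lt_trans h1 d0; rewrite ?ltxx// ltNge ltW.
  apply: UC; have [s ls ds] := late_reach dL; exists s => //.
  move: sd; rewrite /s0; case: eqP => [xE|/eqP ne] sd.
    by left; exists d; rewrite ?xE// sd -xE.
  right; apply: (mem_arms rd mN (late_stage ls)); first by apply/andP.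
  by rewrite /address sd.
- move=> p /CF[x xh [d dd ->]]; exists x, d; split=> //; by rewrite /p0 xh.
Qed.

End Branch.

(** * Readings of an optimal flooding *)

Section Readings.
Context {R : realType} {G : metricGraph R}.
Implicit Types (s : seq (edge G * R)) (e : edge G) (x : R) (f : flooding_data G).

Definition spots s e : seq R := sort <=%R [seq r.2 | r <- s & r.1 == e].
Definition spot_count s e : nat := size (spots s e).
Definition spot_grid s e i : R := nth (len e) (0 :: spots s e) i.

Lemma mem_spots s e x : (x \in spots s e) = ((e, x) \in s).
Proof.
rewrite mem_sort; apply/mapP/idP => [[[e' x'] + ->]|sx].
  by rewrite mem_filter /= => /andP[/eqP ->].
by exists (e, x); rewrite // mem_filter eqxx.
Qed.

Lemma spots_sorted s e : sorted <=%R (spots s e).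
Proof. exact/sort_sorted/le_total. Qed.

Lemma sum_spot_count s : (\sum_e spot_count s e = size s)%N.
Proof.
rewrite (eq_bigr (fun e => count (fun r => r.1 == e) s)); last first.
  by move=> e _; rewrite /spot_count size_sort size_map size_filter.
elim: s => [|r s IH] /=; first by rewrite big1.
rewrite big_split /= IH (bigD1 r.1)//= eqxx big1 ?addn0// => e.
by rewrite eq_sym => /negbTE ->.
Qed.

Lemma spots_reading s f : is_flooding f -> (0 < size s)%N ->
  (forall r, r \in s -> in_edge r.1 r.2) ->
  (forall p, f 0 p <-> exists2 r, r \in s & p = pt r.1 r.2) ->
  reading (spot_count s) (spot_grid s) f.
Proof.
move=> ff s0 sin src.
have gridS e i : (i < spot_count s e)%N -> (e, spot_grid s e i.+1) \in s.
  by move=> ie; rewrite -mem_spots /spot_grid /= mem_nth.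
have bd e i : (i < spot_count s e)%N -> in_edge e (spot_grid s e i.+1).
  by move=> /gridS/sin.
split=> //.
- by move=> e; rewrite /spot_grid nth_default//= ltnS.
- move=> e [|i] ie; rewrite /spot_grid.
    have [z|p] := posnP (spot_count s e); first by rewrite /= nth_default ?ltW ?len_gt0// -/(spot_count s e) z.
    by move: (bd e 0%N p); rewrite /in_edge /spot_grid => /andP[].
  move: ie; rewrite leq_eqVlt => /orP[/eqP ie|ie].
    rewrite [leRHS]nth_default; last by rewrite /= -/(spot_count s e) ie.
    by have := bd e i; rewrite -ie ltnSn => /(_ isT); rewrite /in_edge /spot_grid => /andP[].
  rewrite /=; apply: (sorted_leq_nth le_trans lexx _ (spots_sorted s e)); rewrite ?inE//.
  exact: ltnW.
- move=> p; split=> [/src[[e x] rs ->]|[h /start_None-/(_ (spot_grid s))[e [[|i] [ie he hc]]] ->]]; last 2 first.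
  + by [].
  + by apply/src; exists (e, spot_grid s e i.+1); [exact: gridS|rewrite /hpt he hc].
  have xs : x \in spots s e by rewrite mem_spots.
  have ix : (index x (spots s e) < spot_count s e)%N by rewrite index_mem.
  have [r [re ri]] := @region_at R G (spot_count s) e _ ix.
  exists (r, true); first by rewrite /start /= ri.
  by rewrite /hpt /hedge /coord /= /rlo re ri addr0 /spot_grid /= nth_index.
- by case: s s0 src {sin gridS bd} => // r s _ src; exists (pt r.1 r.2); apply/src; exists r; rewrite ?mem_head.
Qed.

(** The flooding that fills the forest of the reading is a competitor with
    the same number of sources. *)
Lemma optimal_max s f M (rd : reading (spot_count s) (spot_grid s) f) :
  (0 < M)%N -> size s = M -> optimal_flooding M f ->
  forall L, generic (hedge (n:=spot_count s)) (@len R G) (opp (par rd)) L ->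
  xln (time f (nstages f)) - hook_cost (up (par rd)) L <= entropy f.
Proof.
move=> M0 sM [_ fmax] L gL; rewrite (time_end rd) -(totalE gL).
have tot : 0 < total L.
  rewrite (totalE gL) -(time_end rd).
  have [N0|N0] := posnP (nstages f); last by rewrite -(time0 rd) (time_lt rd)// N0 leqnn.
  have [e _] : exists e : edge G, True.
    by have [p _] := reading_ex rd; have [e _] := gspace_ptP p; exists e.
  by rewrite (time_end rd) /graph_length (bigD1 e)//= ltr_pwDl ?len_gt0// sumr_ge0// => e' _; exact/ltW/len_gt0.
have pe := par_end rd; have rp := @arrival_par _ _ _ _ _ rd.
rewrite -(filling_entropy pe rp gL tot) -lee_fin fmax; apply: ereal_sup_ubound.
exists (filling_data (par rd) L) => //; exists M; first by rewrite M0 leqnn.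
split; first exact: (filling_is_flooding pe rp gL tot).
by have := filling_card pe rp gL tot; rewrite sum_spot_count sM.
Qed.

(** Sources read at the same place would be neighbours at distance zero. *)
Lemma spots_uniq s f (rd : reading (spot_count s) (spot_grid s) f) e :
  (forall L, generic (hedge (n:=spot_count s)) (@len R G) (opp (par rd)) L ->
    xln (time f (nstages f)) - hook_cost (up (par rd)) L <= entropy f) ->
  uniq (spots s e).
Proof.
move=> maxf; apply: contraT => /(uniqPn (len e))[i [j [ij js E]]].
have iS : (i.+1 < spot_count s e)%N by exact: leq_ltn_trans ij js.
have [r [re ri]] := @region_at R G (spot_count s) e i.+1 (ltnW iS).
have := gap_gt0 maxf (h := (r, true)); rewrite /start /flip /= ri => /(_ erefl).
rewrite /hedge /= re ltn_eqF// => /(_ erefl); rewrite /hwidth /width /rlo /rhi /= re ri /spot_grid /=.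
rewrite subr_gt0 E ltNge => /negP[].
apply: (sorted_leq_nth le_trans lexx _ (spots_sorted s e)); rewrite ?inE//.
Qed.

(** Repetitions of the given place pad the list when there are fewer than [M]
    sources; [spots_uniq] excludes them afterwards. *)
Lemma places_ex f K M e0 x0 : (f 0 #= `I_K)%card -> (K <= M)%N ->
  in_edge e0 x0 -> f 0 (pt e0 x0) -> exists s,
  [/\ size s = M, (e0, x0) \in s, forall r, r \in s -> in_edge r.1 r.2,
      forall p, f 0 p <-> exists2 r, r \in s & p = pt r.1 r.2
    & (K < M)%N -> ~~ uniq (spots s e0)].
Proof.
move=> cK KM ex0 f0.
have [g [gf gi gs]] : exists g : nat -> gspace G, set_bij `I_K (f 0) g.
  pose pT : pointedType := HB.pack_for pointedType (gspace G) (isPointed.Build (gspace G) (pt e0 x0)).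
  by apply: (card_set_bijP (U := pT)); rewrite card_eq_sym.
have [i0 i0K gi0] := gs _ f0.
have rep (p : gspace G) : exists r : edge G * R, in_edge r.1 r.2 /\ p = pt r.1 r.2.
  by have [e [x [ex ->]]] := gspace_ptP p; exists (e, x).
pose q i := if i == i0 then (e0, x0) else projT1 (cid (rep (g i))).
have qP i : in_edge (q i).1 (q i).2 /\ g i = pt (q i).1 (q i).2.
  by rewrite /q; case: eqP => [->|_]; [rewrite gi0|case: cid].
have q0 : (e0, x0) \in [seq q i | i <- iota 0 K].
  by apply/mapP; exists i0; rewrite ?mem_iota// /q eqxx.
exists ([seq q i | i <- iota 0 K] ++ nseq (M - K) (e0, x0)); split.
- by rewrite size_cat size_map size_iota size_nseq subnKC.
- by rewrite mem_cat q0.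
- by move=> r; rewrite mem_cat => /orP[/mapP[i _ ->]|/nseqP[-> _]//]; case: (qP i).
- move=> p; split=> [/gs[i iK <-]|[r]].
    exists (q i); last by case: (qP i).
    by rewrite mem_cat map_f// mem_iota.
  rewrite mem_cat => /orP[/mapP[i + ->] ->|/nseqP[-> _] ->//].
  by rewrite mem_iota /= => iK; have [_ <-] := qP i; exact: gf.
move=> KltM; apply/negP => u.
have : (count_mem x0 (spots ([seq q i | i <- iota 0 K] ++ nseq (M - K) (e0, x0)) e0) <= 1)%N.
  by rewrite count_uniq_mem//; case: (_ \in _).
rewrite /spots count_sort count_map count_filter /= (eq_count (a2 := pred1 (e0, x0))); last first.
  by move=> [e x] /=; rewrite xpair_eqE andbC.
rewrite count_cat leqNgt => /negP[]; rewrite -addn1 leq_add//.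
  by rewrite -has_count has_pred1.
by rewrite count_nseq /= eqxx mul1n subn_gt0.
Qed.

End Readings.


(** Fewer than [M] sources would allow a reading with a repeated one, which
    optimality forbids. *)
Lemma optimal_reading (R : realType) (G : metricGraph R) (M : nat) (f : flooding_data G)
    (e0 : edge G) (x0 : R) :
  (0 < M)%N -> optimal_flooding M f -> in_edge e0 x0 -> f 0 (pt e0 x0) ->
  (f 0 #= `I_M)%card /\ exists (n : edge G -> nat) (c : edge G -> nat -> R) (rd : reading n c f),
    (forall L, generic (hedge (n:=n)) (@len R G) (opp (par rd)) L ->
      xln (time f (nstages f)) - hook_cost (up (par rd)) L <= entropy f) /\
    exists2 r : half n, start r = None & hedge r = e0 /\ coord c r 0 = x0.
Proof.
move=> M0 opt ex0 f0; have [[K /andP[K0 KM] [ff cK]] _] := opt.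
have [s [sM s0 sin src dup]] := places_ex cK KM ex0 f0.
have rd : reading (spot_count s) (spot_grid s) f by apply: spots_reading; rewrite ?sM.
have maxf := optimal_max (rd := rd) M0 sM opt.
split.
  have /eqP <- // : K == M.
  by rewrite eqn_leq KM leqNgt; apply/negP => /dup; rewrite (spots_uniq e0 maxf).
exists (spot_count s), (spot_grid s), rd; split=> //.
have xs : x0 \in spots s e0 by rewrite mem_spots.
have ix : (index x0 (spots s e0) < spot_count s e0)%N by rewrite index_mem.
have [r [re ri]] := @region_at R G (spot_count s) e0 _ ix.
exists (r, true); first by rewrite /start /= ri.
by rewrite /hedge /coord /= /rlo re ri addr0 /spot_grid /= nth_index.
Qed.

Theorem theorem4p6 (R : realType) (G : metricGraph R) (M : nat)
    (hM : (1 <= M)%N) (f : flooding_data G) (hf : optimal_flooding M f) :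
  (* (i) *)
  (forall k k', (1 <= k <= k')%N -> (k' <= nstages f)%N ->
     (narms f k <= narms f k')%N) /\
  (* (ii) *)
  ~ has_dormant_arm f /\
  (* (iii) *)
  (forall t : R, 0 <= t < graph_length G -> forall v p,
     vdegree v = 1%N -> is_vertex_point v p -> ~ f t p) /\
  (* (iv) *)
  (forall t : R, 0 <= t < graph_length G ->
     ([set C | is_component (f t) C] #= `I_M)%card) /\
  (* (v) *)
  (forall t : R, 0 <= t < graph_length G -> ~ has_loop (f t)) /\
  (* (vi) *)
  (forall t : R, 0 <= t < graph_length G ->
     f 0 = [set v | exists2 T, is_component (f t) T & is_centroid T v]) /\
  (* (vii) *)
  (forall (y : gspace G) (k : nat) (t : R) (i j : 'I_(narms f k))
          (Sv Sw : set (gspace G)),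
     f 0 y -> (1 <= k <= nstages f)%N -> time f k.-1 < t < time f k ->
     (boundary (f t) `&` basin f y) (tip i t) ->
     (boundary (f t) `&` basin f y) (tip j t) ->
     branch f y (tip i t) Sv ->
     branch f y (tip j t) Sw ->
     [/\ speed i != 0, total_length Sv != 0
       & speed j / speed i = total_length Sw / total_length Sv]) /\
  (* (viii) *)
  (forall (y1 y2 : gspace G) (k : nat) (t : R) (i j : 'I_(narms f k))
          (Sv Sw : set (gspace G)),
     f 0 y1 -> f 0 y2 ->
     (1 <= k <= nstages f)%N -> time f k.-1 < t < time f k ->
     (boundary (f t) `&` basin f y1) (tip i t) ->
     (boundary (f t) `&` basin f y2) (tip j t) ->
     branch f y1 (tip i t) Sv ->
     branch f y2 (tip j t) Sw ->
     [/\ speed i != 0, total_length Sv != 0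
       & speed j / speed i = total_length Sw / total_length Sv]).
Proof.
have [e0 [x0 [ex0 f0]]] : exists (e : edge G) (x : R), in_edge e x /\ f 0 (pt e x).
  have [[K /andP[K0 _] [_ cK]] _] := hf; apply: contrapT => nx.
  have E : f 0 = set0.
    apply/seteqP; split=> // p f0p; have [e [x [ex E]]] := gspace_ptP p.
    by apply: nx; exists e, x; rewrite -E.
  by move: cK; rewrite E card_eq_sym card_eq0 => /eqP/seteqP[H _]; exact: (H 0%N K0).
have [cM [n [c [rd [maxf _]]]]] := optimal_reading hM hf ex0 f0.
have zE := time_end rd.
have stage t : 0 <= t < graph_length G ->
    exists2 k, (k < nstages f)%N & time f k <= t < time f k.+1.
  by rewrite -zE => /(time_stage rd).
have balanced k t (kN : (k < nstages f)%N) (tt : time f k <= t < time f k.+1) (j : 'I_(narms f 1)) :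
    2 * speed j * t <= total_length (connected_component (f t) (anchor (farm j))).
  have N0 : (0 < nstages f)%N by exact: leq_trans kN.
  have [h [fh lt] jE] := arm_active rd N0 (shape_at rd (leq0n _)) j.
  have aE : farm j = arm_of c h 0 by rewrite jE ph0.
  have ein : in_edge (aedge (farm j)) (acoord (farm j)).
    by rewrite aE; exact: (node_in rd).
  have fa : f 0 (pt (aedge (farm j)) (acoord (farm j))).
    by move: fh; rewrite aE (time0 rd).
  (* The source at the anchor of [j] is now placed on the edge of [j]. *)
  have [_ [n' [c' [rd' [maxf' [r rN [re rc]]]]]]] := optimal_reading hM hf ein fa.
  have [h' ah' jE'] := arm_active rd' N0 (shape_at rd' (leq0n _)) j.
  have aE' : farm j = arm_of c' h' 0 by rewrite jE' ph0.
  have jh' : along c' h' (farm j).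
    by rewrite jE'; exact: (active_along (shape_at rd' (leq0n _))).
  apply: (root_arm_balance maxf' kN tt jh').
  apply: (root_start rd' rN); [by rewrite re aE'|by rewrite rc aE'|].
  by have [_ ] := ah'; rewrite !ph0 addr0.
have rates k t (i j : 'I_(narms f k)) y1 y2 (Sv Sw : set (gspace G)) :
    f 0 y1 -> f 0 y2 -> (1 <= k <= nstages f)%N -> time f k.-1 < t < time f k ->
    basin f y1 (tip i t) -> basin f y2 (tip j t) ->
    branch f y1 (tip i t) Sv -> branch f y2 (tip j t) Sw ->
    [/\ speed i != 0, total_length Sv != 0
      & speed j / speed i = total_length Sw / total_length Sv].
  case: k i j => [//|k] i j fy1 fy2 /= kN tt bi bj bv bw.
  have len1 (l : 'I_(narms f k.+1)) y C : f 0 y -> basin f y (tip l t) -> branch f y (tip l t) C ->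
      0 < speed l /\ total_length C = speed l * (time f (nstages f) - t).
    have [h ah lE] := arm_active rd kN (shape_at rd (ltnW kN)) l.
    apply: (branch_length maxf kN tt (h := h)).
    by rewrite lE; exact: (active_along (shape_at rd (ltnW kN))).
  have [si ->] := len1 i y1 Sv fy1 bi bv; have [sj ->] := len1 j y2 Sw fy2 bj bw.
  have rem : 0 < time f (nstages f) - t.
    rewrite subr_gt0; case/andP: tt => _ h; apply: lt_le_trans h _.
    by apply: (time_le rd); rewrite kN leqnn.
  split; [exact: lt0r_neq0|by apply: lt0r_neq0; exact: mulr_gt0|].
  by rewrite invfM mulrACA divff ?mulr1// lt0r_neq0.
split.
  move=> k k' /andP[k1 kk']; rewrite -(subnKC kk'); elim: (k' - k)%N => [|d IH]; first by rewrite addn0.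
  rewrite addnS => dN; apply: leq_trans (IH (ltnW dN)) _.
  case: k k1 kk' IH dN => // k _ _ _ dN; rewrite addSn in dN *.
  exact: (narms_mono maxf).
split; first exact: (no_dormant_arm maxf).
split; first by move=> t /stage[k kN tt] v p; exact: (no_leaf maxf kN tt).
split.
  by move=> t /stage[k kN tt]; exact: card_eq_trans (components_sources maxf kN tt) cM.
split; first by move=> t /stage[k kN tt]; exact: (no_loop maxf kN tt).
split; first by move=> t /stage[k kN tt]; exact: (centroids maxf kN tt (balanced k t kN tt)).
split.
  move=> y k t i j Sv Sw fy kN tt [_ bi] [_ bj] bv bw.
  exact: (rates k t i j y y Sv Sw).
move=> y1 y2 k t i j Sv Sw fy1 fy2 kN tt [_ bi] [_ bj] bv bw.
exact: (rates k t i j y1 y2 Sv Sw).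
Qed.
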